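(* Let $\mathfrak g=\mathfrak{sl}(m|n)$ with the distinguished positive system $\Delta^+$ and the conjugate-linear anti-involution $\omega_+$. Then $\Lambda\in\mathfrak h^*$ is the highest weight of a unitarizable highest weight $\mathfrak g$-supermodule (i.e. the simple highest weight supermodule $L(\Lambda)$ is $\omega_+$-unitarizable) if and only if the following two conditions hold: (a) $\Lambda$ satisfies the unitarity conditions. (b) If $k_0\in\{1,\dots,n\}$ is the smallest integer such that $(\Lambda,\delta_{k_0}-\delta_n)=0$, then one of the following holds: (i) $(\Lambda+\rho,\epsilon_m-\delta_k)=0$ for some $k\in\{k_0,\dots,n\}$; or (ii) $(\Lambda+\rho,\epsilon_m-\delta_n)>0$.
   Context: Setting. $m,n\ge1$ are integers with $m+n>2$. $\mathfrak g=\mathfrak{sl}(m|n)$ is the complex Lie superalgebra of block matrices $X=\begin{pmatrix}A&B\\ C&D\end{pmatrix}$ ($A$ of size $m\times m$, $D$ of size $n\times n$) with $\operatorname{tr}A-\operatorname{tr}D=0$; even part $\mathfrak g_{\bar0}$: $B=C=0$; odd part $\mathfrak g_{\bar1}$: $A=D=0$. $\mathfrak h$ is the subalgebra of diagonal matrices in $\mathfrak g$; for $H=\operatorname{diag}(h_1,\dots,h_{m+n})$ put $\epsilon_i(H)=h_i$, $\delta_k(H)=h_{m+k}$. A weight $\Lambda=\sum_i\lambda^i\epsilon_i+\sum_k\mu^k\delta_k\in\mathfrak h^*$ is written $(\lambda^1,\dots,\lambda^m|\mu^1,\dots,\mu^n)$; tuples are taken modulo multiples of $(1,\dots,1|-1,\dots,-1)$.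 The bilinear form is $(\epsilon_i,\epsilon_j)=\delta_{ij}$, $(\delta_k,\delta_l)=-\delta_{kl}$, $(\epsilon_i,\delta_k)=0$; pairings of weights with roots do not depend on the chosen tuple. Positive system (distinguished): $\Delta^+_{\bar0}=\{\epsilon_i-\epsilon_j\ (i<j),\ \delta_k-\delta_l\ (k<l)\}$, $\Delta^+_{\bar1}=\{\epsilon_i-\delta_k:1\le i\le m,1\le k\le n\}$; $\rho=\tfrac12\sum_{\alpha\in\Delta^+_{\bar0}}\alpha-\tfrac12\sum_{\alpha\in\Delta^+_{\bar1}}\alpha$. $L(\Lambda)$ is the simple highest weight $\mathfrak g$-supermodule of highest weight $\Lambda$ with respect to $\Delta^+$, with even highest weight vector. Anti-involution: $\omega_+\begin{pmatrix}A&B\\ C&D\end{pmatrix}=\begin{pmatrix}A^\dagger&C^\dagger\\ B^\dagger&D^\dagger\end{pmatrix}$, $\dagger$ = conjugate transpose. A $\mathfrak g$-supermodule $M=M_{\bar0}\oplus M_{\bar1}$ is $\omega_+$-unitarizable if it carries a positive definite Hermitian form with $M_{\bar0}\perp M_{\bar1}$ and $\langle Xv,w\rangle=\langle v,\omega_+(X)w\rangle$ for all $X\in\mathfrak g$, $v,w\in M$. Unitarizability of $\mathfrak g_{\bar0}$-modules is defined in the same way using $\omega_+|_{\mathfrak g_{\bar0}}$. Unitarity conditions on $\Lambda=(\lambda^1,\dots,\lambda^m|\mu^1,\dots,\mu^n)$: $\Lambda$ is the highest weight (with respect to $\Delta^+_{\bar0}$) of a unitarizable highest weight $\mathfrak g_{\bar0}$-module,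 and (i) $\lambda^1\ge\cdots\ge\lambda^m\ge-\mu^n\ge\cdots\ge-\mu^1$; (ii) if $(\Lambda+\rho,\epsilon_m-\delta_k)=0$ for some $k$, then $(\Lambda+\rho,\epsilon_m-\delta_j)>0$ for all $j=1,\dots,k-1$ and $(\Lambda,\delta_k-\delta_n)=0$; (iii) if $(\Lambda+\rho,\epsilon_m-\delta_k)\ne0$ for all $k=1,\dots,n$, then $(\Lambda+\rho,\epsilon_m-\delta_k)>0$ for all $k=1,\dots,n$. *)

(* Defs.v *)
(* The complex numbers are R[i] for R : realType. *)
From HB Require Import structures.
From mathcomp Require Import all_boot all_order all_algebra.
From mathcomp Require Import complex reals.

Set Implicit Arguments.
Unset Strict Implicit.
Unset Printing Implicit Defensive.

Import Order.TTheory GRing.Theory Num.Theory.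
Local Open Scope ring_scope.
Local Open Scope complex_scope.

Definition last_ord (n : nat) (hn : (0 < n)%N) : 'I_n :=
  Ordinal (etrans (ltn_predL n) hn).

Section SpecialLinearSuperalgebra.
Variables (R : realType) (m n : nat).
Local Notation C := R[i].
Local Notation mx := 'M[C]_(m + n).

Definition sl : {pred mx} :=
  [pred X : mx | \tr (ulsubmx X) - \tr (drsubmx X) == 0].

(* Parities are booleans: false is even, true is odd. *)
Definition sl_part (a : bool) : {pred mx} :=
  [pred X : mx | (X \in sl) &&
     (if a then (ulsubmx X == 0) && (drsubmx X == 0)
      else (ursubmx X == 0) && (dlsubmx X == 0))].

(* The superbracket of X and Y, for X of parity a and Y of parity b. *)
Definition sbracket (a b : bool) (X Y : mx) : mx :=
  X *m Y - (-1) ^+ (a && b) *: (Y *m X).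

Definition ctrmx p q (A : 'M[C]_(p, q)) : 'M[C]_(q, p) :=
  (map_mx Num.conj A)^T.

Definition omega_plus (X : mx) : mx :=
  block_mx (ctrmx (ulsubmx X)) (ctrmx (dlsubmx X))
           (ctrmx (ursubmx X)) (ctrmx (drsubmx X)).

(* The weight sum_i lam^i eps_i + sum_k mu^k delta_k is represented by the    *)
(* row vector row_mx lam mu; two rows that differ by a multiple of            *)
(* (1,..,1|-1,..,-1) represent the same functional on the Cartan subalgebra,  *)
(* and nothing below depends on the representative.                           *)
Definition eps (i : 'I_m) : 'rV[C]_(m + n) := delta_mx 0 (lshift n i).
Definition del (k : 'I_n) : 'rV[C]_(m + n) := delta_mx 0 (rshift m k).

Definition weight_eval (L : 'rV[C]_(m + n)) (H : mx) : C :=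
  \sum_j L 0 j * H j j.

Definition wform (L G : 'rV[C]_(m + n)) : C :=
  \sum_(i < m) L 0 (lshift n i) * G 0 (lshift n i)
  - \sum_(k < n) L 0 (rshift m k) * G 0 (rshift m k).

Definition rho : 'rV[C]_(m + n) :=
  2^-1 *: (\sum_(i < m) \sum_(j < m | (i < j)%N) (eps i - eps j)
           + \sum_(k < n) \sum_(l < n | (k < l)%N) (del k - del l))
  - 2^-1 *: (\sum_(i < m) \sum_(k < n) (eps i - del k)).

(* The strictly upper triangular matrices are the span of the root vectors    *)
(* E_ij attached to the positive roots.  They are used instead of the         *)
(* h-eigenspaces because for m = n = 2 the restrictions to h of a positive    *)
(* and of a negative odd root may coincide.                                   *)
Definition strict_upper : {pred mx} :=
  [pred X : mx | [forall i : 'I_(m + n), forall j : 'I_(m + n),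
                   (j <= i)%N ==> (X i j == 0)]].

(* The next five notions are relative to a set g of matrices (sl or its even  *)
(* part) acting on V through act, whose values outside g are irrelevant.      *)
Section Action.
Variables (g : {pred mx}) (V : lmodType C) (act : mx -> {linear V -> V}).

Definition action_linear : Prop :=
  forall (c : C) (X Y : mx) (v : V), X \in g -> Y \in g ->
    act (c *: X + Y) v = c *: act X v + act Y v.

Definition hw_vector (L : 'rV[C]_(m + n)) (v : V) : Prop :=
  [/\ v != 0,
      forall H, H \in g -> is_diag_mx H -> act H v = weight_eval L H *: v
    & forall X, X \in g -> X \in strict_upper -> act X v = 0].

Definition subspace (N : V -> Prop) : Prop :=
  N 0 /\ forall (c : C) (u v : V), N u -> N v -> N (c *: u + v).

Definition stable (N : V -> Prop) : Prop :=
  forall X v, X \in g -> N v -> N (act X v).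

Definition contravariant (f : {dot V for Num.conj}) : Prop :=
  forall X v w, X \in g -> f (act X v) w = f v (act (omega_plus X) w).

End Action.

Record even_module := EvenModule {
  em_sort : lmodType C;
  em_act : mx -> {linear em_sort -> em_sort};
  em_linear : action_linear (sl_part false) em_act;
  em_bracket : forall X Y v,
    X \in sl_part false -> Y \in sl_part false ->
    em_act (sbracket false false X Y) v
    = em_act X (em_act Y v) - em_act Y (em_act X v) }.

Definition even_highest_weight (V : even_module) (L : 'rV[C]_(m + n)) : Prop :=
  exists v : em_sort V,
    hw_vector (sl_part false) (@em_act V) L v /\
    forall N, subspace N -> stable (sl_part false) (@em_act V) N -> N v ->
      forall w, N w.

Definition even_unitarizable (V : even_module) : Prop :=
  exists f, contravariant (sl_part false) (@em_act V) f.

Definition sm_space (M0 M1 : lmodType C) : lmodType C := (M0 * M1)%type.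

(* v is homogeneous of parity a in the direct sum of M0 (even), M1 (odd). *)
Definition homogeneous (M0 M1 : lmodType C) (a : bool) (v : sm_space M0 M1) :=
  if a then v.1 == 0 else v.2 == 0.

Record supermodule := SuperModule {
  sm_even : lmodType C;
  sm_odd : lmodType C;
  sm_act : mx -> {linear sm_space sm_even sm_odd -> sm_space sm_even sm_odd};
  sm_linear : action_linear sl sm_act;
  sm_parity : forall a b X v,
    X \in sl_part a -> homogeneous b v -> homogeneous (a (+) b) (sm_act X v);
  sm_bracket : forall a b X Y v,
    X \in sl_part a -> Y \in sl_part b ->
    sm_act (sbracket a b X Y) v
    = sm_act X (sm_act Y v) - (-1) ^+ (a && b) *: sm_act Y (sm_act X v) }.

Definition sm_sort (M : supermodule) := sm_space (sm_even M) (sm_odd M).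

Definition subsupermodule (M : supermodule) (N : sm_sort M -> Prop) : Prop :=
  [/\ subspace N,
      forall v : sm_sort M, N v -> N (v.1, 0) /\ N (0, v.2)
    & stable sl (@sm_act M) N].

Definition simple_supermodule (M : supermodule) : Prop :=
  (exists v : sm_sort M, v != 0) /\
  forall N : sm_sort M -> Prop, subsupermodule N ->
    (forall v, N v -> v = 0) \/ (forall v, N v).

Definition highest_weight_supermodule (M : supermodule) (L : 'rV[C]_(m + n)) :
    Prop :=
  exists v : sm_sort M,
    [/\ homogeneous false v,
        hw_vector sl (@sm_act M) L v
      & forall N : sm_sort M -> Prop, subsupermodule N -> N v ->
          forall w, N w].

(* M is a model of L(Lambda), which is unique up to isomorphism. *)
Definition is_simple_hw (M : supermodule) (L : 'rV[C]_(m + n)) : Prop :=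
  simple_supermodule M /\ highest_weight_supermodule M L.

Definition unitarizable (M : supermodule) : Prop :=
  exists f : {dot (sm_sort M) for Num.conj},
    (forall v w : sm_sort M,
       homogeneous false v -> homogeneous true w -> f v w = 0) /\
    contravariant sl (@sm_act M) f.

Section Conditions.
Variables (hm : (0 < m)%N) (hn : (0 < n)%N) (L : 'rV[C]_(m + n)).

Let lam (i : 'I_m) : C := L 0 (lshift n i).
Let mu (k : 'I_n) : C := L 0 (rshift m k).
Let eps_m := eps (last_ord hm).
Let del_n := del (last_ord hn).

(* In the order of R[i], x <= y means that y - x is real and nonnegative, so  *)
(* the chain only involves differences that are independent of the chosen     *)
(* representative of the weight.                                              *)
Definition weight_chain : Prop :=
  [/\ forall i j : 'I_m, (i <= j)%N -> lam j <= lam i,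
      - mu (last_ord hn) <= lam (last_ord hm)
    & forall k l : 'I_n, (k <= l)%N -> - mu k <= - mu l].

Definition unitarity_conditions : Prop :=
  [/\ exists V : even_module, even_highest_weight V L /\ even_unitarizable V,
      weight_chain,
      forall k : 'I_n, wform (L + rho) (eps_m - del k) = 0 ->
        (forall j : 'I_n, (j < k)%N -> 0 < wform (L + rho) (eps_m - del j))
        /\ wform L (del k - del_n) = 0
    & (forall k : 'I_n, wform (L + rho) (eps_m - del k) <> 0) ->
      forall k : 'I_n, 0 < wform (L + rho) (eps_m - del k)].

Definition condition_b : Prop :=
  forall k0 : 'I_n,
    wform L (del k0 - del_n) = 0 ->
    (forall k : 'I_n, wform L (del k - del_n) = 0 -> (k0 <= k)%N) ->
    (exists2 k : 'I_n, (k0 <= k)%N & wform (L + rho) (eps_m - del k) = 0)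
    \/ 0 < wform (L + rho) (eps_m - del_n).

End Conditions.

End SpecialLinearSuperalgebra.

(* Main.v *)
(* Put a_k = lambda^m + mu^k + 1 - k for k = 1,..,n, the value of Lambda + rho on eps_m - delta_k.
   Necessity: applying the odd lowering operators of the roots eps_m - delta_k one after the other
   to the highest weight vector produces vectors whose squared norms are products of the a_k, and
   their nonnegativity forces either a_n > 0 or a_k = 0 for some k with mu^k = mu^n.  The
   unitarizable even module is the even submodule generated by the highest weight vector.

   Sufficiency when a_n > 0: the Kac module over the given even module V is an exterior algebra
   over V, and it carries a contravariant hermitian form F.  The sum D of Y_a X_a over the odd
   roots satisfies F(Dw, w) = sum of the F(X_a w, X_a w).  Up to the Casimir element of gl(m|n), 2 D
   is a constant minus the even Casimir, so comparing weights shows that every vector of positive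
   degree is killed by a product of factors D - c with c > 0.  Hence w = D q(D)^2 w for a real
   polynomial q, and F(w, w) = F(D u, u) with u = q(D) w, so that F is positive definite by
   induction on the degree.

   Sufficiency when a_k = 0 and mu^k = mu^n: sl_2-theory in V shows that after a shift of the
   tuple the lambda^i and mu^k are natural numbers with mu^n = 0, lambda^m = k - 1 and mu^j = 0
   for j >= k.  The module is then found in the oscillator representation of gl(m|n) on d = lambda^1
   copies of m fermions and n bosons: its highest weight vector fills lambda^i fermions of type
   i, times a product of leading minors in the bosonic variables. *)
Require Import Defs.
From HB Require Import structures.
From mathcomp Require Import all_boot all_order all_algebra.
From mathcomp Require Import complex reals boolp.
From mathcomp Require Import ring lra zify mpoly.

Set Implicit Arguments.
Unset Strict Implicit.
Unset Printing Implicit Defensive.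

Import Order.TTheory GRing.Theory Num.Theory.
Local Open Scope ring_scope.

(** * Hermitian forms and submodules *)

(** The module of the unitarity conditions may a priori be infinite-dimensional, so no spectral
    theorem is at hand. Eigenspaces of D are replaced by annihilating products of real linear
    factors, the square root of a positive operator by a polynomial, and integrality comes from the
    Archimedean property. The form F exists because the exterior algebra is cofree for its
    annihilation operators: the anticommuting odd raising operators lift to a map [Phi] that turns
    them into annihilation, and F(u, w) pairs u with [Phi w] in the Fock form. Its positivity rests
    on a Casimir gap of at least 2 a_n for each odd root used. Simplicity needs no quotient: for a
    positive definite contravariant form, a vector of positive height killed by all raising
    operators is orthogonal to every image of a lowering operator, hence zero in the cyclic module.
    Both constructions are made for gl(m|n), whose matrix units satisfy one uniform relation; the
    shift of the tuple is invisible on matrices of supertrace 0. Indices start at 0 in the code, so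
    a_k reads as lam + mu k - k. *)

Definition mklin (K : nzRingType) (V W : lmodType K) (f : V -> W) (fP : linear f) :
  {linear V -> W} := HB.pack f (GRing.isLinear.Build K V W *:%R f fP).

Section Forms.
Variables (C : numClosedFieldType) (V : lmodType C).

(** Forms on submodules, Fock spaces and Kac modules are each assembled from these three facts;
    [dot_of_hform] and [hform_of_dot] translate to the library's dot products where the statement is
    met. *)
Record hform := HForm {
  hform_val :> V -> V -> C;
  hform_linl : forall a u v w, hform_val (a *: u + v) w = a * hform_val u w + hform_val v w;
  hform_herm : forall u v, hform_val u v = (hform_val v u)^*;
  hform_pos : forall u, u != 0 -> 0 < hform_val u u }.

Variable B : hform.

Lemma hform0l w : B 0 w = 0.
Proof.
have := hform_linl B 1 0 0 w; rewrite scaler0 addr0 mul1r.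
by move/(congr1 (fun x => x - B 0 w)); rewrite subrr addrK.
Qed.

Lemma hformZl a u w : B (a *: u) w = a * B u w.
Proof. by rewrite -[a *: u]addr0 hform_linl hform0l addr0. Qed.

Lemma hformDl u v w : B (u + v) w = B u w + B v w.
Proof. by rewrite -[u]scale1r hform_linl mul1r scale1r. Qed.

Lemma hformNl u w : B (- u) w = - B u w.
Proof. by rewrite -scaleN1r hformZl mulN1r. Qed.

Lemma hformBl u v w : B (u - v) w = B u w - B v w.
Proof. by rewrite hformDl hformNl. Qed.

Lemma hform_suml I (r : seq I) (P : pred I) (F : I -> V) w :
  B (\sum_(i <- r | P i) F i) w = \sum_(i <- r | P i) B (F i) w.
Proof.
apply: (big_morph (fun u => B u w)) => [u v|]; first exact: hformDl.
exact: hform0l.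
Qed.

Lemma hform0r w : B w 0 = 0.
Proof. by rewrite hform_herm hform0l rmorph0. Qed.

Lemma hformZr a u w : B u (a *: w) = a^* * B u w.
Proof. by rewrite hform_herm hformZl rmorphM /= -hform_herm. Qed.

Lemma hformDr u v w : B u (v + w) = B u v + B u w.
Proof. by rewrite hform_herm hformDl rmorphD /= -!hform_herm. Qed.

Lemma hformNr u w : B u (- w) = - B u w.
Proof. by rewrite hform_herm hformNl rmorphN /= -!hform_herm. Qed.

Lemma hformBr u v w : B u (v - w) = B u v - B u w.
Proof. by rewrite hformDr hformNr. Qed.

Lemma hform_sumr I (r : seq I) (P : pred I) (F : I -> V) w :
  B w (\sum_(i <- r | P i) F i) = \sum_(i <- r | P i) B w (F i).
Proof.
apply: (big_morph (fun u => B w u)) => [u v|]; first exact: hformDr.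
exact: hform0r.
Qed.

Lemma hform_ge0 u : 0 <= B u u.
Proof.
by have [->|/(hform_pos B)/ltW//] := eqVneq u 0; rewrite hform0l.
Qed.

Lemma hform_eq0 u : (B u u == 0) = (u == 0).
Proof.
apply/idP/eqP => [Bu|->]; last by rewrite hform0l.
by apply: contraTeq Bu => /(hform_pos B)/lt0r_neq0.
Qed.

Let hform_bilin : bilinear_for *%R (Num.conj \; *%R) B.
Proof.
split=> [w a u v|u a v w]; first exact: hform_linl.
by rewrite /= hformDr hformZr.
Qed.

Let hform_herm_eps u v : B u v = (-1) ^+ false * (B v u)^*.
Proof. by rewrite expr0 mul1r -hform_herm. Qed.

Lemma dot_of_hform : {f : {dot V for Num.conj} | forall u v, f u v = B u v}.
Proof.
pose b1 := bilinear_isBilinear.Build C V V C *%R (Num.conj \; *%R) B hform_bilin.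
pose b2 := isHermitianSesquilinear.Build C V false Num.conj B hform_herm_eps.
pose b3 := isDotProduct.Build C V B (hform_pos B).
pose f : {dot V for Num.conj} := HB.pack (hform_val B) b1 b2 b3.
by exists f.
Qed.

End Forms.

Lemma hform_of_dot (C : numClosedFieldType) (V : lmodType C) (f : {dot V for Num.conj}) :
  {B : hform V | forall u v, B u v = f u v}.
Proof.
have fl a u v w : f (a *: u + v) w = a * f u w + f v w.
  by rewrite linearDl linearZl_LR.
have fh u v : f u v = (f v u)^* by rewrite hermC expr0 mul1r.
by exists (HForm fl fh (@neq0_dnorm_gt0 _ _ _ f)).
Qed.

Definition submod (K : nzRingType) (V : lmodType K) (N : V -> Prop) : Prop :=
  N 0 /\ forall (c : K) (u v : V), N u -> N v -> N (c *: u + v).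

Section SubmodTheory.
Variables (K : nzRingType) (V : lmodType K) (N : V -> Prop).
Hypothesis hN : submod N.

Lemma submodD u v : N u -> N v -> N (u + v).
Proof. by move=> Nu Nv; rewrite -[u]scale1r; apply: hN.2. Qed.

Lemma submodZ a u : N u -> N (a *: u).
Proof. by move=> Nu; rewrite -[_ *: _]addr0; apply: hN.2 => //; apply: hN.1. Qed.

Lemma submodN u : N u -> N (- u).
Proof. by rewrite -scaleN1r; apply: submodZ. Qed.

Lemma submodB u v : N u -> N v -> N (u - v).
Proof. by move=> Nu /submodN; apply: submodD. Qed.

Lemma submod_sum I (r : seq I) (P : pred I) (F : I -> V) :
  (forall i, P i -> N (F i)) -> N (\sum_(i <- r | P i) F i).
Proof. by move=> NF; apply: big_ind => //; [exact: hN.1 | exact: submodD]. Qed.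

(** The closure proof is an argument of the predicate, so that the module structure can be attached
    to a set [N] known to be closed by hypothesis only. *)
Definition submod_pred (_ : submod N) : {pred V} := fun v => `[<N v>].

Fact submod_pred_closed : submod_closed (submod_pred hN).
Proof.
split; first by apply/asboolP; exact: hN.1.
by move=> c u v /asboolP Nu /asboolP Nv; apply/asboolP; apply: hN.2.
Qed.

HB.instance Definition _ :=
  GRing.isSubmodClosed.Build K V (submod_pred hN) submod_pred_closed.

Record submod_sort := SubmodElt {
  submod_val : V; submod_valP : submod_val \in submod_pred hN }.

HB.instance Definition _ := [isSub for submod_val].
HB.instance Definition _ := [Choice of submod_sort by <:].
HB.instance Definition _ := [SubChoice_isSubLmodule of submod_sort by <:].

Lemma submod_prop (x : submod_sort) : N (val x).
Proof. by apply/asboolP; exact: submod_valP. Qed.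

Definition submod_elt v (Nv : N v) : submod_sort := SubmodElt (introT (asboolP (N v)) Nv).

Lemma submod_valD (x y : submod_sort) : val (x + y) = val x + val y.
Proof. by rewrite raddfD. Qed.

Lemma submod_valZ c (x : submod_sort) : val (c *: x) = c *: val x.
Proof. by rewrite linearZ. Qed.

Lemma submod_val0 : val (0 : submod_sort) = 0.
Proof. by rewrite raddf0. Qed.

End SubmodTheory.

Lemma submod_ker (K : nzRingType) (V W : lmodType K) (f : {linear V -> W}) :
  submod (fun v => f v = 0).
Proof. by split=> [|c u v fu fv]; rewrite ?linear0 ?linearP //= fu fv scaler0 addr0. Qed.

Lemma submod_pre (K : nzRingType) (V W : lmodType K) (f : {linear V -> W}) N :
  submod N -> submod (fun v => N (f v)).
Proof.
move=> hN; split=> [|c u v Nu Nv]; first by rewrite linear0; exact: hN.1.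
by rewrite linearP; apply: hN.2.
Qed.

Lemma submod_and (K : nzRingType) (V : lmodType K) (N N' : V -> Prop) :
  submod N -> submod N' -> submod (fun v => N v /\ N' v).
Proof.
move=> hN hN'; split=> [|c u v [Nu N'u] [Nv N'v]]; first by split; [exact: hN.1|exact: hN'.1].
by split; [exact: hN.2|exact: hN'.2].
Qed.

Section GradedSums.
Variables (K : nzRingType) (V : lmodType K) (G : nat -> V -> Prop).
Hypothesis hG : forall p, submod (G p).

Definition gsum (w : V) : Prop :=
  exists P (f : nat -> V), (forall p, G p (f p)) /\ w = \sum_(p < P) f p.

Lemma gsum_submod : submod gsum.
Proof.
split; first by exists 0%N, (fun=> 0); split=> [p|]; [exact: (hG p).1|rewrite big_ord0].
move=> c u v [P [f [fd ->]]] [Q [g [gd ->]]].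
(* Both families are cut off to zero beyond their own length, so that one sum of length [P + Q]
   carries the combination. *)
pose tr (P : nat) (f : nat -> V) p := if (p < P)%N then f p else 0.
have trd (Q' : nat) h (hd : forall p, G p (h p)) p : G p (tr Q' h p).
  by rewrite /tr; case: ifP => // _; exact: (hG p).1.
have trE (Q' : nat) h (M : nat) : (Q' <= M)%N -> \sum_(p < M) tr Q' h p = \sum_(p < Q') h p.
  move=> QM; rewrite (big_ord_widen M h QM) [RHS]big_mkcond /=.
  by apply: eq_bigr => i _.
exists (P + Q)%N, (fun p => c *: tr P f p + tr Q g p); split.
  by move=> p; apply: (hG p).2; apply: trd.
by rewrite big_split /= -scaler_sumr !trE ?leq_addr ?leq_addl.
Qed.

Lemma gsum_in p w : G p w -> gsum w.
Proof.
move=> dw; exists p.+1, (fun q => if q == p then w else 0); split.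
  by move=> q; case: eqVneq => [->//|_]; exact: (hG q).1.
rewrite big_ord_recr /= eqxx big1 ?add0r // => i _.
by rewrite ltn_eqF.
Qed.

End GradedSums.

(* A weak form of the commutation relations of a basis (E_ij) of gl(m|n), or of its even
   part with E_ij = 0 for the odd matrix units: it is all that triangular arguments use. *)
Definition weak_comm (C : numClosedFieldType) (V : lmodType C) N
    (E : 'I_N -> 'I_N -> {linear V -> V}) : Prop :=
  forall i j k l, exists s a b : C, forall w,
    E i j (E k l w) = s *: E k l (E i j w)
      + ((j == k)%:R * a) *: E i l w + ((l == i)%:R * b) *: E k j w.

(** * Cyclic modules generated by a highest weight vector *)

Section Descend.
Variables (C : numClosedFieldType) (V : lmodType C) (N : nat).
Variable (E : 'I_N -> 'I_N -> {linear V -> V}).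
Variables (B : hform V) (L : 'I_N -> C) (v0 : V).
Hypothesis E_comm : weak_comm E.
Hypothesis E_adj : forall i j u w, B (E i j u) w = B u (E j i w).
Hypothesis E_raise : forall i j : 'I_N, (i < j)%N -> E i j v0 = 0.
Hypothesis E_diag : forall i, E i i v0 = L i *: v0.

(** The degree is the total height of the lowering operators applied to [v0]. It replaces the weight
    decomposition: one natural number is enough for the orthogonality arguments. *)
Inductive descend : nat -> V -> Prop :=
| desc_vac : descend 0 v0
| desc_low p (i j : 'I_N) w : (j < i)%N -> descend p w -> descend (p + (i - j)) (E i j w)
| desc_zero p : descend p 0
| desc_lin p a u w : descend p u -> descend p w -> descend p (a *: u + w).

Lemma descend_submod p : submod (descend p).
Proof. by split=> [|c u v]; [exact: desc_zero | exact: desc_lin]. Qed.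

(** Integer degrees, with only 0 below degree 0, let [E i j] shift the degree by [i - j] without a
    case distinction. *)
Definition descz (z : int) (w : V) : Prop :=
  if z is Posz p then descend p w else w = 0.

Lemma descz_submod z : submod (descz z).
Proof.
case: z => p; first exact: descend_submod.
by split=> // c u v -> ->; rewrite scaler0 addr0.
Qed.

Lemma descz_low z (i j : 'I_N) w : (j < i)%N -> descz z w ->
  descz (z + i%:Z - j%:Z) (E i j w).
Proof.
case: z => p ji /=.
  move=> dw; have -> : p%:Z + i%:Z - j%:Z = (p + (i - j))%N by lia.
  exact: desc_low.
by move=> ->; rewrite linear0; exact: (descz_submod _).1.
Qed.

(** Pulling [E i j] past the outermost lowering operator leaves correction terms [E i l] and [E k j]
    of the same total height on a shorter word; the induction hypothesis covers them whatever their
    coefficients. *)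
Lemma descend_E p w (i j : 'I_N) : descend p w -> descz (p%:Z + i%:Z - j%:Z) (E i j w).
Proof.
move=> dw; elim: dw i j => {p w} [i j|p k l w lk dw IH i j|p i j|p a u w _ IHu _ IHw i j].
- case: (ltngtP i j) => ij.
  + by rewrite E_raise //; exact: (descz_submod _).1.
  + by rewrite add0r; exact: (descz_low (z := 0) ij desc_vac).
  + move/val_inj: ij => <-; rewrite addrK E_diag.
    by apply: (submodZ (descz_submod _)); exact: desc_vac.
- have [s [a [b ->]]] := E_comm i j k l.
  have -> : (p + (k - l))%:Z + i%:Z - j%:Z = p%:Z + i%:Z - j%:Z + k%:Z - l%:Z by lia.
  apply: (submodD (descz_submod _)); first apply: (submodD (descz_submod _)).
  + by apply: (submodZ (descz_submod _)); apply: descz_low.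
  + have [->|] := eqVneq j k; last by move=> _; rewrite mul0r scale0r; exact: (descz_submod _).1.
    apply: (submodZ (descz_submod _)).
    by have -> : p%:Z + i%:Z - k%:Z + k%:Z - l%:Z = p%:Z + i%:Z - l%:Z by lia.
  + have [->|] := eqVneq l i; last by move=> _; rewrite mul0r scale0r; exact: (descz_submod _).1.
    apply: (submodZ (descz_submod _)).
    by have -> : p%:Z + i%:Z - j%:Z + k%:Z - i%:Z = p%:Z + k%:Z - j%:Z by lia.
- by rewrite linear0; exact: (descz_submod _).1.
- by rewrite linearP; exact: (descz_submod _).2.
Qed.

Lemma descend_vac_orth p w : descend p w -> (0 < p)%N -> B v0 w = 0.
Proof.
elim=> {p w} [//|p i j w ji _ _ _|p _|p a u w _ IHu _ IHw p0]; last 2 first.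
- by rewrite hform0r.
- by rewrite hformDr hformZr IHu // IHw // mulr0 addr0.
by rewrite -E_adj E_raise // hform0l.
Qed.

(** Lowering operators move to the other argument, where their adjoints reduce the degree, until
    [v0] is left; [v0] is orthogonal to images of lowering operators because the adjoints kill
    it. *)
Lemma descend_orth p q u w : descend p u -> descend q w -> p != q -> B u w = 0.
Proof.
move=> du dw pq.
suff: forall z x, z != p%:Z -> descz z x -> B u x = 0.
  by move=> /(_ q%:Z w); apply=> //; rewrite eqz_nat eq_sym.
elim: du => {p q u w dw pq} [[q|q] x // z0 dx|p i j w ji _ IH z x zp dx|p z x _ _|p a u w _ IHu _ IHw z x zp dx].
- by apply: descend_vac_orth dx _; rewrite lt0n.
- by rewrite dx hform0r.
- rewrite E_adj; case: z zp dx => q zp dx; last by rewrite dx linear0 hform0r.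
  by apply: IH (descend_E j i dx); lia.
- by rewrite hform0l.
- by rewrite hform_linl (IHu z) // (IHw z) // mulr0 addr0.
Qed.

Lemma descend_singular p w : (0 < p)%N -> descend p w ->
  (forall i j : 'I_N, (i < j)%N -> E i j w = 0) -> w = 0.
Proof.
move=> p0 dw sw; apply/eqP; rewrite -(hform_eq0 B).
suff: forall q x, descend q x -> (0 < q)%N -> B w x = 0 by move=> /(_ _ _ dw p0) ->.
move=> q x; elim=> {q x} [//|q i j x ji _ _ _|q _|q a x y _ IHx _ IHy q0].
- by rewrite -E_adj sw // hform0l.
- by rewrite hform0r.
- by rewrite hformDr hformZr IHx // IHy // mulr0 addr0.
Qed.

Lemma descend0 w : descend 0 w -> exists c, w = c *: v0.
Proof.
move eqp : 0%N => p dw; elim: dw eqp => {p w} [_|p i j w ji _ _|p _|p a u w _ IHu _ IHw p0].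
- by exists 1; rewrite scale1r.
- lia.
- by exists 0; rewrite scale0r.
- have [c ->] := IHu p0; have [d ->] := IHw p0.
  by exists (a * c + d); rewrite scalerDl scalerA.
Qed.

Definition cyc : V -> Prop := gsum descend.

Lemma cyc_submod : submod cyc.
Proof. exact: gsum_submod descend_submod. Qed.

Lemma descend_cyc p w : descend p w -> cyc w.
Proof. exact: gsum_in descend_submod _ _. Qed.

Lemma cyc_E i j w : cyc w -> cyc (E i j w).
Proof.
move=> [P [f [fd ->]]]; rewrite linear_sum; apply: (submod_sum cyc_submod) => p _.
have := descend_E i j (fd p).
case: (_ - _)%R => q; first exact: descend_cyc.
by rewrite /= => ->; exact: cyc_submod.1.
Qed.

Lemma cyc_v0 : cyc v0.
Proof. exact: descend_cyc desc_vac. Qed.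

(** Induction on the number of components of [w]. If the top degree is positive, some raising
    operator does not kill the top component; applied to [w] it stays in [M], shortens the sum, and
    gives a nonzero vector by orthogonality of the degrees. At the end a multiple of [v0]
    remains. *)
Lemma cyc_simple (M : V -> Prop) w : submod M ->
  (forall (i j : 'I_N) x, (i < j)%N -> M x -> M (E i j x)) ->
  cyc w -> w != 0 -> M w -> M v0.
Proof.
move=> hM Mraise [P [f [fd ->]]].
elim/ltn_ind: P f fd => [[|P]] IH f fd; first by rewrite big_ord0 eqxx.
move=> w0 Mw; have [fP0|fP0] := eqVneq (f P) 0.
  by apply: (IH P _ f) => //; move: w0 Mw; rewrite big_ord_recr /= fP0 addr0.
case: (posnP P) => [P0|Pgt0].
  subst P; have [c fc] := descend0 (fd 0%N).
  move: Mw; rewrite big_ord1 /= fc => /(submodZ hM c^-1).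
  rewrite scalerA mulVf ?scale1r //.
  by apply: contraNneq fP0 => c0; rewrite fc c0 scale0r.
have [i [j [ij fij]]] : exists i j : 'I_N, (i < j)%N /\ E i j (f P) <> 0.
  apply: contrapT => noij; move/eqP: fP0; apply.
  apply: descend_singular Pgt0 (fd P) _ => i j ij.
  by apply: contrapT => fij; apply: noij; exists i, j.
have jP : (j - i <= P)%N.
  rewrite leqNgt; apply/negP => Pj; have := descend_E i j (fd P).
  have -> : P%:Z + i%:Z - j%:Z = Negz (j - i - P).-1 by lia.
  by [].
(* [E i j] lowers degrees by [j - i]: the components below that degree vanish, the others are
   reindexed from 0. *)
pose g q := E i j (f (q + (j - i))%N).
have gd q : descend q (g q).
  have := descend_E i j (fd (q + (j - i))%N).
  by have -> : (q + (j - i))%N%:Z + i%:Z - j%:Z = q by lia.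
have sumg : E i j (\sum_(p < P.+1) f p) = \sum_(q < (P - (j - i)).+1) g q.
  rewrite linear_sum -(big_mkord xpredT (fun p => E i j (f p))) /=.
  rewrite (big_cat_nat (leq0n (j - i)%N)) /=; last by rewrite (leq_trans jP).
  rewrite big_nat_cond big1 ?add0r; last first.
    move=> p /andP[/andP[_ pj] _]; have := descend_E i j (fd p).
    have -> : p%:Z + i%:Z - j%:Z = Negz (j - i - p).-1 by lia.
    by [].
  rewrite -{1}[(j - i)%N]add0n big_addn subSn // big_mkord.
  by apply: eq_bigr.
apply: (IH (P - (j - i)).+1 _ g) => //; first by lia.
  (* If the image vanished, pairing it with its own top component [E i j (f P)] would give that
     component norm 0. *)
  apply/eqP => g0; apply: fij; apply/eqP; rewrite -(hform_eq0 B).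
  have gt : g (P - (j - i))%N = E i j (f P) by rewrite /g subnK.
  rewrite -{1}gt; have := congr1 (fun x => B x (g (P - (j - i))%N)) g0.
  rewrite big_ord_recr /= hformDl hform0l hform_suml big1 ?add0r ?gt; first by move=> ->.
  by move=> q _; rewrite -gt; apply: descend_orth (gd _) (gd _) _; rewrite ltn_eqF.
by rewrite -sumg; apply: Mraise.
Qed.

End Descend.

(** * From representations of gl(m|n) to simple unitarizable supermodules *)

Section Superrep.
Variables (C : numClosedFieldType) (m n : nat).

Definition odd_ix (i : 'I_(m + n)) : bool := (m <= i)%N.

Lemma odd_ixl i : odd_ix (lshift n i) = false.
Proof. by rewrite /odd_ix leqNgt /= ltn_ord. Qed.

Lemma odd_ixr k : odd_ix (rshift m k) = true.
Proof. by rewrite /odd_ix /= leq_addr. Qed.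

Definition superrep (V : lmodType C) (E : 'I_(m + n) -> 'I_(m + n) -> {linear V -> V}) :=
  forall i j k l w,
    let s := (-1) ^+ ((odd_ix i (+) odd_ix j) && (odd_ix k (+) odd_ix l)) in
    E i j (E k l w) - s *: E k l (E i j w)
    = (j == k)%:R *: E i l w - (s * (l == i)%:R) *: E k j w.

Lemma superrep_weak_comm (V : lmodType C) (E : 'I_(m + n) -> 'I_(m + n) -> {linear V -> V}) :
  superrep E -> weak_comm E.
Proof.
move=> hE i j k l; set s : C := (-1) ^+ ((odd_ix i (+) odd_ix j) && (odd_ix k (+) odd_ix l)).
exists s, 1, (- s) => w; have /eqP := hE i j k l w; rewrite -/s subr_eq => /eqP ->.
by rewrite mulr1 mulrN scaleNr addrC addrA mulrC.
Qed.

End Superrep.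

Section Sum4.
Variables (V : nmodType) (I : finType).

Lemma sum4 (F : I -> I -> I -> I -> V) :
  \sum_i \sum_j \sum_k \sum_l F i j k l =
  \sum_(q : (I * I) * (I * I)) F q.1.1 q.1.2 q.2.1 q.2.2.
Proof.
rewrite pair_bigA /= -(pair_bigA _ (fun p q => F p.1 p.2 q.1 q.2)) /=.
by apply: eq_bigr => p _; rewrite pair_bigA.
Qed.

Definition swap4 (q : (I * I) * (I * I)) := (q.2, q.1).

Lemma swap4K : involutive swap4.
Proof. by case. Qed.

End Sum4.

Section Transfer.
Variables (R : realType) (m n : nat).
Local Notation C := R[i].
Local Notation mx := 'M[C]_(m + n).
Local Notation odd_ix := (@odd_ix m n).

Lemma slE (X : mx) : (X \in @sl R m n) = (\sum_i (-1) ^+ odd_ix i * X i i == 0).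
Proof.
rewrite inE big_split_ord /= /mxtrace -sumrN; congr (_ + _ == _); apply: eq_bigr => i _.
  by rewrite odd_ixl mul1r !mxE.
by rewrite odd_ixr mulN1r !mxE.
Qed.

Lemma sl_delta i j : i != j -> (delta_mx i j : mx) \in @sl R m n.
Proof.
move=> ij; rewrite slE big1 // => k _; rewrite mxE; case: eqP => [->|_]; last by rewrite mulr0.
by rewrite (negPf ij) mulr0.
Qed.

Lemma sl_partP a (X : mx) : reflect
  (X \in @sl R m n /\ forall i j, odd_ix i (+) odd_ix j != a -> X i j = 0)
  (X \in @sl_part R m n a).
Proof.
apply: (iffP idP).
  rewrite inE => /andP[Xsl Xa]; split=> // i j; move: Xa.
  rewrite -(splitK i) -(splitK j); case: a;
  case: (split i) => i'; case: (split j) => j' /=; rewrite ?odd_ixl ?odd_ixr //= => /andP[/eqP h1 /eqP h2] _.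
  - by have := congr1 (fun A : 'M_m => A i' j') h1; rewrite !mxE.
  - by have := congr1 (fun A : 'M_n => A i' j') h2; rewrite !mxE.
  - by have := congr1 (fun A : 'M_(m, n) => A i' j') h1; rewrite !mxE.
  - by have := congr1 (fun A : 'M_(n, m) => A i' j') h2; rewrite !mxE.
move=> [Xsl h]; rewrite inE Xsl /=; case: a h => h.
  by apply/andP; split; apply/eqP/matrixP => i j; rewrite !mxE h ?odd_ixl ?odd_ixr.
by apply/andP; split; apply/eqP/matrixP => i j; rewrite !mxE h ?odd_ixl ?odd_ixr.
Qed.

Lemma omega_plusE (X : mx) i j : omega_plus X i j = (X j i)^*.
Proof.
have -> : omega_plus X = ctrmx X.
  rewrite /omega_plus /ctrmx -{5}[X]submxK map_block_mx tr_block_mx //.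
by rewrite !mxE.
Qed.

Variables (V : lmodType C) (E : 'I_(m + n) -> 'I_(m + n) -> {linear V -> V}).

Definition rep_act (X : mx) (w : V) : V := \sum_i \sum_j X i j *: E i j w.

Lemma rep_act_linear X : linear (rep_act X).
Proof.
move=> a u w; rewrite /rep_act scaler_sumr -big_split; apply: eq_bigr => i _ /=.
rewrite scaler_sumr -big_split; apply: eq_bigr => j _ /=.
by rewrite linearP scalerDr !scalerA mulrC.
Qed.

Lemma rep_act_linearZ X a w : rep_act X (a *: w) = a *: rep_act X w.
Proof. exact: (linearZ_LR (mklin (rep_act_linear X))). Qed.

Lemma rep_actP c X Y w : rep_act (c *: X + Y) w = c *: rep_act X w + rep_act Y w.
Proof.
rewrite /rep_act scaler_sumr -big_split; apply: eq_bigr => i _ /=.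
rewrite scaler_sumr -big_split; apply: eq_bigr => j _ /=.
by rewrite !mxE scalerDl scalerA.
Qed.

Lemma rep_act_delta i j w : rep_act (delta_mx i j) w = E i j w.
Proof.
rewrite /rep_act (bigD1 i) //= (bigD1 j) //= mxE !eqxx scale1r.
rewrite big1 => [|l lj]; last by rewrite mxE (negPf lj) andbF scale0r.
rewrite addr0 big1 ?addr0 // => k ki; rewrite big1 // => l _.
by rewrite mxE (negPf ki) scale0r.
Qed.

Lemma rep_act_comp X Y w :
  rep_act X (rep_act Y w) = \sum_i \sum_j \sum_k \sum_l (X i j * Y k l) *: E i j (E k l w).
Proof.
rewrite /rep_act; apply: eq_bigr => i _; apply: eq_bigr => j _.
rewrite linear_sum scaler_sumr; apply: eq_bigr => k _.
rewrite linear_sum scaler_sumr; apply: eq_bigr => l _.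
by rewrite linearZ /= scalerA.
Qed.

Hypothesis E_rep : superrep E.

Lemma rep_act_mul (X Y : mx) w :
  rep_act (X *m Y) w = \sum_i \sum_j \sum_k \sum_l (X i j * Y k l * (j == k)%:R) *: E i l w.
Proof.
rewrite /rep_act; apply: eq_bigr => i _.
under eq_bigr => l _ do rewrite mxE scaler_suml.
rewrite exchange_big; apply: eq_bigr => j _ /=.
rewrite [RHS](bigD1 j) //= [X in _ = _ + X]big1 ?addr0 => [|k kj].
  by apply: eq_bigr => l _; rewrite eqxx mulr1.
by rewrite big1 // => l _; rewrite eq_sym (negPf kj) mulr0 scale0r.
Qed.

(** Both sides become sums over quadruples of indices. Where the parities of (i, j) and (k, l) are a
    and b, the summands match by the relation for matrix units; elsewhere an entry of [X] or [Y]
    vanishes. *)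
Lemma rep_act_bracket a b (X Y : mx) w :
  X \in @sl_part R m n a -> Y \in @sl_part R m n b ->
  rep_act (sbracket a b X Y) w
  = rep_act X (rep_act Y w) - (-1) ^+ (a && b) *: rep_act Y (rep_act X w).
Proof.
move=> /sl_partP[_ Xa] /sl_partP[_ Yb]; set s := (-1) ^+ _.
have -> : sbracket a b X Y = (- s) *: (Y *m X) + X *m Y by rewrite /sbracket scaleNr addrC.
rewrite rep_actP rep_act_mul rep_act_mul rep_act_comp (rep_act_comp Y X) scaleNr addrC.
rewrite !(@sum4 V) [X in _ - _ *: X = _](reindex_inj (inv_inj (@swap4K _))) /=.
rewrite [X in _ = _ - _ *: X](reindex_inj (inv_inj (@swap4K _))) /=.
rewrite !scaler_sumr -!sumrB /=; apply: eq_bigr => -[[i j] [k l]] _ /=.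
have [Xij|Xij] := eqVneq (odd_ix i (+) odd_ix j) a; last first.
  by rewrite (Xa _ _ Xij) !(mul0r, mulr0, scale0r, scaler0, subr0, oppr0, addr0).
have [Ykl|Ykl] := eqVneq (odd_ix k (+) odd_ix l) b; last first.
  by rewrite (Yb _ _ Ykl) !(mul0r, mulr0, scale0r, scaler0, subr0, oppr0, addr0).
have /eqP := E_rep i j k l w; rewrite Xij Ykl -/s subr_eq => /eqP ->.
rewrite scalerDr scalerBr !scalerA.
rewrite [Y k l * X i j]mulrC [s * (X i j * Y k l)]mulrC addrK ![X i j * Y k l]mulrC.
congr (_ - _ *: _); ring.
Qed.

Variables (B : hform V) (G : {linear V -> V}) (v0 : V) (lam : 'I_(m + n) -> C).
Hypothesis E_adj : forall i j u w, B (E i j u) w = B u (E j i w).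
Hypothesis G_inv : forall u, G (G u) = u.
Hypothesis G_E : forall i j u, G (E i j u) = (-1) ^+ (odd_ix i (+) odd_ix j) *: E i j (G u).
Hypothesis G_adj : forall u w, B (G u) w = B u (G w).
Hypothesis v0_neq0 : v0 != 0.
Hypothesis G_v0 : G v0 = v0.
Hypothesis E_raise : forall i j : 'I_(m + n), (i < j)%N -> E i j v0 = 0.
Hypothesis E_diag : forall i, E i i v0 = lam i *: v0.

Let wc := superrep_weak_comm E_rep.
Let cycV := cyc E v0.

Lemma descend_parity p w : descend E v0 p w -> descend E v0 p (G w).
Proof.
elim=> {p w} [|p i j w ji _ IH|p|p a u w _ IHu _ IHw]; last 2 first.
- by rewrite linear0; exact: desc_zero.
- by rewrite linearP; exact: desc_lin.
- by rewrite G_v0; exact: desc_vac.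
by rewrite G_E; apply: (submodZ (descend_submod _ _ _)); apply: desc_low.
Qed.

Lemma cyc_parity w : cycV w -> cycV (G w).
Proof.
move=> [P [f [fd ->]]]; exists P, (fun p => G (f p)).
by split=> [p|]; [exact: descend_parity|rewrite linear_sum].
Qed.

(** [G] is the parity operator: its two eigenspaces in the cyclic module become the summands of the
    supermodule. *)
Definition graded (a : bool) (w : V) : Prop := cycV w /\ G w = (-1) ^+ a *: w.

Lemma homog_submod a : submod (graded a).
Proof.
apply: submod_and; first exact: cyc_submod.
split=> [|c u w Gu Gw]; first by rewrite linear0 scaler0.
by rewrite linearP /= Gu Gw scalerDr !scalerA mulrC.
Qed.

Local Notation M0 := (submod_sort (homog_submod false)).
Local Notation M1 := (submod_sort (homog_submod true)).
Local Notation MM := (sm_space M0 M1).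

(** A supermodule is given by two separate summands; this map puts them back into [V] and, being
    injective, pulls every identity back from [V]. *)
Definition sm_emb (z : MM) : V := val z.1 + val z.2.

Lemma sm_emb_linear : linear sm_emb.
Proof.
move=> a u w.
have -> : sm_emb (a *: u + w) = val (a *: u.1 + w.1) + val (a *: u.2 + w.2) by [].
rewrite (submod_valD (a *: u.1)) (submod_valD (a *: u.2)) (submod_valZ a u.1) (submod_valZ a u.2).
rewrite /sm_emb scalerDr.
by rewrite -!addrA; congr (_ + _); rewrite addrCA.
Qed.

Definition sm_embl : {linear MM -> V} := mklin sm_emb_linear.
Local Notation emb := sm_embl.

Lemma embP a u w : emb (a *: u + w) = a *: emb u + emb w.
Proof. exact: sm_emb_linear. Qed.

Lemma embBZ c u w : emb (u - c *: w) = emb u - c *: emb w.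
Proof. by rewrite (addrC u (- (c *: w))) -(scaleNr c w) embP scaleNr addrC. Qed.

Lemma embE z : emb z = val z.1 + val z.2.
Proof. by []. Qed.

Lemma emb_cyc z : cycV (emb z).
Proof.
by apply: (submodD (cyc_submod _ _)); [exact: (submod_prop z.1).1|exact: (submod_prop z.2).1].
Qed.

Lemma emb_parity z : G (emb z) = val z.1 - val z.2.
Proof.
rewrite embE linearD (submod_prop z.1).2 (submod_prop z.2).2.
by rewrite scale1r expr1 scaleN1r.
Qed.

Lemma double_inj (u w : V) : u + u = w + w -> u = w.
Proof.
rewrite -(mulr2n u) -(mulr2n w) -(scaler_nat 2 u) -(scaler_nat 2 w) => /(congr1 (fun x => (2%:R : C)^-1 *: x)).
by rewrite !scalerA mulVf ?scale1r ?pnatr_eq0.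
Qed.

Lemma emb_inj : injective emb.
Proof.
move=> [x y] [x' y'] e; have eG := congr1 G e; rewrite !emb_parity /= in eG.
rewrite !embE /= in e.
have ex : val x = val x'.
  apply: double_inj; have := congr2 +%R e eG.
  by rewrite addrACA subrr addr0 addrACA subrr addr0.
congr (_, _); apply: val_inj => //=.
by move: e; rewrite ex => /addrI.
Qed.

Lemma homog_split w : cycV w -> graded false (2^-1 *: (w + G w)) /\ graded true (2^-1 *: (w - G w)).
Proof.
move=> cw; have hc := cyc_submod E v0; have cGw := cyc_parity cw.
split; split.
- by apply: (submodZ hc); apply: (submodD hc).
- by rewrite scale1r linearZ /= linearD G_inv addrC.
- by apply: (submodZ hc); apply: (submodB hc).
- by rewrite linearZ /= linearB G_inv expr1 scaleN1r -scalerN opprB.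
Qed.

Definition sm_pr w (cw : cycV w) : MM :=
  (submod_elt (homog_submod false) (homog_split cw).1,
   submod_elt (homog_submod true) (homog_split cw).2).

Lemma emb_pr w (cw : cycV w) : emb (sm_pr cw) = w.
Proof.
rewrite embE /= -scalerDr addrACA subrr addr0 -(mulr2n w) -(scaler_nat 2 w) scalerA.
by rewrite mulVf ?scale1r ?pnatr_eq0.
Qed.

Lemma cyc_act X w : cycV w -> cycV (rep_act X w).
Proof.
move=> cw; have hc := cyc_submod E v0.
apply: (submod_sum hc) => i _; apply: (submod_sum hc) => j _.
by apply: (submodZ hc); apply: (cyc_E wc E_raise E_diag).
Qed.

Definition sm_actf X (z : MM) : MM := sm_pr (cyc_act X (emb_cyc z)).

Lemma emb_actf X z : emb (sm_actf X z) = rep_act X (emb z).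
Proof. exact: emb_pr. Qed.

Lemma sm_actf_linear X : linear (sm_actf X).
Proof.
move=> a u w; apply: emb_inj.
by rewrite [RHS]embP !emb_actf [X in rep_act _ X]embP rep_act_linear.
Qed.

Definition sm_actl X : {linear MM -> MM} := mklin (sm_actf_linear X).
Local Notation actM := sm_actl.

Lemma emb_act X z : emb (actM X z) = rep_act X (emb z).
Proof. exact: emb_pr. Qed.

Lemma homogeneousE a (z : MM) : homogeneous a z <-> G (emb z) = (-1) ^+ a *: emb z.
Proof.
rewrite emb_parity embE /homogeneous; case: a; split.
- by move/eqP=> ->; rewrite submod_val0 !add0r expr1 scaleN1r.
- rewrite expr1 scaleN1r opprD => /addIr /eqP; rewrite -subr_eq0 opprK => /eqP e.
  apply/eqP/val_inj/double_inj.
  by rewrite submod_val0 addr0.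
- by move/eqP=> ->; rewrite submod_val0 !addr0 oppr0 addr0 expr0 scale1r.
- rewrite expr0 scale1r => /addrI e.
  apply/eqP/val_inj/double_inj.
  by rewrite submod_val0 addr0 -{1}e addNr.
Qed.

Lemma rep_act_parity a (X : mx) w : X \in @sl_part R m n a ->
  G (rep_act X w) = (-1) ^+ a *: rep_act X (G w).
Proof.
move=> /sl_partP[_ Xa]; rewrite /rep_act linear_sum scaler_sumr; apply: eq_bigr => i _.
rewrite linear_sum scaler_sumr; apply: eq_bigr => j _.
have [<-|h] := eqVneq (odd_ix i (+) odd_ix j) a.
  by rewrite linearZ /= G_E !scalerA mulrC.
by rewrite (Xa _ _ h) !scale0r linear0 scaler0.
Qed.

Lemma sm_model_linear : action_linear (@sl R m n) actM.
Proof.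
move=> c X Y v _ _; apply: emb_inj.
by rewrite [RHS]embP !emb_act rep_actP.
Qed.

Lemma sm_model_parity a b X v :
  X \in @sl_part R m n a -> homogeneous b v -> homogeneous (a (+) b) (actM X v).
Proof.
move=> Xa /homogeneousE hv; apply/homogeneousE.
by rewrite emb_act (rep_act_parity _ Xa) hv rep_act_linearZ scalerA -signr_addb.
Qed.

Lemma sm_model_bracket a b X Y v :
  X \in @sl_part R m n a -> Y \in @sl_part R m n b ->
  actM (sbracket a b X Y) v
  = actM X (actM Y v) - (-1) ^+ (a && b) *: actM Y (actM X v).
Proof.
move=> Xa Yb; apply: emb_inj.
by rewrite [RHS]embBZ !emb_act (rep_act_bracket _ Xa Yb).
Qed.

Definition sm_model : supermodule R m n :=
  SuperModule sm_model_linear sm_model_parity sm_model_bracket.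


Variable (L : 'rV[C]_(m + n)) (c : C).
Hypothesis L_lam : forall i, L 0 i = lam i + (-1) ^+ odd_ix i * c.

(** The tuples differ by c (1,..,1|-1,..,-1), which contributes c times the supertrace of [H], that
    is 0. *)
Lemma weight_evalE (H : mx) : H \in @sl R m n -> weight_eval L H = \sum_i H i i * lam i.
Proof.
rewrite slE => /eqP h; rewrite /weight_eval.
transitivity (\sum_i H i i * lam i + c * \sum_i (-1) ^+ odd_ix i * H i i).
  by rewrite mulr_sumr -big_split; apply: eq_bigr => i _ /=; rewrite L_lam; ring.
by rewrite h mulr0 addr0.
Qed.

Definition sm_vac : MM := sm_pr (cyc_v0 E v0).

Lemma emb_vac : emb sm_vac = v0.
Proof. exact: emb_pr. Qed.

Lemma sm_model_hw : hw_vector (@sl R m n) (@sm_act _ _ _ sm_model) L sm_vac.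
Proof.
split.
- by apply: contraNneq v0_neq0 => e; rewrite -emb_vac e linear0.
- move=> H Hsl Hd; apply: emb_inj; rewrite [LHS]emb_act emb_vac.
  rewrite -[_ *: sm_vac]addr0 embP linear0 addr0 emb_vac weight_evalE // scaler_suml.
  apply: eq_bigr => i _; rewrite (bigD1 i) //= big1 ?addr0 => [|j ji].
    by rewrite E_diag scalerA.
  by move/is_diag_mxP: Hd => ->; rewrite ?scale0r // eq_sym.
- move=> X Xsl Xu; apply: emb_inj; rewrite [LHS]emb_act emb_vac linear0.
  rewrite /rep_act big1 // => i _; rewrite big1 // => j _.
  case: (ltnP i j) => ij; first by rewrite E_raise // scaler0.
  move: Xu => /forallP/(_ i)/forallP/(_ j)/implyP/(_ ij)/eqP ->.
  by rewrite scale0r.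
Qed.

Section Subsupermodule.
Variable N : sm_sort sm_model -> Prop.
Hypothesis hN : subsupermodule N.

Definition emb_im (w : V) : Prop := exists2 z, N z & emb z = w.

Lemma emb_im_submod : submod emb_im.
Proof.
have [[N0 NP] _ _] := hN; split; first by exists 0; rewrite ?linear0.
by move=> a _ _ [u Nu <-] [w Nw <-]; exists (a *: u + w); rewrite ?embP //; apply: NP.
Qed.

Lemma emb_im_E i j w : i != j -> emb_im w -> emb_im (E i j w).
Proof.
move=> ij [z Nz <-]; have [_ _ Nst] := hN.
exists (actM (delta_mx i j) z); last by rewrite emb_act rep_act_delta.
by apply: Nst => //; exact: sl_delta.
Qed.

Lemma emb_im_vac : emb_im v0 -> forall z, N z.
Proof.
move=> h z; have hs := emb_im_submod.
have : emb_im (emb z).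
  have [P [f [fd ->]]] := emb_cyc z; apply: (submod_sum hs) => p _.
  elim: (fd p) => {fd} [//|q i j w ji _ IH|q|q a u w _ IHu _ IHw].
  - by apply: emb_im_E => //; rewrite neq_ltn ji orbT.
  - exact: hs.1.
  - exact: hs.2.
by case=> z' Nz' /emb_inj <-.
Qed.

End Subsupermodule.

Lemma sm_model_simple : simple_supermodule sm_model.
Proof.
split; first by exists sm_vac; have [] := sm_model_hw.
move=> N hN; have [[z [Nz z0]]|h] := pselect (exists z, N z /\ z <> 0); last first.
  by left=> v Nv; apply: contrapT => v0'; apply: h; exists v.
right; apply: (emb_im_vac hN); apply: (cyc_simple wc E_adj E_raise E_diag (w := emb z)).
- exact: emb_im_submod.
- by move=> i j x ij; apply: emb_im_E => //; rewrite neq_ltn ij.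
- exact: emb_cyc.
- by apply/eqP => e; apply: z0; apply: emb_inj; rewrite e linear0.
- by exists z.
Qed.

Lemma sm_model_highest : highest_weight_supermodule sm_model L.
Proof.
exists sm_vac; split; last by move=> N hN Nv; apply: (emb_im_vac hN); exists sm_vac; rewrite ?emb_vac.
- by apply/homogeneousE; rewrite emb_vac expr0 scale1r.
- exact: sm_model_hw.
Qed.

Definition sm_formf (u w : MM) : C := B (emb u) (emb w).

Lemma rep_act_adj X u w : B (rep_act X u) w = B u (rep_act (omega_plus X) w).
Proof.
rewrite /rep_act hform_suml [in RHS]exchange_big hform_sumr; apply: eq_bigr => i _.
rewrite hform_suml hform_sumr; apply: eq_bigr => j _.
by rewrite hformZl hformZr omega_plusE conjCK E_adj.
Qed.

Lemma sm_model_unitarizable : unitarizable sm_model.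
Proof.
have fl a u v w : sm_formf (a *: u + v) w = a * sm_formf u w + sm_formf v w.
  by rewrite /sm_formf embP hform_linl.
have fh u v : sm_formf u v = (sm_formf v u)^* by rewrite /sm_formf hform_herm.
have fp u : u != 0 -> 0 < sm_formf u u.
  move=> u0; apply: hform_pos; apply: contra_neq u0 => e; apply: emb_inj.
  by rewrite e linear0.
have [f fE] := dot_of_hform (HForm fl fh fp).
exists f; split; last by move=> X v w _; rewrite !fE /= /sm_formf !emb_act rep_act_adj.
move=> v w /homogeneousE; rewrite expr0 scale1r => hv.
move=> /homogeneousE; rewrite expr1 scaleN1r => hw.
(* [G] is self-adjoint with eigenvalue 1 on [v] and -1 on [w], so the product equals its own
   opposite. *)
by rewrite fE /= /sm_formf; apply/eqP; rewrite -eqNr -hformNr -hw -G_adj hv.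
Qed.

(** Common end of both sufficiency arguments: what remains is a unitary representation of gl(m|n)
    with a highest weight vector of weight [L] up to a shift of the tuple. *)
Theorem superrep_unitarizable :
  exists M : supermodule R m n, is_simple_hw M L /\ unitarizable M.
Proof.
exists sm_model; split; last exact: sm_model_unitarizable.
by split; [exact: sm_model_simple | exact: sm_model_highest].
Qed.

End Transfer.

(** * Necessity *)

Section Weights.
Variables (R : realType) (m n : nat).
Local Notation C := R[i].

Lemma card_ord_gt N (i0 : 'I_N) : \sum_(j < N | (i0 < j)%N) (1 : C) = N%:R - 1 - i0%:R.
Proof.
rewrite -(big_mkord (fun j => (i0 < j)%N) (fun=> 1)) -(addn0 i0.+1).
rewrite (big_cat_nat (leq0n i0.+1)) ?ltn_ord //= big_nat_cond big1 ?add0r; last first.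
  by move=> j /andP[/andP[_ ji] ij]; lia.
rewrite big_nat_cond (eq_bigl (fun j => (i0.+1 <= j < N)%N)) => [|j]; last lia.
rewrite -big_nat sumr_const_nat natrB ?ltn_ord // -[i0.+1]addn1 natrD; ring.
Qed.

Lemma card_ord_lt N (i0 : 'I_N) : \sum_(j < N | (j < i0)%N) (1 : C) = i0%:R.
Proof.
rewrite -(big_mkord (fun j => (j < i0)%N) (fun=> 1)).
rewrite (big_cat_nat (leq0n i0) (ltnW (ltn_ord i0))) /= addrC big_nat_cond big1 ?add0r; last first.
  by move=> j /andP[/andP[ji _] ij]; lia.
rewrite big_nat_cond (eq_bigl (fun j => (0 <= j < i0)%N)) => [|j]; last lia.
by rewrite -big_nat sumr_const_nat subn0.
Qed.

Lemma sum_delta N (i0 : 'I_N) (F : 'I_N -> C) : \sum_i F i * (i == i0)%:R = F i0.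
Proof.
rewrite (bigD1 i0) //= eqxx mulr1 big1 ?addr0 // => i /negPf ->.
by rewrite mulr0.
Qed.

(** The index [i0] is the smaller member of N - 1 - i0 pairs and the larger member of i0 pairs. *)
Lemma pair_sum N (i0 : 'I_N) :
  \sum_(i < N) \sum_(j < N | (i < j)%N) ((i == i0)%:R - (j == i0)%:R) = N%:R - 1 - 2 * i0%:R :> C.
Proof.
under eq_bigr => i _ do rewrite sumrB.
rewrite sumrB (_ : \sum_i _ = N%:R - 1 - i0%:R); last first.
  rewrite -(card_ord_gt i0) -(sum_delta i0 (fun i : 'I_N => \sum_(j < N | (i < j)%N) 1)).
  by apply: eq_bigr => i _; rewrite mulr_suml; apply: eq_bigr => j _; rewrite mul1r.
rewrite (_ : \sum_i _ = i0%:R); first by ring.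
rewrite -(card_ord_lt i0) -(sum_delta i0 (fun j : 'I_N => \sum_(i < N | (i < j)%N) 1)).
rewrite (exchange_big_dep xpredT) //=.
by apply: eq_bigr => i _; rewrite mulr_suml; apply: eq_bigr => j _; rewrite mul1r.
Qed.

Lemma rowBE (u w : 'rV[C]_(m + n)) j : (u - w) 0 j = u 0 j - w 0 j.
Proof. by rewrite !mxE. Qed.

Lemma rowDE (u w : 'rV[C]_(m + n)) j : (u + w) 0 j = u 0 j + w 0 j.
Proof. by rewrite mxE. Qed.

Lemma eps_l (i j : 'I_m) : eps R n i 0 (lshift n j) = (i == j)%:R.
Proof. by rewrite /eps mxE eqxx /= (inj_eq (@lshift_inj _ _)) eq_sym. Qed.
Lemma eps_r (i : 'I_m) (k : 'I_n) : eps R n i 0 (rshift m k) = 0.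
Proof. by rewrite /eps mxE eqxx /= eq_rlshift. Qed.
Lemma del_l (k : 'I_n) (i : 'I_m) : del R m k 0 (lshift n i) = 0.
Proof. by rewrite /del mxE eqxx /= eq_lrshift. Qed.
Lemma del_r (k l : 'I_n) : del R m k 0 (rshift m l) = (k == l)%:R.
Proof. by rewrite /del mxE eqxx /= (inj_eq (@rshift_inj _ _)) eq_sym. Qed.

Lemma rho_l (i : 'I_m) : rho R m n 0 (lshift n i) = 2^-1 * (m%:R - 1 - 2 * i%:R - n%:R).
Proof.
rewrite /rho !mxE !summxE.
under eq_bigr => p _.
  rewrite summxE.
  under eq_bigr => q _ do rewrite rowBE !eps_l.
  over.
rewrite pair_sum big1 ?addr0; last first.
  by move=> p _; rewrite summxE big1 // => q _; rewrite rowBE !del_l subr0.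
rewrite (_ : \sum_i0 _ = n%:R); first by ring.
rewrite -(sum_delta i (fun=> n%:R)); apply: eq_bigr => p _.
rewrite summxE; under eq_bigr => q _ do rewrite rowBE eps_l del_l subr0.
by rewrite sumr_const card_ord mulr_natl.
Qed.

Lemma rho_r (k : 'I_n) : rho R m n 0 (rshift m k) = 2^-1 * (n%:R - 1 - 2 * k%:R + m%:R).
Proof.
rewrite /rho !mxE !summxE big1 ?add0r; last first.
  by move=> p _; rewrite summxE big1 // => q _; rewrite rowBE !eps_r subr0.
under eq_bigr => p _.
  rewrite summxE.
  under eq_bigr => q _ do rewrite rowBE !del_r.
  over.
rewrite pair_sum (_ : \sum_i0 _ = - m%:R); first by ring.
rewrite -[in RHS](card_ord m) -sumr_const -sumrN; apply: eq_bigr => p _.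
rewrite summxE; under eq_bigr => q _ do rewrite rowBE eps_r del_r sub0r.
rewrite sumrN; congr (- _); rewrite -[RHS](sum_delta k (fun=> 1)).
by apply: eq_bigr => q _; rewrite mul1r.
Qed.

Lemma wform_eps_del (L : 'rV[C]_(m + n)) i k :
  wform L (eps R n i - del R m k) = L 0 (lshift n i) + L 0 (rshift m k).
Proof.
rewrite /wform; under eq_bigr => p _ do rewrite rowBE eps_l del_l subr0 eq_sym.
under [X in _ - X]eq_bigr => p _ do rewrite rowBE eps_r del_r sub0r eq_sym mulrN.
by rewrite sumrN opprK !sum_delta.
Qed.

Lemma wform_del_del (L : 'rV[C]_(m + n)) k l :
  wform L (del R m k - del R m l) = L 0 (rshift m l) - L 0 (rshift m k).
Proof.
rewrite /wform big1 ?sub0r => [|p _]; last by rewrite rowBE !del_l subr0 mulr0.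
under eq_bigr => p _ do rewrite rowBE !del_r ![_ == p]eq_sym mulrBr.
by rewrite sumrB !sum_delta opprB.
Qed.

Lemma wform_rho (hm : (0 < m)%N) (L : 'rV[C]_(m + n)) (k : 'I_n) :
  wform (L + rho R m n) (eps R n (last_ord hm) - del R m k)
  = L 0 (lshift n (last_ord hm)) + L 0 (rshift m k) - k%:R.
Proof.
rewrite wform_eps_del !(rowDE L) rho_l rho_r /=.
have -> : m.-1%:R = m%:R - 1 :> C by rewrite -subn1 natrB.
by field.
Qed.

End Weights.

(** * Norms along a string of odd lowering operators *)

Section Relations.
Variables (R : realType) (m n : nat).
Local Notation C := R[i].
Local Notation mx := 'M[C]_(m + n).
Local Notation p := (@odd_ix m n).
Variables (V : lmodType C) (act : mx -> {linear V -> V}).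
Hypothesis act_lin : action_linear (@sl R m n) act.
Hypothesis act_br : forall a b X Y v,
  X \in @sl_part R m n a -> Y \in @sl_part R m n b ->
  act (sbracket a b X Y) v = act X (act Y v) - (-1) ^+ (a && b) *: act Y (act X v).

Local Notation e i j := (act (delta_mx i j)).

Lemma sl0 : (0 : mx) \in @sl R m n.
Proof. by rewrite slE big1 // => i _; rewrite mxE mulr0. Qed.

Lemma act0 w : act 0 w = 0.
Proof.
have := act_lin 1 w sl0 sl0; rewrite !scale1r addr0 => /(congr1 (fun x => x - act 0 w)).
by rewrite subrr addrK.
Qed.

Lemma actZ c X w : X \in @sl R m n -> act (c *: X) w = c *: act X w.
Proof. by move=> Xs; rewrite -[c *: X]addr0 act_lin ?sl0 // act0 addr0. Qed.

Lemma delta_part i j : i != j -> (delta_mx i j : mx) \in @sl_part R m n (p i (+) p j).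
Proof.
move=> ij; apply/sl_partP; split; first exact: sl_delta.
move=> k l h; rewrite mxE; case: eqP => [ki|//]; case: eqP => [lj|//].
by rewrite ki lj eqxx in h.
Qed.

(** The superbracket of the matrix units at (i, j) and (j, i). Single diagonal units are not in
    sl(m|n), so weights are read off on these combinations. *)
Definition coroot (i j : 'I_(m + n)) : mx :=
  delta_mx i i - (-1) ^+ (p i (+) p j) *: delta_mx j j.

Lemma corootE i j k l : coroot i j k l =
  (k == l)%:R * ((i == k)%:R - (-1) ^+ (p i (+) p j) * (j == k)%:R).
Proof.
have e x : (k == x) && (l == x) = (k == l) && (x == k).
  case: (eqVneq k x) => [->|kx] /=; last by rewrite andbF.
  by rewrite andbT eq_sym.
by rewrite !mxE !e; case: (k == l); rewrite ?mul1r ?mul0r //= mulr0 subrr.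
Qed.

Lemma coroot_diag i j : is_diag_mx (coroot i j).
Proof.
by apply/is_diag_mxP => k l kl; rewrite corootE -val_eqE (negPf kl) mul0r.
Qed.

Lemma coroot_part i j : i != j -> coroot i j \in @sl_part R m n false.
Proof.
move=> ij; apply/sl_partP; split; last first.
  move=> k l; rewrite corootE; case: (eqVneq k l) => [->|_]; last by rewrite mul0r.
  by rewrite addbb.
rewrite slE (bigD1 i) //= (bigD1 j) 1?eq_sym //= big1 ?addr0.
  rewrite !corootE !eqxx !mul1r (negPf ij) [j == i]eq_sym (negPf ij) mulr0 subr0 mulr1 sub0r mulr1.
  by rewrite signr_addb mulrN mulrCA -expr2 sqrr_sign mulr1 subrr.
move=> k /andP[ki kj]; rewrite corootE eqxx [i == k]eq_sym [j == k]eq_sym (negPf ki) (negPf kj).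
by rewrite mulr0 subrr !mulr0.
Qed.

Lemma sl_part_sl a X : X \in @sl_part R m n a -> X \in @sl R m n.
Proof. by case/sl_partP. Qed.

Lemma coroot_weight (L : 'rV[C]_(m + n)) i j :
  weight_eval L (coroot i j) = L 0 i - (-1) ^+ (p i (+) p j) * L 0 j.
Proof.
rewrite /weight_eval; under eq_bigr => k _ do rewrite corootE eqxx mul1r mulrBr ![_ == k]eq_sym mulrCA.
by rewrite sumrB -mulr_sumr !sum_delta.
Qed.

Lemma e_coroot i j w : i != j ->
  e i j (e j i w) = (-1) ^+ (p i (+) p j) *: e j i (e i j w) + act (coroot i j) w.
Proof.
move=> ij; have ji : j != i by rewrite eq_sym.
have := act_br w (delta_part ij) (delta_part ji).
rewrite [p j (+) p i]addbC andbb => /eqP; rewrite eq_sym subr_eq => /eqP ->.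
by rewrite addrC /sbracket !mul_delta_mx andbb.
Qed.

Lemma e_e i j k l w : i != j -> k != l -> (j != k) || (l != i) ->
  e i j (e k l w) = (-1) ^+ ((p i (+) p j) && (p k (+) p l)) *: e k l (e i j w)
   + (j == k)%:R *: e i l w
   - ((-1) ^+ ((p i (+) p j) && (p k (+) p l)) * (l == i)%:R) *: e k j w.
Proof.
move=> ij kl h; have := act_br w (delta_part ij) (delta_part kl).
set s := (-1) ^+ _ => /eqP; rewrite eq_sym subr_eq => /eqP ->.
rewrite addrC -addrA; congr (_ + _); rewrite /sbracket !mul_delta_mx_cond.
have [jk|jk] := eqVneq j k; have [li|li] := eqVneq l i.
- by rewrite jk li !eqxx in h.
- by rewrite mulr0n mulr1n scaler0 subr0 mulr0 scale0r subr0 scale1r.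
- rewrite mulr0n mulr1n sub0r scale0r sub0r mulr1 -scaleNr actZ ?scaleNr //.
  by apply: sl_delta; rewrite eq_sym.
- by rewrite !mulr0n scaler0 subr0 act0 scale0r mulr0 scale0r subr0.
Qed.

Lemma coroot_e i j k l w : i != j -> k != l ->
  act (coroot i j) (e k l w) = e k l (act (coroot i j) w)
   + ((i == k)%:R - (-1) ^+ (p i (+) p j) * (j == k)%:R
      - ((i == l)%:R - (-1) ^+ (p i (+) p j) * (j == l)%:R)) *: e k l w.
Proof.
move=> ij kl; have := act_br w (coroot_part ij) (delta_part kl).
rewrite andFb expr0 scale1r => /eqP; rewrite eq_sym subr_eq => /eqP ->.
rewrite addrC; congr (_ + _); rewrite -actZ; last exact: sl_delta.
congr (act _ w); rewrite /sbracket andFb expr0 scale1r /coroot.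
rewrite mulmxBl mulmxBr -!scalemxAl -!scalemxAr !mul_delta_mx_cond.
have d1 x : delta_mx x l *+ (x == k) = (x == k)%:R *: delta_mx k l :> mx.
  by case: eqVneq => [->|_]; rewrite ?mulr1n ?mulr0n ?scale1r ?scale0r.
have d2 x : delta_mx k x *+ (l == x) = (x == l)%:R *: delta_mx k l :> mx.
  by rewrite eq_sym; case: eqVneq => [->|_]; rewrite ?mulr1n ?mulr0n ?scale1r ?scale0r.
by rewrite !d1 !d2 !scalerA -!scalerBl.
Qed.

Variables (B : hform V) (L : 'rV[C]_(m + n)) (v0 : V).
Hypothesis act_adj : forall X u w, X \in @sl R m n ->
  B (act X u) w = B u (act (omega_plus X) w).
Hypothesis hv0 : hw_vector (@sl R m n) act L v0.

Lemma e_adj i j u w : i != j -> B (e i j u) w = B u (e j i w).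
Proof.
move=> ij; rewrite act_adj ?sl_delta //; congr (B u (act _ w)).
by apply/matrixP => k l; rewrite omega_plusE !mxE conjC_nat andbC.
Qed.

Lemma e_raise (i j : 'I_(m + n)) : (i < j)%N -> e i j v0 = 0.
Proof.
move=> ij; have [_ _ h] := hv0; apply: h; first by rewrite sl_delta // neq_ltn ij.
apply/forallP => k; apply/forallP => l; apply/implyP => lk; rewrite mxE.
case: (eqVneq k i) lk => [->|//]; case: (eqVneq l j) => [->|//].
by rewrite leqNgt ij.
Qed.

Lemma coroot_v0 i j : i != j ->
  act (coroot i j) v0 = (L 0 i - (-1) ^+ (p i (+) p j) * L 0 j) *: v0.
Proof.
move=> ij; have [_ h _] := hv0.
by rewrite h ?coroot_diag ?coroot_weight // (sl_part_sl (coroot_part ij)).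
Qed.

(** The squared norm of [e j i v0] is the value of the weight on the coroot times that of [v0]. *)
Lemma hw_root_ge0 (i j : 'I_(m + n)) : (i < j)%N -> 0 <= L 0 i - (-1) ^+ (p i (+) p j) * L 0 j.
Proof.
move=> ij; have ij' : i != j by rewrite neq_ltn ij.
have ji' : j != i by rewrite eq_sym.
have := hform_ge0 B (e j i v0).
rewrite e_adj // e_coroot // e_raise // linear0 scaler0 add0r coroot_v0 // hformZr.
have [v00 _ _] := hv0.
by rewrite pmulr_lge0 ?hform_pos // conjC_ge0.
Qed.

Hypotheses (hm : (0 < m)%N) (hn : (0 < n)%N).
Local Notation o := (lshift n (last_ord hm)).
Local Notation d := (rshift m).
Let kap (j : nat) : 'I_n := insubd (last_ord hn) j.

(** The order delta_1, delta_2, ... keeps the vector singular for the later indices. [kap] turns the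
    counter into an index; its default is not reached for [j <= n]. *)
Fixpoint odd_string (j : nat) : V :=
  if j is j'.+1 then e (d (kap j')) o (odd_string j') else v0.

Lemma o_d (k : 'I_n) : o != d k. Proof. by rewrite eq_lrshift. Qed.
Lemma d_o (k : 'I_n) : d k != o. Proof. by rewrite eq_rlshift. Qed.
Lemma d_d (k l : 'I_n) : (d k == d l) = (k == l). Proof. exact: inj_eq (@rshift_inj _ _) _ _. Qed.

(** Moving the raising operator of eps_m - delta_k past the last letter delta_j produces an even
    raising operator of root delta_j - delta_k with j < k, so the second clause is carried along
    with the first. Each letter removes one eps_m, whence the -j in the third. *)
Lemma odd_string_props j : (j <= n)%N ->
  [/\ forall k : 'I_n, (j <= k)%N -> e o (d k) (odd_string j) = 0,
      forall q k : 'I_n, (q < k)%N -> (j <= k)%N -> e (d q) (d k) (odd_string j) = 0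
    & forall k : 'I_n, (j <= k)%N ->
       act (coroot o (d k)) (odd_string j) = (L 0 o + L 0 (d k) - j%:R) *: odd_string j].
Proof.
elim: j => [|j IH] jn.
  split=> /= [k _|q k qk _|k _]; rewrite ?e_raise //=.
  - by move: hm; lia.
  - by rewrite ltn_add2l.
  - by rewrite coroot_v0 ?o_d // odd_ixl odd_ixr mulN1r opprK subr0.
have [h1 h2 h3] := IH (ltnW jn).
have kj : kap j = j :> nat by rewrite val_insubd jn.
split=> [k jk|q k qk jk|k jk] /=.
- have nk : (kap j == k) = false by apply/eqP => ek; move: jk; rewrite -ek kj ltnn.
  rewrite e_e ?o_d ?d_o //; last by rewrite d_d eq_sym nk.
  rewrite odd_ixl !odd_ixr /= h1 1?ltnW // linear0 scaler0 add0r d_d eq_sym nk scale0r sub0r.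
  by rewrite h2 ?scaler0 ?subr0 ?oppr0 ?addr0 ?kj // ltnW.
- have nk : (kap j == k) = false by apply/eqP => ek; move: jk; rewrite -ek kj ltnn.
  have qk' : d q != d k by rewrite d_d neq_ltn qk.
  rewrite (e_e _ qk' (d_o _)); last by rewrite o_d orbT.
  rewrite (h2 _ _ qk (ltnW jk)) linear0 scaler0 add0r d_d eq_sym nk scale0r sub0r.
  by rewrite (negPf (o_d _)) mulr0 scale0r oppr0.
- have nk : (kap j == k) = false by apply/eqP => ek; move: jk; rewrite -ek kj ltnn.
  rewrite coroot_e ?o_d ?d_o // h3 1?ltnW // linearZ /= -scalerDl; congr (_ *: _).
  rewrite eqxx (negPf (o_d _)) (negPf (d_o _)) d_d [k == _]eq_sym nk odd_ixl odd_ixr expr1 -natr1 /=; ring.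
Qed.

Lemma odd_string_step j (k : 'I_n) : (j <= k)%N ->
  B (e (d k) o (odd_string j)) (e (d k) o (odd_string j))
  = (L 0 o + L 0 (d k) - j%:R)^* * B (odd_string j) (odd_string j).
Proof.
move=> jk; have [h1 _ h3] := odd_string_props (ltnW (leq_ltn_trans jk (ltn_ord k))).
rewrite e_adj ?d_o // e_coroot ?o_d // h1 // linear0 scaler0 add0r h3 //.
by rewrite hformZr.
Qed.

(** Any delta_k with [k >= j] may prolong the string, not just the next one; this freedom is what
    compares mu^k with mu^n. *)
Lemma odd_string_ge0 j (k : 'I_n) : (j <= k)%N -> odd_string j != 0 ->
  0 <= L 0 o + L 0 (d k) - j%:R.
Proof.
move=> jk u0; have := hform_ge0 B (e (d k) o (odd_string j)).
by rewrite odd_string_step // pmulr_lge0 ?hform_pos // conjC_ge0.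
Qed.

Lemma odd_string_neq0 j : (j <= n)%N ->
  (forall k : 'I_n, (k < j)%N -> L 0 o + L 0 (d k) - k%:R != 0) -> odd_string j != 0.
Proof.
elim: j => [_ _|j IH jn h]; first by have [] := hv0.
have u0 : odd_string j != 0.
  by apply: IH => [|k kj]; [exact: ltnW|apply: h; exact: ltnW].
have kj : kap j = j :> nat by rewrite val_insubd jn.
rewrite -(hform_eq0 B) /= odd_string_step ?kj // mulf_neq0 ?hform_eq0 //.
by rewrite conjC_eq0; have := h (kap j); rewrite kj; apply.
Qed.

Lemma unitary_weight_chain : weight_chain hm hn L.
Proof.
have ge0 (i j : 'I_(m + n)) : (i < j)%N -> p i = p j -> L 0 j <= L 0 i.
  by move=> ij pij; have := hw_root_ge0 ij; rewrite pij addbb mul1r subr_ge0.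
split=> [i j||k l].
- rewrite leq_eqVlt => /orP[/eqP/val_inj -> //|ij].
  by apply: ge0 => //; rewrite !odd_ixl.
- have := @hw_root_ge0 o (d (last_ord hn)) _.
  rewrite odd_ixl odd_ixr mulN1r opprK => h.
  by rewrite -subr_ge0 opprK h //=; move: hm; lia.
- rewrite lerN2 leq_eqVlt => /orP[/eqP/val_inj -> //|kl].
  by apply: ge0; rewrite ?ltn_add2l // !odd_ixr.
Qed.

(** Since mu decreases, the earlier values exceed a_k = 0, so the string that stops before delta_k
    is nonzero. Prolonging it by delta_n instead of delta_k gives mu^n - mu^k >= 0, the reverse of
    the inequality in the chain. *)
Lemma unitary_atypical (k : 'I_n) : L 0 o + L 0 (d k) - k%:R = 0 ->
  (forall j : 'I_n, (j < k)%N -> 0 < L 0 o + L 0 (d j) - j%:R)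
  /\ L 0 (d (last_ord hn)) = L 0 (d k).
Proof.
move=> ak; have [_ _ mono] := unitary_weight_chain.
have gt0 (j : 'I_n) : (j < k)%N -> 0 < L 0 o + L 0 (d j) - j%:R.
  move=> jk.
  have -> : L 0 o + L 0 (d j) - j%:R
      = (L 0 o + L 0 (d k) - k%:R) + (L 0 (d j) - L 0 (d k)) + (k%:R - j%:R) by ring.
  rewrite ak add0r.
  apply: ltr_wpDl; last by rewrite subr_gt0 ltr_nat.
  rewrite subr_ge0.
  by have := mono _ _ (ltnW jk); rewrite lerN2.
split=> //; apply/le_anti/andP; split.
  by have := mono k (last_ord hn); rewrite lerN2; apply; rewrite /= -ltnS prednK.
have u0 : odd_string k != 0.
  by apply: odd_string_neq0 => [|j /gt0/lt0r_neq0//]; exact: ltnW.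
have := @odd_string_ge0 k (last_ord hn) _ u0; rewrite /= -ltnS prednK // ltn_ord.
move=> /(_ isT).
have -> : L 0 o + L 0 (d (last_ord hn)) - k%:R
  = (L 0 o + L 0 (d k) - k%:R) + (L 0 (d (last_ord hn)) - L 0 (d k)) by ring.
by rewrite ak add0r subr_ge0.
Qed.

Lemma unitary_typical : (forall k : 'I_n, L 0 o + L 0 (d k) - k%:R <> 0) ->
  forall k : 'I_n, 0 < L 0 o + L 0 (d k) - k%:R.
Proof.
move=> h k; rewrite lt_def; apply/andP; split; first exact/eqP.
apply: odd_string_ge0 => //; apply: odd_string_neq0 => [|j _]; first exact: ltnW.
exact/eqP.
Qed.

End Relations.

(** * The even module generated by the highest weight vector *)

Section EvenCyclic.
Variables (R : realType) (m n : nat).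
Local Notation C := R[i].
Local Notation mx := 'M[C]_(m + n).
Local Notation g0 := (@sl_part R m n false).
Variables (V : lmodType C) (act : mx -> {linear V -> V}).
Hypothesis act_lin : action_linear g0 act.
Hypothesis act_br : forall X Y v, X \in g0 -> Y \in g0 ->
  act (sbracket false false X Y) v = act X (act Y v) - act Y (act X v).
Variables (B : hform V) (L : 'rV[C]_(m + n)) (v0 : V).
Hypothesis act_adj : forall X u w, X \in g0 -> B (act X u) w = B u (act (omega_plus X) w).
Hypothesis hv0 : hw_vector g0 act L v0.

Definition even_span (w : V) : Prop :=
  forall N, submod N -> (forall X v, X \in g0 -> N v -> N (act X v)) -> N v0 -> N w.

Lemma even_span_submod : submod even_span.
Proof.
by split=> [N hN _ _|c u w hu hw N hN hs Nv]; [exact: hN.1|apply: hN.2];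
  [exact: (hu N hN hs Nv)|exact: (hw N hN hs Nv)].
Qed.

Local Notation W := (submod_sort even_span_submod).

Lemma even_span_act X w : X \in g0 -> even_span w -> even_span (act X w).
Proof. by move=> Xg hw N hN hs Nv; exact: (hs _ _ Xg (hw N hN hs Nv)). Qed.

Lemma even_part0 : 0 \in g0.
Proof.
by apply/sl_partP; split=> [|i j _]; rewrite ?mxE // slE big1 // => i _; rewrite mxE mulr0.
Qed.

(** The action has to be defined on all matrices, while the span is stable under the even part; the
    other matrices are made to act by 0. *)
Definition even_clip (X : mx) : mx := if X \in g0 then X else 0.

Lemma even_clipP X : even_clip X \in g0.
Proof. by rewrite /even_clip; case: ifP => // _; exact: even_part0. Qed.

Lemma even_clipE X : X \in g0 -> even_clip X = X.
Proof. by rewrite /even_clip => ->. Qed.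

Definition even_actf X (z : W) : W :=
  submod_elt even_span_submod (even_span_act (even_clipP X) (submod_prop z)).

Lemma even_actf_linear X : linear (even_actf X).
Proof.
move=> a u w; apply: val_inj.
rewrite (submod_valD (a *: even_actf X u)) (submod_valZ a (even_actf X u)).
have -> : val (even_actf X (a *: u + w)) = act (even_clip X) (val (a *: u + w)) by [].
by rewrite (submod_valD (a *: u)) (submod_valZ a u) linearP.
Qed.

Definition even_actl X : {linear W -> W} := mklin (even_actf_linear X).

Lemma even_actE X z : X \in g0 -> val (even_actl X z) = act X (val z).
Proof. by move=> Xg; rewrite /= even_clipE. Qed.

Lemma even_sub_linear : action_linear g0 even_actl.
Proof.
move=> c X Y v Xg Yg; apply: val_inj.
have cXY : c *: X + Y \in g0.
  move: Xg Yg => /sl_partP[Xs Xp] /sl_partP[Ys Yp]; apply/sl_partP; split.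
    rewrite slE in Xs; rewrite slE in Ys; rewrite slE; apply/eqP.
    transitivity (c * (\sum_i (-1) ^+ odd_ix i * X i i) + \sum_i (-1) ^+ odd_ix i * Y i i).
      by rewrite mulr_sumr -big_split; apply: eq_bigr => i _ /=; rewrite !mxE; ring.
    by rewrite (eqP Xs) (eqP Ys) mulr0 addr0.
  by move=> i j h; rewrite !mxE Xp // Yp // mulr0 addr0.
rewrite (submod_valD (c *: even_actl X v)) (submod_valZ c (even_actl X v)) !even_actE //.
exact: act_lin.
Qed.

Lemma even_bracket_part (X Y : mx) : X \in g0 -> Y \in g0 -> sbracket false false X Y \in g0.
Proof.
move=> /sl_partP[_ Xp] /sl_partP[_ Yp]; rewrite /sbracket expr0 scale1r.
have subE (A A' : mx) i j : (A - A') i j = A i j - A' i j by rewrite !mxE.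
have comp (A A' : mx) : (forall i j, odd_ix i (+) odd_ix j != false -> A i j = 0) ->
    (forall i j, odd_ix i (+) odd_ix j != false -> A' i j = 0) ->
    forall i j, odd_ix i (+) odd_ix j != false -> (A *m A') i j = 0.
  move=> hA hA' i j h; rewrite mxE big1 // => k _.
  have [e|ik] := eqVneq (odd_ix i (+) odd_ix k) false; last by rewrite hA ?mul0r.
  rewrite hA' ?mulr0 //; move: h e.
  by case: (odd_ix i); case: (odd_ix k); case: (odd_ix j).
apply/sl_partP; split; last first.
  by move=> i j h; rewrite subE !comp // subr0.
rewrite slE; under eq_bigr => i _ do rewrite subE mulrBr !mxE !mulr_sumr.
rewrite sumrB [X in _ - X]exchange_big /= subr_eq0; apply/eqP.
apply: eq_bigr => i _; apply: eq_bigr => j _.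
have [e|ij] := eqVneq (odd_ix i (+) odd_ix j) false; last by rewrite Xp // mul0r !mulr0.
by rewrite [Y j i * _]mulrC; congr ((-1) ^+ _ * _); move: e; case: (odd_ix i); case: (odd_ix j).
Qed.

Lemma even_sub_bracket X Y v : X \in g0 -> Y \in g0 ->
  even_actl (sbracket false false X Y) v
  = even_actl X (even_actl Y v) - even_actl Y (even_actl X v).
Proof.
move=> Xg Yg; apply: val_inj.
rewrite (submod_valD (even_actl X (even_actl Y v))) -scaleN1r (submod_valZ (-1)).
by rewrite !even_actE // ?even_bracket_part // act_br // scaleN1r.
Qed.

Definition even_sub : even_module R m n := EvenModule even_sub_linear even_sub_bracket.

Lemma even_span_v0 : even_span v0.
Proof. by []. Qed.

Lemma even_sub_hw : even_highest_weight even_sub L.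
Proof.
exists (submod_elt even_span_submod even_span_v0); split.
  have [v00 hd hu] := hv0; split.
  - by apply: contraNneq v00 => /(congr1 val) /= ->.
  - move=> H Hg Hd; apply: val_inj.
    rewrite (submod_valZ _ (submod_elt even_span_submod even_span_v0)).
    by rewrite [LHS]even_actE //= hd.
  - by move=> X Xg Xu; apply: val_inj; rewrite [LHS]even_actE //= hu.
move=> N hN hs Nv w.
suff: exists2 z, N z & val z = val w by case=> z Nz /val_inj <-.
apply: (submod_prop w (fun x => exists2 z, N z & val z = x)).
- split; first by exists 0; [exact: hN.1|rewrite submod_val0].
  move=> c _ _ [x Nx <-] [y Ny <-]; exists (c *: x + y); first exact: hN.2.
  by rewrite (submod_valD (c *: x)) (submod_valZ c x).
- move=> X _ Xg [z Nz <-]; exists (even_actl X z); last exact: even_actE.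
  exact: hs.
- by exists (submod_elt even_span_submod even_span_v0).
Qed.

Lemma even_sub_unitarizable : even_unitarizable even_sub.
Proof.
pose b (u w : W) := B (val u) (val w).
have bl a u v w : b (a *: u + v) w = a * b u w + b v w.
  by rewrite /b (submod_valD (a *: u)) (submod_valZ a u) hform_linl.
have bh u v : b u v = (b v u)^* by rewrite /b hform_herm.
have bp u : u != 0 -> 0 < b u u.
  by move=> u0; apply: hform_pos; apply: contra_neq u0 => e; apply: val_inj.
have [f fE] := dot_of_hform (HForm bl bh bp).
exists f => X v w Xg; rewrite !fE /= /b.
have oX : omega_plus X \in g0.
  move: Xg => /sl_partP[]; rewrite slE => /eqP Xs Xp; apply/sl_partP; split; last first.
    by move=> i j h; rewrite omega_plusE Xp ?conjC0 // addbC.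
  rewrite slE; apply/eqP; rewrite -[RHS]conjC0 -[in RHS]Xs rmorph_sum.
  by apply: eq_bigr => i _; rewrite rmorphM rmorph_sign omega_plusE.
rewrite -[LHS]/(B (val (even_actl X v)) (val w)).
by rewrite -[RHS]/(B (val v) (val (even_actl (omega_plus X) w))) !even_actE // act_adj.
Qed.

End EvenCyclic.

Section Necessity.
Variables (R : realType) (m n : nat) (hm : (0 < m)%N) (hn : (0 < n)%N).
Variables (L : 'rV[R[i]]_(m + n)) (M : supermodule R m n).
Hypotheses (M_hw : highest_weight_supermodule M L) (M_unit : unitarizable M).

Lemma unitarizable_conditions : unitarity_conditions hm hn L /\ condition_b hm hn L.
Proof.
have [f [_ f_adj]] := M_unit; have [v0 [_ hv0 _]] := M_hw.
have [B BE] := hform_of_dot f.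
have B_adj X u w : X \in @sl R m n ->
    B (sm_act M X u) w = B u (sm_act M (omega_plus X) w).
  by move=> Xs; rewrite !BE; exact: f_adj.
have typ := unitary_typical (@sm_linear _ _ _ M) (@sm_bracket _ _ _ M) B_adj hv0 (hm := hm) hn.
have atyp := unitary_atypical (@sm_linear _ _ _ M) (@sm_bracket _ _ _ M) B_adj hv0 (hm := hm) hn.
split; last first.
  (* An atypical k has mu^k = mu^n, so minimality of k0 gives k0 <= k. Without one, all a_k are
     positive, a_n among them. *)
  move=> k0 _ hk0; have [[k ak]|h] := pselect (exists k, wform (L + rho R m n) (eps R n (last_ord hm) - del R m k) = 0).
    left; exists k => //; apply: hk0; rewrite wform_del_del.
    by rewrite wform_rho in ak; rewrite (atyp k ak).2 subrr.
  right; rewrite wform_rho; apply: typ => k; rewrite -wform_rho => e.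
  by apply: h; exists k.
split.
- have ss X : X \in @sl_part R m n false -> X \in @sl R m n by case/sl_partP.
  have l0 : action_linear (@sl_part R m n false) (sm_act M).
    by move=> c X Y v /ss Xs /ss Ys; exact: sm_linear.
  have b0 X Y v : X \in @sl_part R m n false -> Y \in @sl_part R m n false ->
      sm_act M (sbracket false false X Y) v = sm_act M X (sm_act M Y v) - sm_act M Y (sm_act M X v).
    by move=> Xs Ys; rewrite (sm_bracket v Xs Ys) expr0 scale1r.
  have h0 : hw_vector (@sl_part R m n false) (sm_act M) L v0.
    by case: hv0 => v00 hd hu; split=> // X /ss; [exact: hd|exact: hu].
  exists (even_sub l0 b0 v0); split; first exact: even_sub_hw.
  by apply: even_sub_unitarizable => X u w /ss; exact: B_adj.
- exact: (unitary_weight_chain (@sm_bracket _ _ _ M) B_adj hv0 hm hn).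
- move=> k; rewrite wform_rho => /atyp[gt0 e]; split; last by rewrite wform_del_del e subrr.
  by move=> j jk; rewrite wform_rho; exact: gt0.
- move=> h k; rewrite wform_rho; apply: typ => j; rewrite -wform_rho; exact: h.
Qed.

End Necessity.

(** * Fermionic Fock spaces *)

(* The exterior algebra on N fermionic modes, tensored with V.  In [vac o v] exactly the modes
   selected by o are occupied; [ext T] is the identity tensored with T, [gam] the parity. *)
Record car (C : numClosedFieldType) (V : lmodType C) (B : hform V) (N : nat) := Car {
  car_sp : lmodType C;
  car_form : hform car_sp;
  cr : nat -> {linear car_sp -> car_sp};
  an : nat -> {linear car_sp -> car_sp};
  vac : (nat -> bool) -> {linear V -> car_sp};
  proj : {linear car_sp -> V};
  ext : {linear V -> V} -> {linear car_sp -> car_sp};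
  gam : {linear car_sp -> car_sp};
  cr_cr : forall a b w, (a < N)%N -> (b < N)%N -> cr a (cr b w) = - cr b (cr a w);
  an_cr : forall a b w, (a < N)%N -> (b < N)%N ->
    an a (cr b w) = (a == b)%:R *: w - cr b (an a w);
  cr_adj : forall a u w, (a < N)%N -> car_form (cr a u) w = car_form u (an a w);
  vac_cr : forall (o : nat -> bool) a v, (a < N)%N -> o a -> cr a (vac o v) = 0;
  vac_an : forall (o : nat -> bool) a v, (a < N)%N -> ~~ o a -> an a (vac o v) = 0;
  vac_form : forall o u v, car_form (vac o u) (vac o v) = B u v;
  vac_proj : forall v w, car_form (vac (fun=> false) v) w = B v (proj w);
  ext_vac : forall T o v, ext T (vac o v) = vac o (T v);
  ext_cr : forall T a w, (a < N)%N -> ext T (cr a w) = cr a (ext T w);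
  gam_cr : forall a w, (a < N)%N -> gam (cr a w) = - cr a (gam w);
  gam_vac : forall o, exists b : bool, forall v, gam (vac o v) = (-1) ^+ b *: vac o v;
  gam_vac0 : forall v, gam (vac (fun=> false) v) = vac (fun=> false) v;
  car_ind : forall P : car_sp -> Prop, submod P ->
    (forall v, P (vac (fun=> false) v)) ->
    (forall a w, (a < N)%N -> P w -> P (cr a w)) -> forall w, P w;
  car_univ : forall (U : lmodType C) (X : nat -> {linear U -> U}) (q : {linear U -> V}),
    (forall a b u, (a < N)%N -> (b < N)%N -> X a (X b u) = - X b (X a u)) ->
    exists Phi : {linear U -> car_sp},
      (forall a u, (a < N)%N -> an a (Phi u) = Phi (X a u)) /\
      (forall u, proj (Phi u) = q u) }.

Section CarBase.
Variables (C : numClosedFieldType) (V : lmodType C) (B : hform V).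

Lemma car_base : car B 0.
Proof.
pose i : {linear V -> V} := idfun.
apply: (@Car C V B 0 V B (fun=> i) (fun=> i) (fun=> i) i id i) => //.
- by exists false => v; rewrite scale1r.
- by move=> U X q _; exists q.
Qed.

Variables (N : nat) (K : car B N).
Local Notation W := (car_sp K).
Local Notation W2 := (W * W)%type.

Lemma pair_linear (U : lmodType C) (f g : {linear U -> W}) :
  linear (fun x : U => (f x, g x) : W2).
Proof. by move=> a u w; rewrite !linearP. Qed.
Definition plin (U : lmodType C) (f g : {linear U -> W}) : {linear U -> W2} :=
  mklin (pair_linear f g).

Lemma fst_linear : linear (fun z : W2 => z.1). Proof. by []. Qed.
Lemma snd_linear : linear (fun z : W2 => z.2). Proof. by []. Qed.
Let p1 : {linear W2 -> W} := mklin fst_linear.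
Let p2 : {linear W2 -> W} := mklin snd_linear.
Lemma neg_linear : linear (fun z : W => - z). Proof. by move=> a u w; rewrite opprD scalerN. Qed.
Let neg : {linear W -> W} := mklin neg_linear.
Let z0 (U : lmodType C) : {linear U -> W} := \0.

Definition form2 (u w : W2) : C := car_form K u.1 w.1 + car_form K u.2 w.2.

Lemma form2_hform : {F : hform W2 | forall u w, F u w = form2 u w}.
Proof.
have l a u v w : form2 (a *: u + v) w = a * form2 u w + form2 v w.
  by rewrite /form2 /= !hform_linl; ring.
have h u v : form2 u v = (form2 v u)^*.
  by rewrite /form2 rmorphD /= -!hform_herm.
have p u : u != 0 -> 0 < form2 u u.
  move=> u0; rewrite lt_def addr_ge0 ?hform_ge0 // andbT /form2.
  rewrite paddr_eq0 ?hform_ge0 // !hform_eq0; apply: contra u0 => /andP[/eqP e1 /eqP e2].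
  by rewrite (surjective_pairing u) e1 e2.
by exists (HForm l h p).
Qed.

Lemma car_step : car B N.+1.
Proof.
have [F FE] := form2_hform.
(* In the second component of [W2] mode N is occupied: creating N moves the first component there.
   The older modes change sign on it so as to anticommute with the new one. *)
pose cr' a := if a == N then plin (z0 W2) p1 else plin (cr K a \o p1) (neg \o (cr K a \o p2)).
pose an' a := if a == N then plin p2 (z0 W2) else plin (an K a \o p1) (neg \o (an K a \o p2)).
pose vac' (o : nat -> bool) := if o N then plin (z0 V) (vac K o) else plin (vac K o) (z0 V).
pose proj' : {linear W2 -> V} := proj K \o p1.
pose ext' T := plin (ext K T \o p1) (ext K T \o p2).
pose gam' := plin (gam K \o p1) (neg \o (gam K \o p2)).
have lt a : (a < N.+1)%N -> a != N -> (a < N)%N by lia.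
apply: (@Car C V B N.+1 W2 F cr' an' vac' proj' ext' gam').
- move=> a b [x y] /lt aN /lt bN; rewrite /cr'.
  case: (eqVneq a N) aN => [_ _|_ /(_ isT) aN]; case: (eqVneq b N) bN => [_ _|_ /(_ isT) bN]; congr (_, _) => /=.
  all: rewrite ?linear0 ?oppr0 ?opprK //.
  + by rewrite cr_cr.
  + by rewrite !(linearN (cr K _)) !opprK cr_cr.
- move=> a b [x y] /lt aN /lt bN; rewrite /cr' /an'.
  case: (eqVneq a N) aN => [-> _|na /(_ isT) aN]; case: (eqVneq b N) bN => [-> _|nb /(_ isT) bN].
  + by rewrite scale1r; congr (_, _) => /=; rewrite ?subr0 ?subrr.
  + rewrite scale0r sub0r.
    by congr (_, _) => /=; rewrite ?linear0 ?opprK ?oppr0.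
  + rewrite (negPf na) scale0r sub0r.
    by congr (_, _) => /=; rewrite ?linear0 ?opprK ?oppr0.
  + congr (_, _) => /=; first by rewrite an_cr.
    by rewrite (linearN (an K _)) (linearN (cr K _)) !opprK an_cr.
- move=> a [x y] [z t] /lt aN; rewrite !FE /form2 /cr' /an'.
  case: (eqVneq a N) aN => [-> _|na /(_ isT) aN] /=.
    by rewrite hform0l hform0r add0r addr0.
  by rewrite hformNl hformNr !cr_adj.
- move=> o a v /lt aN oa; rewrite /cr' /vac'.
  case: (eqVneq a N) aN oa => [-> _ ->|na /(_ isT) aN oa] //.
  by case: ifP => _; congr (_, _) => /=; rewrite ?linear0 ?vac_cr ?oppr0.
- move=> o a v /lt aN oa; rewrite /an' /vac'.
  case: (eqVneq a N) aN oa => [-> _ /negPf ->|na /(_ isT) aN oa] //.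
  by case: ifP => _; congr (_, _) => /=; rewrite ?linear0 ?vac_an ?oppr0.
- move=> o u v; rewrite FE /form2 /vac'.
  by case: ifP => _ /=; rewrite hform0l ?add0r ?addr0 vac_form.
- by move=> v [x y]; rewrite FE /form2 /vac' /= hform0l addr0 vac_proj.
- move=> T o v; rewrite /ext' /vac'.
  by case: ifP => _; congr (_, _) => /=; rewrite ?linear0 ?ext_vac.
- move=> T a [x y] /lt aN; rewrite /ext' /cr'.
  case: (eqVneq a N) aN => [-> _|na /(_ isT) aN]; congr (_, _) => /=; rewrite ?linear0 //.
    by rewrite ext_cr.
  by rewrite (linearN (ext K _)) ext_cr.
- move=> a [x y] /lt aN; rewrite /gam' /cr'.
  case: (eqVneq a N) aN => [-> _|na /(_ isT) aN]; congr (_, _) => /=; rewrite ?linear0 ?oppr0 //.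
    by rewrite gam_cr.
  by rewrite (linearN (gam K)) (linearN (cr K _)) gam_cr.
- move=> o; have [b hb] := gam_vac K o; rewrite /gam' /vac'.
  case: ifP => _; last first.
    exists b => v; congr (_, _) => /=; first exact: hb.
    by rewrite linear0 scaler0 oppr0.
  exists (~~ b) => v; congr (_, _) => /=; first by rewrite linear0 scaler0.
  by rewrite hb signrN scaleNr.
- by move=> v; congr (_, _) => /=; rewrite ?linear0 ?oppr0 ?gam_vac0.
- move=> P hP Pv Pcr [x y].
  have P1 : forall x, P (x, 0).
    apply: (car_ind (c := K)).
    + split; first exact: hP.1.
      move=> c u v Pu Pw; have := hP.2 c _ _ Pu Pw.
      by congr P; congr (_, _) => /=; rewrite scaler0 addr0.
    + exact: Pv.
    + move=> a w aN /(Pcr a _ (ltnW aN)); congr P; rewrite /cr' ltn_eqF //.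
      by congr (_, _) => /=; rewrite linear0 oppr0.
  have := Pcr N _ (ltnSn N) (P1 y); rewrite /cr' eqxx => P2.
  have := submodD hP (P1 x) P2; congr P.
  by congr (_, _) => /=; rewrite ?addr0 ?add0r.
- move=> U X q Xa; have [a b u aN bN|Phi [P1 P2]] := car_univ K (X := X) q.
    by apply: Xa; exact: ltnW.
  (* The second component is what annihilating N has to return, the lift of [X N u]; this is
     consistent because [X N] squares to zero. *)
  exists (plin Phi (Phi \o X N)); split; last by move=> u; exact: P2.
  move=> a u /lt aN; rewrite /an'.
  case: (eqVneq a N) aN => [-> _|na /(_ isT) aN]; congr (_, _) => /=.
  + have /eqP := Xa N N u (ltnSn N) (ltnSn N).
    rewrite -addr_eq0 -mulr2n -scaler_nat scaler_eq0 pnatr_eq0 /= => /eqP ->.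
    by rewrite linear0.
  + by rewrite P1.
  + by rewrite P1 // (Xa a N u (ltnW aN) (ltnSn N)) (linearN Phi) opprK.
Qed.

End CarBase.

Theorem car_exists (C : numClosedFieldType) (V : lmodType C) (B : hform V) (N : nat) : car B N.
Proof. by elim: N => [|N K]; [exact: car_base | exact: car_step K]. Qed.

(** Also a device for computation: pairing a vector identity with an arbitrary z makes it a scalar
    one, within reach of [ring]. *)
Lemma hform_inj (C : numClosedFieldType) (V : lmodType C) (B : hform V) (u v : V) :
  (forall w, B u w = B v w) -> u = v.
Proof.
move=> h; apply/eqP; rewrite -subr_eq0 -(hform_eq0 B) hformBl h.
by rewrite subrr.
Qed.

Section CarModes.
Variables (C : numClosedFieldType) (V : lmodType C) (B : hform V) (J : finType).
Variable K : car B #|J|.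
Local Notation W := (car_sp K).
Local Notation BW := (car_form K).

Definition mcr (a : J) : {linear W -> W} := cr K (enum_rank a).
Definition man (a : J) : {linear W -> W} := an K (enum_rank a).
Definition mvac (o : J -> bool) : {linear V -> W} :=
  vac K (fun k => [exists a : J, (enum_rank a == k :> nat) && o a]).
Definition vac0 : {linear V -> W} := vac K (fun=> false).

Lemma mcr_mcr a b w : mcr a (mcr b w) = - mcr b (mcr a w).
Proof. exact: cr_cr. Qed.

Lemma man_mcr a b w : man a (mcr b w) = (a == b)%:R *: w - mcr b (man a w).
Proof. by rewrite an_cr //; congr (_%:R *: _ - _); rewrite (inj_eq val_inj) (inj_eq enum_rank_inj). Qed.

Lemma mcr_adj a u w : BW (mcr a u) w = BW u (man a w).
Proof. exact: cr_adj. Qed.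

Lemma man_adj a u w : BW (man a u) w = BW u (mcr a w).
Proof. by rewrite hform_herm -mcr_adj -hform_herm. Qed.

Lemma mvac_mcr (o : J -> bool) a v : o a -> mcr a (mvac o v) = 0.
Proof. by move=> oa; apply: vac_cr => //; apply/existsP; exists a; rewrite eqxx. Qed.

Lemma mvac_man (o : J -> bool) a v : ~~ o a -> man a (mvac o v) = 0.
Proof.
move=> oa; apply: vac_an => //; apply/existsPn => b.
by apply: contra oa => /andP[/eqP/val_inj/enum_rank_inj <-].
Qed.

Lemma man_vac0 a v : man a (vac0 v) = 0.
Proof. exact: vac_an. Qed.

Lemma vac0_proj v w : BW (vac0 v) w = B v (proj K w).
Proof. exact: vac_proj. Qed.

Lemma proj_vac0 v : proj K (vac0 v) = v.
Proof.
apply: (hform_inj (B := B)) => z.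
by rewrite hform_herm -vac0_proj vac_form -hform_herm.
Qed.

Lemma proj_mcr a w : proj K (mcr a w) = 0.
Proof.
apply: (hform_inj (B := B)) => z.
by rewrite hform_herm -vac0_proj -man_adj man_vac0 !hform0l conjC0.
Qed.

Lemma mcar_ind (P : W -> Prop) : submod P -> (forall v, P (vac0 v)) ->
  (forall a w, P w -> P (mcr a w)) -> forall w, P w.
Proof.
move=> hP hv hc; apply: car_ind => // a w aJ Pw.
have -> : a = enum_rank (enum_val (Ordinal aJ)) by rewrite enum_valK.
exact: hc.
Qed.

(** Cofreeness of the exterior algebra, dual to its generation by creation operators. With [X] the
    odd raising operators it yields the map behind the contravariant form. *)
Lemma mcar_univ (U : lmodType C) (X : J -> {linear U -> U}) (q : {linear U -> V}) :
    (forall a b u, X a (X b u) = - X b (X a u)) ->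
    exists Phi : {linear U -> W},
      (forall a u, man a (Phi u) = Phi (X a u)) /\
      (forall u, proj K (Phi u) = q u).
Proof.
move=> hX.
pose X' (k : nat) : {linear U -> U} := if insub k is Some i then X (@enum_val J xpredT i) else \0.
have X'E (a : J) : X' (enum_rank a) = X a by rewrite /X' valK enum_rankK.
have X'e k : (k < #|J|)%N -> exists a, k = enum_rank a /\ X' k = X a.
  move=> kJ; exists (enum_val (Ordinal kJ)); rewrite enum_valK; split=> //.
  by rewrite -X'E enum_valK.
have [|Phi [P1 P2]] := @car_univ _ _ _ _ K U X' q.
  by move=> a b u /X'e[a' [_ ->]] /X'e[b' [_ ->]].
exists Phi; split=> // a u; rewrite /man P1 ?X'E //.
Qed.

Lemma ext_vac0 T v : ext K T (vac0 v) = vac0 (T v).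
Proof. exact: ext_vac. Qed.

Lemma ext_mcr T a w : ext K T (mcr a w) = mcr a (ext K T w).
Proof. exact: ext_cr. Qed.

Lemma ext_man T a w : ext K T (man a w) = man a (ext K T w).
Proof.
elim/mcar_ind: w => [|v|b w IH].
- split=> [|c u w hu hw]; first by rewrite !linear0.
  by rewrite !linearP hu hw.
- by rewrite man_vac0 linear0 ext_vac0 man_vac0.
- by rewrite man_mcr ext_mcr man_mcr linearB linearZ /= ext_mcr IH.
Qed.

Lemma ext_proj T w : proj K (ext K T w) = T (proj K w).
Proof.
elim/mcar_ind: w => [|v|b w IH].
- split=> [|c u w hu hw]; first by rewrite !linear0.
  by rewrite !linearP hu hw.
- by rewrite ext_vac0 !proj_vac0.
- by rewrite ext_mcr !proj_mcr linear0.
Qed.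

Lemma ext_adj (T T' : {linear V -> V}) : (forall u v, B (T u) v = B u (T' v)) ->
  forall u w, BW (ext K T u) w = BW u (ext K T' w).
Proof.
move=> hT u; elim/mcar_ind: u => [|v w|a u IH w].
- split=> [|c u w hu hw z]; first by move=> z; rewrite linear0 !hform0l.
  by rewrite linearP !hform_linl hu hw.
- by rewrite ext_vac0 !vac0_proj hT ext_proj.
- by rewrite ext_mcr !mcr_adj IH ext_man.
Qed.

Lemma gam_mcr a w : gam K (mcr a w) = - mcr a (gam K w).
Proof. exact: gam_cr. Qed.

Lemma gam_vac00 v : gam K (vac0 v) = vac0 v.
Proof. exact: gam_vac0. Qed.

Lemma gam_gam w : gam K (gam K w) = w.
Proof.
elim/mcar_ind: w => [|v|a w IH].
- split=> [|c u w hu hw]; first by rewrite !linear0.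
  by rewrite !linearP hu hw.
- by rewrite !gam_vac00.
- by rewrite gam_mcr linearN gam_mcr opprK IH.
Qed.

Lemma gam_ext T w : gam K (ext K T w) = ext K T (gam K w).
Proof.
elim/mcar_ind: w => [|v|b w IH].
- split=> [|c u w hu hw]; first by rewrite !linear0.
  by rewrite !linearP hu hw.
- by rewrite ext_vac0 !gam_vac00 ext_vac0.
- by rewrite ext_mcr !gam_mcr linearN /= ext_mcr IH.
Qed.

Lemma gam_man a w : gam K (man a w) = - man a (gam K w).
Proof.
elim/mcar_ind: w => [|v|b w IH].
- split=> [|c u w hu hw]; first by rewrite !linear0.
  by rewrite !linearP hu hw.
- by rewrite gam_vac00 man_vac0 linear0 oppr0.
- rewrite gam_mcr (linearN (man a)) opprK !man_mcr linearB linearZ /= gam_mcr IH.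
  by rewrite (linearN (mcr b)) opprK.
Qed.

Lemma proj_gam w : proj K (gam K w) = proj K w.
Proof.
elim/mcar_ind: w => [|v|b w IH].
- split=> [|c u w hu hw]; first by rewrite !linear0.
  by rewrite !linearP hu hw.
- by rewrite gam_vac00.
- by rewrite gam_mcr linearN /= !proj_mcr oppr0.
Qed.

Lemma gam_adj u w : BW (gam K u) w = BW u (gam K w).
Proof.
elim/mcar_ind: u w => [|v w|a u IH w].
- split=> [|c u w hu hw z]; first by move=> z; rewrite linear0 !hform0l.
  by rewrite linearP !hform_linl hu hw.
- by rewrite gam_vac00 !vac0_proj proj_gam.
- by rewrite gam_mcr hformNl !mcr_adj IH gam_man hformNr opprK.
Qed.

End CarModes.

Section LinearSums.
Variables (C : numClosedFieldType) (U V : lmodType C).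

Lemma linear_big (I : Type) (r : seq I) (P : pred I) (f : I -> {linear U -> V}) :
  linear (fun w => \sum_(i <- r | P i) f i w).
Proof.
move=> a u w; rewrite scaler_sumr -big_split; apply: eq_bigr => i _ /=.
exact: linearP.
Qed.

Lemma linear_addf (f g : U -> V) : linear f -> linear g -> linear (fun w => f w + g w).
Proof. by move=> hf hg a u w; rewrite hf hg scalerDr addrACA. Qed.

Lemma linear_subf (f g : U -> V) : linear f -> linear g -> linear (fun w => f w - g w).
Proof. by move=> hf hg a u w; rewrite hf hg scalerBr opprD addrACA. Qed.

Lemma submod_eq (f g : {linear U -> V}) : submod (fun w => f w = g w).
Proof. by split=> [|c u w hu hw]; [rewrite !linear0|rewrite !linearP hu hw]. Qed.

End LinearSums.

Fact klin_key : unit. Proof. exact: tt. Qed.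

(* Sealed, so that simplification does not unfold the operators built with it. *)
Definition klin (C : nzRingType) (U V : lmodType C) (f : U -> V) (fP : linear f) :
  {linear U -> V} := locked_with klin_key (mklin fP).

Lemma klinE (C : nzRingType) (U V : lmodType C) (f : U -> V) (fP : linear f) x :
  klin fP x = f x.
Proof. by rewrite /klin unlock. Qed.

(** * Kac modules and the typical case *)

Section Kac.
Variables (C : numClosedFieldType) (m n : nat) (V : lmodType C) (B : hform V).
Variables (A : 'I_m -> 'I_m -> {linear V -> V}) (D : 'I_n -> 'I_n -> {linear V -> V}).
Hypothesis A_A : forall i j k l v,
  A i j (A k l v) = A k l (A i j v) + (j == k)%:R *: A i l v - (l == i)%:R *: A k j v.
Hypothesis D_D : forall i j k l v,
  D i j (D k l v) = D k l (D i j v) + (j == k)%:R *: D i l v - (l == i)%:R *: D k j v.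
Hypothesis A_D : forall i j k l v, A i j (D k l v) = D k l (A i j v).
Hypothesis A_adj : forall i j u w, B (A i j u) w = B u (A j i w).
Hypothesis D_adj : forall i j u w, B (D i j u) w = B u (D j i w).

Variable K : car B #|{: 'I_m * 'I_n}|.
Local Notation W := (car_sp K).
Local Notation BW := (car_form K).
Local Notation Y i k := (@mcr C V B _ K (i, k)).
Local Notation Y' i k := (@man C V B _ K (i, k)).
Local Notation ex := (ext K).

(** The second term is the derivation of the exterior algebra that extends the adjoint action on the
    odd lowering operators. [Y i k] has weight delta_k - eps_i, hence the minus sign and the order
    of the indices. *)
Definition kacA (i j : 'I_m) : {linear W -> W} :=
  klin (linear_subf (linearP (ex (A i j)))
    (linear_big (index_enum 'I_n) xpredT (fun k : 'I_n => Y j k \o Y' i k : {linear W -> W}))).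

Definition kacD (k l : 'I_n) : {linear W -> W} :=
  klin (linear_addf (linearP (ex (D k l)))
    (linear_big (index_enum 'I_m) xpredT (fun i : 'I_m => Y i k \o Y' i l : {linear W -> W}))).

(** Forced by killing the vacuum and having the anticommutators of gl(m|n) with the [Y]. The terms
    cubic in the modes must occur once: they come with [kacA], so [D] enters through its action on V
    alone. *)
Definition kacX (i : 'I_m) (k : 'I_n) : {linear W -> W} :=
  klin (linear_addf
    (linear_big (index_enum 'I_m) xpredT (fun j : 'I_m => kacA i j \o Y' j k : {linear W -> W}))
    (linear_big (index_enum 'I_n) xpredT (fun q : 'I_n => ex (D q k) \o Y' i q : {linear W -> W}))).

Definition kacE (a b : 'I_(m + n)) : {linear W -> W} :=
  match split a, split b with
  | inl i, inl j => kacA i j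
  | inl i, inr k => kacX i k
  | inr k, inl i => Y i k
  | inr k, inr l => kacD k l
  end.

Lemma kacA_def i j w : kacA i j w = ex (A i j) w - \sum_k Y j k (Y' i k w).
Proof. exact: klinE. Qed.
Lemma kacD_def k l w : kacD k l w = ex (D k l) w + \sum_i Y i k (Y' i l w).
Proof. exact: klinE. Qed.
Lemma kacX_def i k w : kacX i k w = \sum_j kacA i j (Y' j k w) + \sum_q ex (D q k) (Y' i q w).
Proof. exact: klinE. Qed.

Lemma kacE_ll i j : kacE (lshift n i) (lshift n j) = kacA i j.
Proof. by rewrite /kacE (unsplitK (inl i : 'I_m + 'I_n)) (unsplitK (inl j : 'I_m + 'I_n)). Qed.
Lemma kacE_lr i k : kacE (lshift n i) (rshift m k) = kacX i k.
Proof. by rewrite /kacE (unsplitK (inl i : 'I_m + 'I_n)) (unsplitK (inr k : 'I_m + 'I_n)). Qed.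
Lemma kacE_rl k i : kacE (rshift m k) (lshift n i) = Y i k.
Proof. by rewrite /kacE (unsplitK (inl i : 'I_m + 'I_n)) (unsplitK (inr k : 'I_m + 'I_n)). Qed.
Lemma kacE_rr k l : kacE (rshift m k) (rshift m l) = kacD k l.
Proof. by rewrite /kacE (unsplitK (inr k : 'I_m + 'I_n)) (unsplitK (inr l : 'I_m + 'I_n)). Qed.

Lemma sum_deltaZ (U : lmodType C) (I : finType) (i : I) (F : I -> U) :
  \sum_j (i == j)%:R *: F j = F i.
Proof.
rewrite (bigD1 i) //= eqxx scale1r big1 ?addr0 // => j /negPf ji.
by rewrite eq_sym ji scale0r.
Qed.

Lemma kacA_Y i j p l w : kacA i j (Y p l w) = Y p l (kacA i j w) - (i == p)%:R *: Y j l w.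
Proof.
rewrite !kacA_def ext_mcr linearB (linear_sum (Y p l)) -addrA; congr (_ + _).
rewrite (eq_bigr (fun k => (l == k)%:R *: ((i == p)%:R *: Y j k w) + Y p l (Y j k (Y' i k w)))).
  by rewrite big_split sum_deltaZ opprD addrC.
move=> k _; rewrite man_mcr linearB linearZ /= mcr_mcr opprK scalerA; congr (_ *: _ + _).
by rewrite -natrM mulnb xpair_eqE andbC [l == k]eq_sym.
Qed.

Lemma kacD_Y k l p q w : kacD k l (Y p q w) = Y p q (kacD k l w) + (l == q)%:R *: Y p k w.
Proof.
rewrite !kacD_def ext_mcr linearD (linear_sum (Y p q)) -addrA; congr (_ + _).
rewrite (eq_bigr (fun i => (p == i)%:R *: ((l == q)%:R *: Y i k w) + Y p q (Y i k (Y' i l w)))).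
  by rewrite big_split sum_deltaZ addrC.
move=> i _; rewrite man_mcr linearB linearZ /= mcr_mcr opprK scalerA; congr (_ *: _ + _).
by rewrite -natrM mulnb xpair_eqE [p == i]eq_sym.
Qed.

(** Moving [Y p l] out of [kacA] leaves terms [Y j l (Y' j k w)], whose sum is precisely the part of
    [kacD l k] missing from the second sum of [kacX]. *)
Lemma kacX_Y i k p l w :
  kacX i k (Y p l w) = (k == l)%:R *: kacA i p w + (p == i)%:R *: kacD l k w - Y p l (kacX i k w).
Proof.
rewrite !kacX_def.
rewrite (eq_bigr (fun j => ((p == j)%:R *: ((k == l)%:R *: kacA i j w)
    - Y p l (kacA i j (Y' j k w))) + (p == i)%:R *: Y j l (Y' j k w))); last first.
  move=> j _; rewrite man_mcr linearB linearZ /= kacA_Y scalerA.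
  rewrite opprB addrA addrAC [i == p]eq_sym; congr (_ *: _ - _ + _).
  by rewrite -natrM mulnb xpair_eqE [p == j]eq_sym.
rewrite (eq_bigr (fun q => (l == q)%:R *: ((p == i)%:R *: ex (D q k) w)
    - Y p l (ex (D q k) (Y' i q w)))); last first.
  move=> q _; rewrite man_mcr linearB linearZ /= ext_mcr scalerA.
  by rewrite -natrM mulnb xpair_eqE andbC [i == p]eq_sym [l == q]eq_sym.
rewrite !big_split /= !sumrN -!linear_sum !sum_deltaZ.
rewrite /= kacD_def scalerDr (linearD (Y p l)) opprD !addrA.
by rewrite [LHS](ACl (1*4*3*2*5)).
Qed.

Lemma kacE_Y a b p q w :
  let s := (-1) ^+ (odd_ix a (+) odd_ix b) in
  kacE a b (Y p q w) = s *: Y p q (kacE a b w) + (b == rshift m q)%:R *: kacE a (lshift n p) w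
    - (s * (lshift n p == a)%:R) *: kacE (rshift m q) b w.
Proof.
have [i ->|k ->] := split_ordP a; have [j ->|l ->] := split_ordP b; rewrite /= ?odd_ixl ?odd_ixr /=
  ?kacE_ll ?kacE_lr ?kacE_rl ?kacE_rr ?eq_lshift ?eq_rshift ?eq_lrshift ?eq_rlshift
  ?scale0r ?mulr0 ?scale0r ?addr0 ?subr0 ?expr0 ?expr1 ?mul1r ?scale1r ?scaleN1r ?mulN1r.
- by rewrite kacA_Y eq_sym.
- rewrite kacX_Y [l == q]eq_sym scaleNr opprK.
  by rewrite [RHS](ACl (2*3*1)).
- by rewrite mcr_mcr.
- by rewrite kacD_Y.
Qed.

Lemma kacA_vac i j v : kacA i j (vac0 K v) = vac0 K (A i j v).
Proof. by rewrite kacA_def ext_vac0 big1 ?subr0 // => k _; rewrite man_vac0 linear0. Qed.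

Lemma kacD_vac k l v : kacD k l (vac0 K v) = vac0 K (D k l v).
Proof. by rewrite kacD_def ext_vac0 big1 ?addr0 // => i _; rewrite man_vac0 linear0. Qed.

Lemma kacX_vac i k v : kacX i k (vac0 K v) = 0.
Proof. by rewrite kacX_def !big1 ?addr0 // => j _; rewrite man_vac0 linear0. Qed.

Definition bracket_at (E : 'I_(m + n) -> 'I_(m + n) -> {linear W -> W}) (w : W) :=
  forall a b c d,
    let s := (-1) ^+ ((odd_ix a (+) odd_ix b) && (odd_ix c (+) odd_ix d)) in
    E a b (E c d w) = s *: E c d (E a b w)
      + (b == c)%:R *: E a d w - (s * (d == a)%:R) *: E c b w.

Lemma bracket_at_submod E : submod (bracket_at E).
Proof.
split=> [|x u w hu hw] a b c d /=; first by rewrite !linear0 ?addr0 ?subr0.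
rewrite !linearP (hu a b c d) (hw a b c d).
by apply: (hform_inj (B := BW)) => z; rewrite !(hformDl, hformNl, hformZl); ring.
Qed.

(** On the vacuum everything reduces to the relations on V and to commutators with one [Y]. The step
    from w to [Y p q w] is the Jacobi identity and uses the relation at w for five quadruples. *)
Lemma kac_bracket_at w : bracket_at kacE w.
Proof.
elim/mcar_ind: w => [|v|[p q] w IH]; first exact: bracket_at_submod.
- move=> a b c d /=; have [i ea|k ea] := split_ordP a; have [j eb|l eb] := split_ordP b;
  have [i' ec|k' ec] := split_ordP c; have [j' ed|l' ed] := split_ordP d.
  all: rewrite ?ea ?eb ?ec ?ed ?odd_ixl ?odd_ixr ?eq_lshift ?eq_rshift ?eq_lrshift ?eq_rlshift /=
    ?mulr0 ?scale0r ?addr0 ?subr0 ?expr0 ?expr1 ?mul1r ?scale1r.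
  all: rewrite ?kacE_ll ?kacE_lr ?kacE_rl ?kacE_rr.
  all: rewrite ?(kacA_Y, kacD_Y, kacX_Y, kacA_vac, kacX_vac, kacD_vac, linear0, scaler0, addr0, subr0, add0r).
  all: try by [].
  + by rewrite A_A (linearB (vac0 K)) linearD !linearZ.
  + by rewrite eq_sym.
  + by rewrite A_D.
  + by apply: (hform_inj (B := BW)) => z; rewrite ?(hformDl, hformNl, hformZl); ring.
  + by rewrite [i' == j]eq_sym subrK.
  + by apply: (hform_inj (B := BW)) => z; rewrite ?(hformDl, hformNl, hformZl, hform0l); ring.
  + by rewrite mcr_mcr scaleN1r.
  + by rewrite addrK.
  + by rewrite A_D.
  + by rewrite D_D (linearB (vac0 K)) linearD !linearZ.
- move=> a b c d /=.
  rewrite !kacE_Y !(linearD (kacE _ _)) !(linearN (kacE _ _)) !(linearZ_LR (kacE _ _)) !kacE_Y.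
  rewrite (IH a b c d) (IH a (lshift n p) c d) (IH (rshift m q) b c d)
    (IH a b c (lshift n p)) (IH a b (rshift m q) d).
  rewrite !(linearD (mcr _ _)) !(linearN (mcr _ _)) !(linearZ_LR (mcr _ _)).
  apply: (hform_inj (B := BW)) => z; rewrite !(hformDl, hformNl, hformZl).
  pose f a b c d := BW (kacE a b (kacE c d w)) z; pose g a b := BW (kacE a b w) z.
  pose f' a b c d := BW (Y p q (kacE a b (kacE c d w))) z; pose g' a b := BW (Y p q (kacE a b w)) z.
  rewrite -!/(f _ _ _ _) -!/(g _ _) -!/(f' _ _ _ _) -!/(g' _ _); move: f g f' g' => f g f' g'.
  have [i ->|k ->] := split_ordP a; have [j ->|l ->] := split_ordP b;
  have [i' ->|k' ->] := split_ordP c; have [j' ->|l' ->] := split_ordP d;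
  rewrite ?odd_ixl ?odd_ixr ?eq_lshift ?eq_rshift ?eq_lrshift ?eq_rlshift /= ?expr0 ?expr1; ring.
Qed.

Lemma kac_superrep : superrep kacE.
Proof.
move=> a b c d w /=; rewrite (kac_bracket_at w a b c d) /=.
by apply: (hform_inj (B := BW)) => z; rewrite !(hformDl, hformNl, hformZl); ring.
Qed.

End Kac.

Lemma sum_square (V : nmodType) N (F : 'I_N -> 'I_N -> V) :
  \sum_a \sum_b F a b
  = \sum_a F a a + \sum_(a < N) \sum_(b < N | (a < b)%N) (F a b + F b a).
Proof.
have split a : \sum_b F a b
    = F a a + (\sum_(b < N | (a < b)%N) F a b + \sum_(b < N | (b < a)%N) F a b).
  rewrite (bigD1 a) //=; congr (_ + _); rewrite (bigID (fun b : 'I_N => (a < b)%N)) /=.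
  congr (_ + _); apply: eq_bigl => b; rewrite -val_eqE /=; lia.
rewrite (eq_bigr _ (fun a _ => split a)) big_split /=; congr (_ + _).
rewrite big_split /= [X in _ + X = _](exchange_big_dep xpredT) //= -big_split /=.
by apply: eq_bigr => a _; rewrite -big_split.
Qed.

(** * The Casimir operator of gl(m|n) *)

Section Casimir.
Variables (C : numClosedFieldType) (m n : nat) (V : lmodType C).
Variables (B : hform V) (E : 'I_(m + n) -> 'I_(m + n) -> {linear V -> V}).
Hypothesis E_rep : superrep E.
Local Notation p := (@odd_ix m n).
Local Notation sg a := ((-1) ^+ p a : C).

Lemma superrepE i j k l w :
  E i j (E k l w) = (-1) ^+ ((p i (+) p j) && (p k (+) p l)) *: E k l (E i j w)
    + (j == k)%:R *: E i l w
    - ((-1) ^+ ((p i (+) p j) && (p k (+) p l)) * (l == i)%:R) *: E k j w.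
Proof. by have /eqP := E_rep i j k l w; rewrite subr_eq => /eqP ->; rewrite addrC addrA. Qed.

Definition casimir (w : V) : V := \sum_a \sum_b sg b *: E a b (E b a w).

Lemma casimir_linear : linear casimir.
Proof.
move=> x u w; rewrite /casimir scaler_sumr -big_split; apply: eq_bigr => a _ /=.
rewrite scaler_sumr -big_split; apply: eq_bigr => b _ /=.
by rewrite !linearP.
Qed.

(** [E c d] passes both factors of a summand at the cost of four sums: the two with [Q] cancel, and
    [P c] cancels against [P d] because their signs agree. *)
Lemma casimir_comm c d w : E c d (casimir w) = casimir (E c d w).
Proof.
pose P x := \sum_a (sg x * (-1) ^+ ((p c (+) p d) && (p a (+) p x))) *: E a d (E c a w).
pose Q b := sg b *: E c b (E b d w).
have PE : P c = P d.
  apply: eq_bigr => a _; congr (_ *: _).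
  by case: (p a); case: (p c); case: (p d); rewrite /= ?expr0 ?expr1 ?mulr1 ?mul1r ?mulrNN ?mulr1.
rewrite /casimir linear_sum.
transitivity (\sum_a (\sum_b sg b *: E a b (E b a (E c d w))
   + ((sg d * (-1) ^+ ((p c (+) p d) && (p a (+) p d))) *: E a d (E c a w)
      - (c == a)%:R *: \sum_b Q b + (d == a)%:R *: \sum_b Q b
      - (sg c * (-1) ^+ ((p c (+) p d) && (p a (+) p c))) *: E a d (E c a w)))); last first.
  by rewrite big_split /= !big_split /= !sumrN !sum_deltaZ -/(P c) -/(P d) PE subrK subrr addr0.
apply: eq_bigr => a _; rewrite linear_sum.
rewrite -(sum_deltaZ d (fun b => (sg b * (-1) ^+ ((p c (+) p d) && (p a (+) p b))) *: E a b (E c a w))).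
rewrite -(sum_deltaZ c (fun b => (sg b * (-1) ^+ ((p c (+) p d) && (p a (+) p b))) *: E a d (E b a w))).
rewrite !scaler_sumr -!sumrB -!big_split -!sumrB -!big_split /=; apply: eq_bigr => b _.
rewrite linearZ /= superrepE [E c d (E b a w)]superrepE.
rewrite !(linearB (E _ _)) !(linearD (E _ _)) !(linearZ_LR (E _ _)) /Q.
rewrite [a == c]eq_sym [b == c]eq_sym [p b (+) p a]addbC.
have sq (x : bool) : (-1) ^+ x * (-1) ^+ x = 1 :> C by case: x; rewrite ?mulrNN mulr1.
move: (sq ((p c (+) p d) && (p a (+) p b))); set s := (-1) ^+ ((p c (+) p d) && (p a (+) p b)).
move=> ss; apply: (hform_inj (B := B)) => z; rewrite !(hformDl, hformNl, hformZl).
case: (eqVneq c a) => [ca|_]; case: (eqVneq d a) => [da|_]; rewrite ?ca ?da; move: ss; clearbody s => ss.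
all: rewrite /=; ring: ss.
Qed.

(** This is (nu, nu + 2 rho) in the bilinear form of the statement. *)
Definition casimir_val (nu : 'I_(m + n) -> C) : C :=
  \sum_a sg a * nu a ^+ 2
  + \sum_(a < m + n) \sum_(b < m + n | (a < b)%N) (sg b * nu a - sg a * nu b).

Lemma casimir_weight nu w : (forall a, E a a w = nu a *: w) ->
  casimir w = casimir_val nu *: w
    + \sum_(a < m + n) \sum_(b < m + n | (a < b)%N) (sg a * 2) *: E b a (E a b w).
Proof.
move=> hw; rewrite /casimir sum_square /casimir_val scalerDl -addrA; congr (_ + _).
  rewrite scaler_suml; apply: eq_bigr => a _.
  by rewrite hw linearZ /= hw !scalerA.
rewrite scaler_suml -big_split; apply: eq_bigr => a _ /=.
rewrite scaler_suml -big_split; apply: eq_bigr => b ab /=.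
rewrite [E a b (E b a w)]superrepE !hw !eqxx [p b (+) p a]addbC andbb.
apply: (hform_inj (B := B)) => z; rewrite !(hformDl, hformNl, hformZl).
by case: (p a); case: (p b); rewrite /= ?expr0 ?expr1; ring.
Qed.

End Casimir.

Lemma sum_deltaM (C : pzRingType) (I : finType) (i : I) (f : I -> C) :
  \sum_j f j * (i == j)%:R = f i.
Proof.
rewrite (bigD1 i) //= eqxx mulr1 big1 ?addr0 // => j /negPf ji.
by rewrite eq_sym ji mulr0.
Qed.

(** * Row and column counts of a set of odd roots *)

Section Words.
Variables (m n : nat).
Local Notation J := ('I_m * 'I_n)%type.
Implicit Types S : seq J.

(** A pair (i, k) stands for the odd root eps_i - delta_k: the product of the lowering operators
    over [S] removes eps_i from the weight [rowc] times and adds delta_k [colc] times. *)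
Definition rowc S (i : 'I_m) := count (fun a : J => a.1 == i) S.
Definition colc S (k : 'I_n) := count (fun a : J => a.2 == k) S.

Lemma sum_rowc (C : pzRingType) (f : 'I_m -> C) S :
  \sum_i f i * (rowc S i)%:R = \sum_(a <- S) f a.1.
Proof.
elim: S => [|a S IH]; first by rewrite big_nil big1 // => i _; rewrite mulr0.
rewrite big_cons -IH -(sum_deltaM a.1 f) -big_split.
by apply: eq_bigr => i _; rewrite /rowc /= natrD mulrDr addrC.
Qed.

Lemma sum_colc (C : pzRingType) (f : 'I_n -> C) S :
  \sum_k f k * (colc S k)%:R = \sum_(a <- S) f a.2.
Proof.
elim: S => [|a S IH]; first by rewrite big_nil big1 // => i _; rewrite mulr0.
rewrite big_cons -IH -(sum_deltaM a.2 f) -big_split.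
by apply: eq_bigr => i _; rewrite /colc /= natrD mulrDr addrC.
Qed.

Lemma colc_ge S : (size S <= \sum_(a <- S) colc S a.2)%N.
Proof.
rewrite -sum1_size big_seq [X in (_ <= X)%N]big_seq; apply: leq_sum => a aS.
by rewrite -has_count; apply/hasP; exists a.
Qed.

Lemma row_tail_le S (a : J) : uniq S ->
  (count (fun b : J => (b.1 == a.1) && (a.2 < b.2)%N) S <= n.-1 - a.2)%N.
Proof.
move=> uS; rewrite -size_filter; set T := filter _ _.
rewrite -(size_map (fun b : J => val b.2)) -(size_iota a.2.+1 (n.-1 - a.2)).
apply: uniq_leq_size.
  rewrite map_inj_in_uniq ?filter_uniq // => b c.
  rewrite !mem_filter => /andP[/andP[/eqP b1 _] _] /andP[/andP[/eqP c1 _] _] /val_inj e.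
  by rewrite (surjective_pairing b) (surjective_pairing c) b1 c1 e.
move=> k /mapP[b]; rewrite mem_filter => /andP[/andP[_ ab] _] ->; rewrite mem_iota /=.
by move: ab (ltn_ord b.2) => /=; set x := nat_of_ord b.2; set y := nat_of_ord a.2; lia.
Qed.

(** The left side counts ordered pairs in a common row: a root with itself, with one to its right,
    or with one to its left. The last two kinds are mirror images, and at most n - 1 - k columns lie
    to the right of column k. *)
Lemma rowc_le S : uniq S ->
  (\sum_(a <- S) rowc S a.1 <= size S + (\sum_(a <- S) (n.-1 - a.2)).*2)%N.
Proof.
move=> uS.
pose up (a b : J) := (b.1 == a.1) && (a.2 < b.2)%N.
have e1 a : a \in S -> rowc S a.1 = (count (up a) S + (1 + count (up^~ a) S))%N.
  move=> aS; have <- : count_mem a S = 1%N by rewrite count_uniq_mem ?aS.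
  have cnt3 (p p1 p2 p3 : pred J) : (forall b, p b = (p1 b + (p2 b + p3 b))%N :> nat) ->
      count p S = (count p1 S + (count p2 S + count p3 S))%N.
    by move=> h; elim: (S) => //= b T ->; have := h b; lia.
  apply: cnt3 => b; rewrite /up [a.1 == b.1]eq_sym; case: (eqVneq b.1 a.1) => [e|ne] /=.
    rewrite (surjective_pairing b) (surjective_pairing a) xpair_eqE e eqxx /=.
    by rewrite -val_eqE /=; case: ltngtP.
  by have -> : (b == a) = false by apply: contraNF ne => /eqP ->.
rewrite big_seq (eq_bigr _ e1) -big_seq !big_split /= sum1_size addnCA leq_add2l.
have -> : (\sum_(a <- S) count (up^~ a) S = \sum_(a <- S) count (up a) S)%N.
  under eq_bigr => a _ do rewrite -sum1_count big_mkcond.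
  under [RHS]eq_bigr => a _ do rewrite -sum1_count big_mkcond.
  by rewrite exchange_big.
rewrite addnn leq_double; apply: leq_sum => a _; exact: row_tail_le.
Qed.

End Words.

(** * The Casimir gap *)

Section Gap.
Variables (R : realType) (m n : nat).
Local Notation C := R[i].
Variables (lam : 'I_m -> C) (mu : 'I_n -> C) (t : C).
Hypothesis t_gt0 : 0 < t.
Hypothesis lam_mu : forall i k, t + n.-1%:R <= lam i + mu k.

Definition weight_of (l : 'I_m -> C) (u : 'I_n -> C) (a : 'I_(m + n)) : C :=
  match split a with inl i => l i | inr k => u k end.

Lemma weight_of_l l u i : weight_of l u (lshift n i) = l i.
Proof. by rewrite /weight_of (unsplitK (inl i : 'I_m + 'I_n)). Qed.
Lemma weight_of_r l u k : weight_of l u (rshift m k) = u k.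
Proof. by rewrite /weight_of (unsplitK (inr k : 'I_m + 'I_n)). Qed.

Local Notation sg b := ((-1) ^+ odd_ix b : C).

Lemma sgn_gt_l (i : 'I_m) :
  \sum_(b < m + n | (lshift n i < b)%N) sg b = m%:R - 1 - i%:R - n%:R.
Proof.
rewrite big_split_ord /= (eq_bigr (fun=> 1)) => [|j _]; last by rewrite odd_ixl.
rewrite card_ord_gt (eq_bigl xpredT) => [|k]; last by have := ltn_ord i; lia.
by rewrite (eq_bigr (fun=> -1)) => [|k _]; rewrite ?odd_ixr // sumr_const card_ord mulNrn.
Qed.

Lemma sgn_lt_l (i : 'I_m) : \sum_(b < m + n | (b < lshift n i)%N) sg b = i%:R.
Proof.
rewrite big_split_ord /= (eq_bigr (fun=> 1)) => [|j _]; last by rewrite odd_ixl.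
by rewrite card_ord_lt big1 ?addr0 // => k; have := ltn_ord i; lia.
Qed.

Lemma sgn_gt_r (k : 'I_n) :
  \sum_(b < m + n | (rshift m k < b)%N) sg b = - (n%:R - 1 - k%:R).
Proof.
rewrite big_split_ord /= big1 ?add0r => [|j]; last by have := ltn_ord j; lia.
rewrite (eq_bigl (fun l : 'I_n => (k < l)%N)) => [|l]; last by rewrite ltn_add2l.
by rewrite (eq_bigr (fun=> -1)) => [|l _]; rewrite ?odd_ixr // sumrN card_ord_gt.
Qed.

Lemma sgn_lt_r (k : 'I_n) : \sum_(b < m + n | (b < rshift m k)%N) sg b = m%:R - k%:R.
Proof.
rewrite big_split_ord /= (eq_bigr (fun=> 1)) => [|j _]; last by rewrite odd_ixl.
rewrite (eq_bigl xpredT) => [|j]; last by have := ltn_ord j; lia.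
rewrite sumr_const card_ord (eq_bigl (fun l : 'I_n => (l < k)%N)) => [|l]; last by rewrite ltn_add2l.
by rewrite (eq_bigr (fun=> -1)) => [|l _]; rewrite ?odd_ixr // sumrN card_ord_lt.
Qed.

Lemma casimir_lin (nu : 'I_(m + n) -> C) :
  \sum_(a < m + n) \sum_(b < m + n | (a < b)%N) (sg b * nu a - sg a * nu b)
  = \sum_(i < m) (m%:R - 1 - 2 * i%:R - n%:R) * nu (lshift n i)
    + \sum_(k < n) (2 * k%:R + 1 - n%:R - m%:R) * nu (rshift m k).
Proof.
under eq_bigr => a _ do rewrite sumrB -mulr_suml.
rewrite sumrB [X in _ - X](exchange_big_dep xpredT) //= -sumrB.
transitivity (\sum_(a < m + n) ((\sum_(b < m + n | (a < b)%N) sg b)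
    - (\sum_(b < m + n | (b < a)%N) sg b)) * nu a).
  by apply: eq_bigr => a _; rewrite mulrBl; congr (_ - _); rewrite mulr_suml.
rewrite big_split_ord /=; congr (_ + _); apply: eq_bigr => i _.
  by rewrite sgn_gt_l sgn_lt_l; ring.
by rewrite sgn_gt_r sgn_lt_r; ring.
Qed.

(** The difference is linear in the roots of S, minus the squared row counts, plus the squared
    column counts. [rowc_le] bounds the negative squares by the size of S plus 2 (n - 1 - k) per
    root, and [colc_ge] gives the size back. Each root (i, k) still contributes 2 (lam i + mu k - (n
    - 1)) + 2 (m - 1 - i), at least 2 t. *)
Lemma casimir_gap (S : seq ('I_m * 'I_n)) : uniq S -> S != [::] ->
  0 < casimir_val (weight_of lam mu)
      - casimir_val (weight_of (fun i => lam i - (rowc S i)%:R) (fun k => mu k + (colc S k)%:R)).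
Proof.
move=> uS S0; rewrite /casimir_val !casimir_lin !big_split_ord /=.
have -> (x1 x2 x3 x4 y1 y2 y3 y4 : C) : x1 + x2 + (x3 + x4) - (y1 + y2 + (y3 + y4))
  = (x1 - y1 + (x3 - y3)) + (x2 - y2 + (x4 - y4)) by ring.
rewrite -!sumrB -!big_split /=.
pose f i := 2 * lam i + (m%:R - 1 - 2 * i%:R - n%:R); pose g k := 2 * mu k - (2 * k%:R + 1 - n%:R - m%:R).
rewrite (eq_bigr (fun i => f i * (rowc S i)%:R - (rowc S i)%:R * (rowc S i)%:R)); last first.
  by move=> i _; rewrite !weight_of_l odd_ixl /f; ring.
rewrite [X in _ + X](eq_bigr (fun k => g k * (colc S k)%:R + (colc S k)%:R * (colc S k)%:R)); last first.
  by move=> k _; rewrite !weight_of_r odd_ixr /g expr1; ring.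
rewrite !big_split /= sumrN !sum_rowc !sum_colc -!natr_sum.
have h1 : (\sum_(a <- S) rowc S a.1)%:R <= (size S)%:R + 2 * \sum_(a <- S) (n.-1%:R - a.2%:R) :> C.
  rewrite [X in _ <= _ + 2 * X](eq_bigr (fun a : 'I_m * 'I_n => (n.-1 - a.2)%N%:R)) => [|a _]; last first.
    by rewrite natrB //; have := ltn_ord a.2; lia.
  by rewrite -natr_sum mulr_natl -mulrnA -natrD ler_nat muln2; exact: rowc_le.
have h2 : (size S)%:R <= (\sum_(a <- S) colc S a.2)%:R :> C by rewrite ler_nat colc_ge.
have h3 : 0 < \sum_(a <- S) 2 * t.
  rewrite big_const_seq count_predT iter_addr_0 pmulrn_lgt0 ?mulr_gt0 ?ltr0n //.
  by case: (S) S0.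
apply: lt_le_trans h3 _.
have h4 : \sum_(a <- S) 2 * t <= \sum_(a <- S) f a.1 + \sum_(a <- S) g a.2 - 2 * \sum_(a <- S) (n.-1%:R - a.2%:R).
  rewrite mulr_sumr -big_split -sumrB; apply: ler_sum => a _ /=.
  rewrite -subr_ge0.
  have -> : f a.1 + g a.2 - 2 * (n.-1%:R - a.2%:R) - 2 * t
      = 2 * (lam a.1 + mu a.2 - (t + n.-1%:R)) + 2 * (m%:R - 1 - a.1%:R).
    by rewrite /f /g; ring.
  rewrite addr_ge0 ?mulr_ge0 ?subr_ge0 ?ler0n //.
  by rewrite lerBrDr natr1 ler_nat.
apply: le_trans h4 _; rewrite -subr_ge0.
have -> (x y z u v : C) : x - u + (y + v) - (x + y - z) = (z - u) + v by ring.
have -> (z u v : C) : z - u + v = ((size S)%:R + z - u) + (v - (size S)%:R) by ring.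
by apply: addr_ge0; rewrite subr_ge0; [exact: h1|exact: h2].
Qed.

End Gap.

(** * Real polynomials in an operator *)

Section OperatorPoly.
Local Open Scope complex_scope.
Variables (R : realType) (W : lmodType R[i]) (D : {linear W -> W}).
Implicit Types (p q : {poly R}) (w : W).

(** The coefficients are real so that [peval q] is hermitian as soon as [D] is. *)
Definition peval q w : W := \sum_(i < size q) (q`_i)%:C *: iter i D w.

Lemma iter_linear k : linear (iter k D).
Proof. by move=> a u w; elim: k => //= k ->; rewrite linearP. Qed.

Lemma peval_linear q : linear (peval q).
Proof.
move=> a u w; rewrite /peval scaler_sumr -big_split; apply: eq_bigr => i _ /=.
by rewrite iter_linear scalerDr !scalerA mulrC.
Qed.

Definition pevall q : {linear W -> W} := klin (peval_linear q).

Lemma pevallE q w : pevall q w = peval q w. Proof. exact: klinE. Qed.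

Lemma peval_wide n q w : (size q <= n)%N -> peval q w = \sum_(i < n) (q`_i)%:C *: iter i D w.
Proof.
move=> qn; rewrite /peval (big_ord_widen n (fun i => (q`_i)%:C *: iter i D w) qn).
rewrite big_mkcond; apply: eq_bigr => i _; case: ltnP => // qi.
by rewrite nth_default // scale0r.
Qed.

Lemma pevalD p q w : peval (p + q) w = peval p w + peval q w.
Proof.
pose k := maxn (size p) (size q).
rewrite (@peval_wide k) ?size_polyD // (@peval_wide k p) ?leq_maxl // (@peval_wide k q) ?leq_maxr //.
by rewrite -big_split; apply: eq_bigr => i _; rewrite /= coefD rmorphD scalerDl.
Qed.

Lemma pevalC c w : peval c%:P w = c%:C *: w.
Proof.
rewrite (@peval_wide 1) ?size_polyC; last by case: (c != 0).
by rewrite big_ord1 coefC eqxx.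
Qed.

Lemma pevalMX q w : peval (q * 'X) w = D (peval q w).
Proof.
rewrite (@peval_wide (size q).+1); last first.
  by have [->|q0] := eqVneq q 0; rewrite ?mul0r ?size_poly0 // size_mulX.
rewrite big_ord_recl coefMX eqxx scale0r add0r /peval linear_sum.
by apply: eq_bigr => i _; rewrite coefMX /= linearZ.
Qed.

Lemma pevalCM c q w : peval (c%:P * q) w = c%:C *: peval q w.
Proof.
rewrite (@peval_wide (size q)) ?size_Cmul_le //; last by rewrite mul_polyC size_scale_leq.
rewrite /peval scaler_sumr; apply: eq_bigr => i _.
by rewrite coefCM rmorphM scalerA.
Qed.

Lemma pevalM p q w : peval (p * q) w = peval p (peval q w).
Proof.
elim/poly_ind: p => [|p c IH].
  by rewrite mul0r /peval size_poly0 !big_ord0.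
by rewrite mulrDl !pevalD -mulrA [_ * q]mulrC mulrA !pevalMX IH pevalCM pevalC.
Qed.

Lemma peval_comm p q w : peval p (peval q w) = peval q (peval p w).
Proof. by rewrite -!pevalM mulrC. Qed.

Lemma peval_op (T : {linear W -> W}) q w : (forall u, T (D u) = D (T u)) ->
  T (peval q w) = peval q (T w).
Proof.
move=> TD; rewrite /peval linear_sum; apply: eq_bigr => i _; rewrite linearZ /=; congr (_ *: _).
by elim: (nat_of_ord i) => //= k <-.
Qed.

Definition root_prod (cs : seq R) : {poly R} := \prod_(c <- cs) ('X - c%:P).

(* A sufficient condition for w to lie in a sum of eigenspaces of D with positive eigenvalues
   once D is hermitian for a form that is not yet known to be definite. *)
Definition good w := exists cs, all (fun c => 0 < c) cs /\ peval (root_prod cs) w = 0.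

Lemma good_submod : submod good.
Proof.
split; first by exists [::]; rewrite -pevallE linear0.
move=> a u w [cs [cs0 hu]] [ds [ds0 hw]]; exists (cs ++ ds); rewrite all_cat cs0 ds0; split=> //.
rewrite -pevallE linearP !pevallE /root_prod big_cat /= !pevalM -!/(root_prod _) hw.
by rewrite peval_comm hu -!pevallE !linear0 addr0.
Qed.

Lemma good_op (T : {linear W -> W}) w : (forall u, T (D u) = D (T u)) -> good w -> good (T w).
Proof. by move=> TD [cs [cs0 hw]]; exists cs; rewrite -peval_op // hw linear0. Qed.

Lemma good_step c w : 0 < c -> good (D w - c%:C *: w) -> good w.
Proof.
move=> c0 [cs [cs0 hw]]; exists (c :: cs); rewrite /= c0; split=> //.
rewrite /root_prod big_cons mulrC pevalM -/(root_prod cs) pevalD -polyCN pevalC rmorphN scaleNr.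
by rewrite -['X]mul1r pevalMX -[1]/(1%:P) pevalC scale1r.
Qed.

(* 'X is a square modulo the product: add the linear factors one at a time, adjusting q at the
   new root c by means of the real square root of c^-1, or by Hensel lifting if c is repeated. *)
Lemma sqrt_poly cs : all (fun c => 0 < c) cs -> exists q r, 'X * (q * q) = 1 + r * root_prod cs.
Proof.
elim: cs => [_|c cs IH /= /andP[c0 /IH[q [r e]]]].
  by exists 0, (-1); rewrite /root_prod big_nil !mul0r mulr0 mulr1 subrr.
set P := root_prod cs in e *.
(* Replacing q by q + s P turns the cofactor of P into this polynomial; its vanishing at c gives
   divisibility by the longer product. *)
have root_ext s : root (r + (2 * s) *: ('X * q) + (s ^+ 2) *: ('X * P)) c ->
    exists q r, 'X * (q * q) = 1 + r * root_prod (c :: cs).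
  move=> /factor_theorem[r' re]; exists (q + s *: P), r'.
  rewrite /root_prod big_cons -/(root_prod cs) -/P [X in _ = 1 + X]mulrA -re.
  rewrite -!mul_polyC !(polyCM, polyC_exp) -[2%:P]/(2%:R%:P) polyC_natr.
  have -> : 'X * ((q + s%:P * P) * (q + s%:P * P)) = 'X * (q * q)
    + 2 * s%:P * ('X * q) * P + s%:P ^+ 2 * ('X * P) * P by ring.
  by rewrite e; ring.
have ec : c * (q.[c] * q.[c]) = 1 + r.[c] * P.[c].
  by have := congr1 (fun f : {poly R} => f.[c]) e; rewrite !(hornerM, hornerD, hornerX, hornerC).
have [P0|P0] := eqVneq P.[c] 0.
  have q0 : q.[c] != 0.
    by apply/eqP => q0; move: ec; rewrite q0 P0 !mulr0 addr0 => /esym/eqP; rewrite oner_eq0.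
  apply: (root_ext (- r.[c] / (2 * (c * q.[c])))).
  rewrite /root !(hornerD, hornerZ, hornerM, hornerX) P0 !mulr0 addr0; apply/eqP.
  by field; rewrite q0 gt_eqF.
pose x := (Num.sqrt c)^-1.
have xx : c * (x * x) = 1.
  rewrite -invfM -expr2 sqr_sqrtr ?ltW // divff // gt_eqF //.
apply: (root_ext ((x - q.[c]) / P.[c])).
rewrite /root !(hornerD, hornerZ, hornerM, hornerX) -(mulrI_eq0 _ (mulfI P0)); apply/eqP.
have -> : P.[c] * (r.[c] + 2 * ((x - q.[c]) / P.[c]) * (c * q.[c]) + ((x - q.[c]) / P.[c]) ^+ 2 * (c * P.[c]))
  = (1 + r.[c] * P.[c]) - c * (q.[c] * q.[c]) + (c * (x * x) - 1) by field.
by rewrite xx ec !subrr addr0.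
Qed.

Lemma good_sqrt w : good w -> exists q, w = D (peval q (peval q w)).
Proof.
move=> [cs [/sqrt_poly[q [r e]] hw]]; exists q.
rewrite -pevalM -pevalMX mulrC e pevalD pevalM hw -(pevallE r 0) linear0 addr0.
by rewrite -[1]/(1%:P) pevalC scale1r.
Qed.

Section GoodPos.
Variable F : W -> W -> R[i].
Hypothesis F_linl : forall a u v w, F (a *: u + v) w = a * F u w + F v w.
Hypothesis F_herm : forall u v, F u v = (F v u)^*.
Hypothesis F_D : forall u w, F (D u) w = F u (D w).

Lemma F_peval q u w : F (peval q u) w = F u (peval q w).
Proof.
have F0 v : F 0 v = 0.
  have := F_linl 1 0 0 v; rewrite scaler0 addr0 mul1r => /(congr1 (fun x => x - F 0 v)).
  by rewrite subrr addrK.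
have FZ a v z : F (a *: v) z = a * F v z by rewrite -[a *: v]addr0 F_linl F0 addr0.
have FDl v v' z : F (v + v') z = F v z + F v' z by rewrite -[v]scale1r F_linl mul1r scale1r.
have Fi i v z : F (iter i D v) z = F v (iter i D z).
  by elim: i z => //= i IH z; rewrite F_D IH -iterSr.
have Fs n (G : 'I_n -> W) z : F (\sum_i G i) z = \sum_i F (G i) z.
  by apply: (big_morph (fun u => F u z)) => // v v'.
rewrite /peval Fs F_herm Fs rmorph_sum; apply: eq_bigr => i _.
rewrite !FZ rmorphM /= -F_herm Fi; congr (_ * _).
by rewrite -[RHS]/((q`_i)%:C^*)%C conjc_real.
Qed.

(** One of the two factors q(D) moves to the other argument. [F] is not an [hform] here because its
    positivity is the goal. *)
Lemma good_form w : good w -> exists u q, u = peval q w /\ F w w = F (D u) u /\ (u = 0 -> w = 0).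
Proof.
move=> /good_sqrt[q e]; exists (peval q w), q; split=> //; split.
  rewrite {1}e; have c u : D (peval q u) = peval q (D u) by apply: peval_op.
  by rewrite c F_peval.
by move=> h; rewrite e h -(pevallE q 0) !linear0.
Qed.

End GoodPos.

End OperatorPoly.

(** * The contravariant form on the Kac module *)

Section Shapovalov.
Variables (R : realType) (m n : nat).
Local Notation C := R[i].
Local Notation J := ('I_m * 'I_n)%type.
Variables (V : lmodType C) (B : hform V).
Variables (A : 'I_m -> 'I_m -> {linear V -> V}) (D : 'I_n -> 'I_n -> {linear V -> V}).
Hypothesis A_A : forall i j k l v,
  A i j (A k l v) = A k l (A i j v) + (j == k)%:R *: A i l v - (l == i)%:R *: A k j v.
Hypothesis D_D : forall i j k l v,
  D i j (D k l v) = D k l (D i j v) + (j == k)%:R *: D i l v - (l == i)%:R *: D k j v.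
Hypothesis A_D : forall i j k l v, A i j (D k l v) = D k l (A i j v).
Hypothesis A_adj : forall i j u w, B (A i j u) w = B u (A j i w).
Hypothesis D_adj : forall i j u w, B (D i j u) w = B u (D j i w).

Variable K : car B #|{: J}|.
Local Notation W := (car_sp K).
Local Notation BW := (car_form K).
Local Notation Y i k := (@mcr C V B _ K (i, k)).
Local Notation Y' i k := (@man C V B _ K (i, k)).
Local Notation kA := (kacA A K).
Local Notation kD := (kacD D K).
Local Notation kX := (kacX A D K).
Local Notation E := (kacE A D K).
Local Notation p := (@odd_ix m n).

Let E_rep : superrep E. Proof. exact: kac_superrep. Qed.

Lemma kacA_adj i j u w : BW (kA i j u) w = BW u (kA j i w).
Proof.
rewrite !kacA_def hformBl hformBr (ext_adj (A_adj i j)) hform_suml hform_sumr.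
by congr (_ - _); apply: eq_bigr => k _; rewrite mcr_adj man_adj.
Qed.

Lemma kacD_adj i j u w : BW (kD i j u) w = BW u (kD j i w).
Proof.
rewrite !kacD_def hformDl hformDr (ext_adj (D_adj i j)) hform_suml hform_sumr.
by congr (_ + _); apply: eq_bigr => k _; rewrite mcr_adj man_adj.
Qed.

Lemma kacA_proj i j w : proj K (kA i j w) = A i j (proj K w).
Proof.
by apply: (hform_inj (B := B)) => z; rewrite hform_herm -vac0_proj -kacA_adj kacA_vac vac0_proj
  A_adj -hform_herm.
Qed.

Lemma kacD_proj i j w : proj K (kD i j w) = D i j (proj K w).
Proof.
by apply: (hform_inj (B := B)) => z; rewrite hform_herm -vac0_proj -kacD_adj kacD_vac vac0_proj
  D_adj -hform_herm.
Qed.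

Lemma kacX_X (a b : J) w : kX a.1 a.2 (kX b.1 b.2 w) = - kX b.1 b.2 (kX a.1 a.2 w).
Proof.
have := superrepE E_rep (lshift n a.1) (rshift m a.2) (lshift n b.1) (rshift m b.2) w.
rewrite !odd_ixl !odd_ixr !eq_rlshift !kacE_lr /= expr1 mulr0 !scale0r.
by rewrite addr0 subr0 scaleN1r.
Qed.

Variable Phi : {linear W -> W}.
Hypothesis Phi_an : forall (a : J) u, man K a (Phi u) = Phi (kX a.1 a.2 u).
Hypothesis Phi_proj : forall u, proj K (Phi u) = proj K u.

(* Contravariant form: [Phi] intertwines the annihilation operators with the odd raising
   operators [kX], so [Y i k] and [kX i k] are adjoint for [shap]. *)
Definition shap (u w : W) : C := BW u (Phi w).

Lemma shap_linl a u v w : shap (a *: u + v) w = a * shap u w + shap v w.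
Proof. exact: hform_linl. Qed.

Lemma shapDl u v w : shap (u + v) w = shap u w + shap v w.
Proof. exact: hformDl. Qed.

Lemma shapZl a u w : shap (a *: u) w = a * shap u w.
Proof. exact: hformZl. Qed.

Lemma shapNl u w : shap (- u) w = - shap u w.
Proof. exact: hformNl. Qed.

Lemma shapDr u v w : shap u (v + w) = shap u v + shap u w.
Proof. by rewrite /shap linearD hformDr. Qed.

Lemma shapZr a u w : shap u (a *: w) = a^* * shap u w.
Proof. by rewrite /shap linearZ hformZr. Qed.

Lemma shapNr u w : shap u (- w) = - shap u w.
Proof. by rewrite /shap linearN hformNr. Qed.

Lemma shap_vac v w : shap (vac0 K v) w = B v (proj K w).
Proof. by rewrite /shap vac0_proj Phi_proj. Qed.

Lemma shap_Y (a : J) u w : shap (mcr K a u) w = shap u (kX a.1 a.2 w).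
Proof. by rewrite /shap mcr_adj Phi_an. Qed.

Lemma kacY_E c d q (l : 'I_m) w : E c d (Y l q w) =
  (-1) ^+ (p c (+) p d) *: Y l q (E c d w) + (d == rshift m q)%:R *: E c (lshift n l) w
    - ((-1) ^+ (p c (+) p d) * (lshift n l == c)%:R) *: E (rshift m q) d w.
Proof. exact: kacE_Y. Qed.

Lemma kacX_E c d q (l : 'I_m) w : kX l q (E d c w) =
  (-1) ^+ (p c (+) p d) *: E d c (kX l q w) + (d == rshift m q)%:R *: E (lshift n l) c w
   - ((-1) ^+ (p c (+) p d) * (lshift n l == c)%:R) *: E d (rshift m q) w.
Proof.
rewrite -(kacE_lr A D K l q) (superrepE E_rep) odd_ixl odd_ixr /= [p d (+) p c]addbC.
by rewrite [rshift m q == d]eq_sym [c == _]eq_sym.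
Qed.

(** Induction on u: the operator passes [Y l q] on the left and [kX l q] on the right, and the odd
    correction terms match by [shap_Y]. *)
Lemma shap_E_even c d u w : p c = p d -> shap (E c d u) w = shap u (E d c w).
Proof.
elim/mcar_ind: u c d w => [|v c d w|[l q] u IH c d w].
- split=> [c d w cd|x u v hu hv c d w cd]; first by rewrite linear0 /shap !hform0l.
  by rewrite linearP !shap_linl hu ?hv.
- have [i ->|k ->] := split_ordP c; have [j ->|l ->] := split_ordP d; rewrite ?odd_ixl ?odd_ixr // => _.
    by rewrite !kacE_ll kacA_vac !shap_vac A_adj kacA_proj.
  by rewrite !kacE_rr kacD_vac !shap_vac D_adj kacD_proj.
- move=> cd; rewrite kacY_E shap_Y kacX_E cd addbb !(expr0, scale1r, mul1r).
  rewrite !(shapDl, shapNl, shapZl, shapDr, shapNr, shapZr) shap_Y /= !conjC_nat IH //.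
  congr (_ + _ - _).
    have [i ec|k ec] := split_ordP c; have [j ed|k' ed] := split_ordP d; move: cd; rewrite ec ed
      ?odd_ixl ?odd_ixr ?eq_lrshift ?mul0r // => _.
    by rewrite kacE_rl kacE_lr shap_Y.
  have [i ec|k ec] := split_ordP c; have [j ed|k' ed] := split_ordP d; move: cd; rewrite ec ed
    ?odd_ixl ?odd_ixr ?eq_lrshift ?mul0r // => _.
  by rewrite kacE_rl kacE_lr shap_Y.
Qed.

Lemma shap_A i j u w : shap (kA i j u) w = shap u (kA j i w).
Proof. by rewrite -!(kacE_ll A D) shap_E_even // !odd_ixl. Qed.

Lemma shap_D i j u w : shap (kD i j u) w = shap u (kD j i w).
Proof. by rewrite -!(kacE_rr A D) shap_E_even // !odd_ixr. Qed.

(** Hermitian symmetry is not yet available, so this is not the conjugate of [shap_Y]; it needs its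
    own induction and then serves to prove that symmetry. *)
Lemma shap_X (a : J) u w : shap (kX a.1 a.2 u) w = shap u (mcr K a w).
Proof.
elim/mcar_ind: u w => [|v w|b u IH w].
- split=> [w|x u v hu hv w]; first by rewrite linear0 /shap !hform0l.
  by rewrite linearP !shap_linl hu hv.
- by rewrite kacX_vac shap_vac proj_mcr hform0r /shap hform0l.
- have e1 := kacY_E (lshift n a.1) (rshift m a.2) b.2 b.1 u.
  rewrite /= odd_ixl odd_ixr kacE_lr kacE_ll kacE_rr -surjective_pairing in e1.
  have e2 := kacY_E (lshift n b.1) (rshift m b.2) a.2 a.1 w.
  rewrite /= odd_ixl odd_ixr kacE_lr kacE_ll kacE_rr -surjective_pairing in e2.
  rewrite e1 shap_Y e2 !(shapDl, shapNl, shapZl, shapDr, shapNr, shapZr) shap_Y IH.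
  rewrite shap_A shap_D !rmorphM !rmorph_sign !conjC_nat !eq_lshift !eq_rshift.
  by rewrite [b.1 == _]eq_sym [b.2 == _]eq_sym; ring.
Qed.

Lemma shap_E c d u w : shap (E c d u) w = shap u (E d c w).
Proof.
have [i ->|k ->] := split_ordP c; have [j ->|k' ->] := split_ordP d.
- by rewrite shap_E_even // !odd_ixl.
- by rewrite kacE_lr kacE_rl (shap_X (i, k')).
- by rewrite kacE_lr kacE_rl (shap_Y (j, k)).
- by rewrite shap_E_even // !odd_ixr.
Qed.

Lemma shap_herm u w : shap u w = (shap w u)^*.
Proof.
elim/mcar_ind: u w => [|v w|a u IH w].
- split=> [w|x u v hu hv w]; first by rewrite /shap linear0 hform0l hform0r conjC0.
  by rewrite shap_linl shapDr shapZr rmorphD rmorphM /= conjCK hu hv.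
- elim/mcar_ind: w => [|v'|a w _].
  + split=> [|x u w hu hw]; first by rewrite /shap linear0 hform0l hform0r conjC0.
    by rewrite shap_linl shapDr shapZr rmorphD rmorphM /= hu hw.
  + by rewrite !shap_vac !proj_vac0 hform_herm.
  + by rewrite shap_vac proj_mcr hform0r shap_Y kacX_vac /shap linear0 hform0r conjC0.
- by rewrite shap_Y IH shap_X.
Qed.

Lemma kac_parity a b w : gam K (E a b w) = (-1) ^+ (p a (+) p b) *: E a b (gam K w).
Proof.
have gA i j u : gam K (kA i j u) = kA i j (gam K u).
  rewrite !kacA_def linearB gam_ext; congr (_ - _); rewrite linear_sum; apply: eq_bigr => k _.
  by rewrite gam_mcr gam_man (linearN (mcr _ _)) opprK.
have [i ->|k ->] := split_ordP a; have [j ->|l ->] := split_ordP b; rewrite ?odd_ixl ?odd_ixr /=.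
- by rewrite kacE_ll scale1r gA.
- rewrite kacE_lr expr1 scaleN1r !kacX_def linearD !linear_sum opprD -!sumrN; congr (_ + _).
    by apply: eq_bigr => j _; rewrite gA gam_man linearN.
  by apply: eq_bigr => q _; rewrite gam_ext gam_man linearN.
- by rewrite kacE_rl expr1 scaleN1r gam_mcr.
- rewrite kacE_rr scale1r !kacD_def linearD gam_ext; congr (_ + _); rewrite linear_sum.
  apply: eq_bigr => i _.
  by rewrite gam_mcr gam_man (linearN (mcr _ _)) opprK.
Qed.

Lemma shap_gam u w : shap (gam K u) w = shap u (gam K w).
Proof.
elim/mcar_ind: u w => [|v w|a u IH w].
- split=> [w|x u v hu hv w]; first by rewrite linear0 /shap !hform0l.
  by rewrite linearP !shap_linl hu hv.
- by rewrite gam_vac00 !shap_vac proj_gam.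
- rewrite gam_mcr shapNl !shap_Y IH -(kacE_lr A D) kac_parity odd_ixl odd_ixr.
  by rewrite expr1 scaleN1r shapNr opprK.
Qed.

Variables (v0 : V) (lam : 'I_m -> C) (mu : 'I_n -> C).
Hypothesis A_raise : forall i j : 'I_m, (i < j)%N -> A i j v0 = 0.
Hypothesis D_raise : forall i j : 'I_n, (i < j)%N -> D i j v0 = 0.
Hypothesis A_diag : forall i, A i i v0 = lam i *: v0.
Hypothesis D_diag : forall k, D k k v0 = mu k *: v0.
Hypothesis V_gen : forall P : V -> Prop, submod P -> P v0 ->
  (forall i j v, P v -> P (A i j v)) -> (forall i j v, P v -> P (D i j v)) -> forall v, P v.

Local Notation w0 := (vac0 K v0).
Local Notation Lam := (weight_of lam mu).

Lemma kac_raise (a b : 'I_(m + n)) : (a < b)%N -> E a b w0 = 0.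
Proof.
have [i ->|k ->] := split_ordP a; have [j ->|l ->] := split_ordP b => /= ab.
- by rewrite kacE_ll kacA_vac A_raise ?linear0.
- by rewrite kacE_lr kacX_vac.
- by have := ltn_ord j; lia.
- by rewrite kacE_rr kacD_vac D_raise ?linear0 // -(ltn_add2l m).
Qed.

Lemma kac_diag a : E a a w0 = Lam a *: w0.
Proof.
have [i ->|k ->] := split_ordP a.
  by rewrite kacE_ll kacA_vac A_diag weight_of_l linearZ.
by rewrite kacE_rr kacD_vac D_diag weight_of_r linearZ.
Qed.

(** The Casimir operator commutes with the action, and the Kac module is generated by [w0], on which
    every raising operator vanishes. *)
Lemma kac_casimir w : casimir E w = casimir_val Lam *: w.
Proof.
have hP : submod (fun w => casimir E w = casimir_val Lam *: w).
  split=> [|x u z hu hz]; first by rewrite -(klinE (casimir_linear E)) linear0 scaler0.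
  by rewrite casimir_linear hu hz scalerDr !scalerA mulrC.
have hE a b z : casimir E z = casimir_val Lam *: z -> casimir E (E a b z) = casimir_val Lam *: E a b z.
  by move=> hz; rewrite -(casimir_comm BW E_rep) hz linearZ.
elim/mcar_ind: w => [|v|[i k] w] //; last by move=> /(hE (rshift m k) (lshift n i)); rewrite kacE_rl.
apply: (V_gen (P := fun v => casimir E (vac0 K v) = casimir_val Lam *: vac0 K v)).
- exact: (submod_pre (vac0 K) hP).
- rewrite (casimir_weight BW E_rep kac_diag) big1 ?addr0 // => a _.
  by rewrite big1 // => b ab; rewrite kac_raise // linear0 scaler0.
- by move=> i j z /(hE (lshift n i) (lshift n j)); rewrite kacE_ll kacA_vac.
- by move=> i j z /(hE (rshift m i) (rshift m j)); rewrite kacE_rr kacD_vac.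
Qed.

Definition kacdop_fun w := \sum_(a : J) mcr K a (kX a.1 a.2 w).

Lemma kacdop_linear : linear kacdop_fun.
Proof.
move=> x u w; rewrite /kacdop_fun scaler_sumr -big_split; apply: eq_bigr => a _ /=.
by rewrite !linearP.
Qed.

Definition kacdop : {linear W -> W} := klin kacdop_linear.

Lemma kacdopE w : kacdop w = \sum_(a : J) mcr K a (kX a.1 a.2 w).
Proof. exact: klinE. Qed.

Lemma kacdop_shap u w : shap (kacdop u) w = shap u (kacdop w).
Proof.
rewrite !kacdopE /shap (linear_sum Phi) hform_suml hform_sumr; apply: eq_bigr => a _.
by rewrite -!/(shap _ _) shap_Y -shap_X.
Qed.

Lemma kacdop_sq u : shap (kacdop u) u = \sum_(a : J) shap (kX a.1 a.2 u) (kX a.1 a.2 u).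
Proof.
rewrite kacdopE /shap hform_suml; apply: eq_bigr => a _.
by rewrite -!/(shap _ _) shap_Y.
Qed.

Lemma kacdopE2 w : kacdop w = \sum_i \sum_k Y i k (kX i k w).
Proof. by rewrite kacdopE (pair_bigA _ (fun i k => Y i k (kX i k w))); apply: eq_bigr => -[]. Qed.

Lemma kacA_X i j l q w : kA i j (kX l q w) = kX l q (kA i j w) + (j == l)%:R *: kX i q w.
Proof.
have := superrepE E_rep (lshift n i) (lshift n j) (lshift n l) (rshift m q) w.
rewrite !odd_ixl !odd_ixr !kacE_ll !kacE_lr eq_rlshift eq_lshift /= expr0 mulr0 scale0r subr0.
by rewrite scale1r.
Qed.

Lemma kacD_X k l i q w : kD k l (kX i q w) = kX i q (kD k l w) - (q == k)%:R *: kX i l w.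
Proof.
have := superrepE E_rep (rshift m k) (rshift m l) (lshift n i) (rshift m q) w.
rewrite !odd_ixl !odd_ixr !kacE_rr !kacE_lr eq_rlshift eq_rshift /= expr0 mul1r scale0r addr0.
by rewrite scale1r.
Qed.

Lemma kacdop_A i j w : kA i j (kacdop w) = kacdop (kA i j w).
Proof.
rewrite !kacdopE2 exchange_big [RHS]exchange_big linear_sum /=; apply: eq_bigr => q _.
rewrite linear_sum /=; rewrite (eq_bigr (fun l => Y l q (kX l q (kA i j w))
  + ((j == l)%:R *: Y l q (kX i q w) - (i == l)%:R *: Y j q (kX l q w)))).
  by rewrite big_split /= sumrB !sum_deltaZ subrr addr0.
move=> l _; rewrite kacA_Y kacA_X linearD linearZ /= addrA; congr (_ - _).
Qed.

Lemma kacdop_D k l w : kD k l (kacdop w) = kacdop (kD k l w).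
Proof.
rewrite !kacdopE2 linear_sum /=; apply: eq_bigr => i _.
rewrite linear_sum /=; rewrite (eq_bigr (fun q => Y i q (kX i q (kD k l w))
  + ((l == q)%:R *: Y i k (kX i q w) - (k == q)%:R *: Y i q (kX i l w)))).
  by rewrite big_split /= sumrB !sum_deltaZ subrr addr0.
move=> q _; rewrite kacD_Y kacD_X linearB linearZ /= [q == k]eq_sym.
by rewrite addrAC addrA.
Qed.

(** Of the normally ordered terms of the scalar Casimir operator, the odd ones add up to twice
    [kacdop], the D of the overview; the even ones remain, with opposite signs for gl(m) and
    gl(n). *)
Lemma kacdop_weight nu w : (forall a, E a a w = nu a *: w) ->
  2 *: kacdop w = (casimir_val Lam - casimir_val nu) *: w
    - (\sum_(i < m) \sum_(j < m | (i < j)%N) 2 *: kA j i (kA i j w)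
       - \sum_(k < n) \sum_(l < n | (k < l)%N) 2 *: kD l k (kD k l w)).
Proof.
move=> hw; have := casimir_weight BW E_rep hw; rewrite kac_casimir.
have -> : \sum_(a < m + n) \sum_(b < m + n | (a < b)%N) ((-1) ^+ p a * 2) *: E b a (E a b w)
  = 2 *: kacdop w + (\sum_(i < m) \sum_(j < m | (i < j)%N) 2 *: kA j i (kA i j w)
       - \sum_(k < n) \sum_(l < n | (k < l)%N) 2 *: kD l k (kD k l w)).
  rewrite big_split_ord /= addrA; congr (_ + _).
    rewrite kacdopE2 scaler_sumr -big_split; apply: eq_bigr => i _ /=.
    rewrite big_split_ord /= addrC; congr (_ + _).
      rewrite scaler_sumr; apply: eq_big => [k|k _]; first by have := ltn_ord i; lia.
      by rewrite odd_ixl mul1r kacE_lr kacE_rl.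
    by apply: eq_bigr => j _; rewrite odd_ixl mul1r !kacE_ll.
  rewrite -sumrN; apply: eq_bigr => k _; rewrite big_split_ord /= big1 ?add0r; last first.
    by move=> j; have := ltn_ord j; lia.
  rewrite -sumrN; apply: eq_big => [l|l _]; first by rewrite ltn_add2l.
  by rewrite odd_ixr expr1 mulN1r scaleNr !kacE_rr.
move=> e; rewrite scalerBl e [_ *: w + _]addrC.
by rewrite (addrK (casimir_val nu *: w)) addrK.
Qed.

Definition word (S : seq J) (w : W) : W := foldr (fun a => mcr K a) w S.

Lemma word_cat S T w : word (S ++ T) w = word S (word T w).
Proof. by rewrite /word foldr_cat. Qed.

Lemma word_linear S : linear (word S).
Proof. by elim: S => [|a S IH] x u w //=; rewrite IH linearP. Qed.

Definition wordl S : {linear W -> W} := klin (word_linear S).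
Lemma wordlE S w : wordl S w = word S w. Proof. exact: klinE. Qed.

Lemma word_dup S w : ~~ uniq S -> word S w = 0.
Proof.
elim: S => //= a S IH; rewrite negb_and negbK => /orP[aS|/IH ->]; last by rewrite linear0.
have -> : S = take (index a S) S ++ a :: drop (index a S).+1 S.
  by rewrite -[LHS](cat_take_drop (index a S)) (drop_nth a) ?index_mem // nth_index.
rewrite word_cat /=; set u := word (drop _ _) w; elim: (take _ _) => [|b T IHT] /=.
  have /eqP := mcr_mcr a a u; rewrite -addr_eq0 -mulr2n -scaler_nat scaler_eq0 pnatr_eq0 /=.
  by move/eqP.
by rewrite mcr_mcr IHT linear0 oppr0.
Qed.

(** The commutator of an even matrix unit at (c, d) with the lowering operator of [a] is, up to
    sign, that of [repl c d a], or 0 when [hit] fails. *)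
Definition repl (c d : 'I_(m + n)) (a : J) : J :=
  match split c, split d with
  | inl i, inl j => (j, a.2)
  | inr k, inr l => (a.1, k)
  | _, _ => a
  end.

Definition hit (c d : 'I_(m + n)) (a : J) : bool :=
  match split c, split d with
  | inl i, inl j => i == a.1
  | inr k, inr l => l == a.2
  | _, _ => false
  end.

Lemma kac_repl c d a w : p c = p d -> exists x : C,
  E c d (mcr K a w) = mcr K a (E c d w) + (x * (hit c d a)%:R) *: mcr K (repl c d a) w.
Proof.
rewrite /hit /repl; have [i ->|k ->] := split_ordP c; have [j ->|l ->] := split_ordP d;
  rewrite ?odd_ixl ?odd_ixr // => _.
  exists (-1).
  by rewrite !kacE_ll {1 2}(surjective_pairing a) kacA_Y mulN1r scaleNr.
exists 1.
by rewrite !kacE_rr {1 2}(surjective_pairing a) kacD_Y mul1r.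
Qed.

(** An even matrix unit passes through a word at the cost of words with one letter replaced. The
    prefix [T] collects the letters already passed; [P] is a parameter because both [good] and the
    degree use this. *)
Lemma word_E c d P T S w : p c = p d -> submod P ->
  (forall S1 a S2, S = S1 ++ a :: S2 -> hit c d a ->
     P (word (T ++ S1 ++ repl c d a :: S2) w)) ->
  P (word T (E c d (word S w) - word S (E c d w))).
Proof.
move=> cd hP; elim: S T => [|a S IH] T hS.
  by rewrite /= subrr -wordlE linear0; exact: hP.1.
have [x e] := kac_repl a (word S w) cd.
rewrite /= e addrAC -wordlE linearD !wordlE; apply: (submodD hP).
  rewrite -linearB -[word T _]/(word T (word [:: a] _)) -word_cat; apply: IH => S1 b S2 eS hb.
  by rewrite -catA; apply: (hS (a :: S1)); rewrite ?eS.
rewrite -wordlE linearZ wordlE /=; case: (boolP (hit c d a)) => [h|_]; last first.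
  by rewrite mulr0 scale0r; exact: hP.1.
apply: (submodZ hP); have := hS [::] a S erefl h.
by rewrite word_cat.
Qed.

(** Even raising operators strictly lower this height: they increase the row or decrease the column
    of a letter. *)
Definition ht (S : seq J) : nat := \sum_(a <- S) ((m - a.1) + a.2).

Lemma ht_repl (c d : 'I_(m + n)) a S1 S2 : (c < d)%N -> p c = p d -> hit c d a ->
  (ht (S1 ++ repl c d a :: S2) < ht (S1 ++ a :: S2))%N.
Proof.
move=> cd pcd h; rewrite /ht !big_cat !big_cons ltn_add2l ltn_add2r.
move: cd pcd h; rewrite /hit /repl.
have [i ->|k ->] := split_ordP c; have [j ->|l ->] := split_ordP d; rewrite ?odd_ixl ?odd_ixr //.
  rewrite /= => ij _ /eqP <-.
  by have := ltn_ord j; lia.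
rewrite /= => ij _ /eqP <-.
by lia.
Qed.

Lemma word_weight S a : E a a (word S w0) =
  weight_of (fun i => lam i - (rowc S i)%:R) (fun k => mu k + (colc S k)%:R) a *: word S w0.
Proof.
elim: S => [|b S IH] /=.
  rewrite kac_diag; congr (_ *: _); rewrite /weight_of.
  by case: split => i; rewrite ?subr0 ?addr0.
have [i ea|k ea] := split_ordP a; move: IH; rewrite ea ?weight_of_l ?weight_of_r.
  rewrite kacE_ll => IH; rewrite {1}(surjective_pairing b) kacA_Y IH linearZ /= -surjective_pairing.
  rewrite /rowc /=; case: (eqVneq b.1 i) => [e|ne]; last by rewrite add0n scale0r subr0.
  rewrite -e -surjective_pairing -[X in _ - X]scale1r scalerA -scalerBl; congr (_ *: _).
  by rewrite natrD /=; ring.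
rewrite kacE_rr => IH; rewrite {1}(surjective_pairing b) kacD_Y IH linearZ /= -surjective_pairing.
rewrite /colc /= [k == _]eq_sym; case: (eqVneq b.2 k) => [e|ne]; last by rewrite add0n scale0r addr0.
rewrite -e -surjective_pairing -[X in _ + X]scale1r scalerA -scalerDl; congr (_ *: _).
by rewrite natrD /=; ring.
Qed.

Variable t : C.
Hypothesis t_gt0 : 0 < t.
Hypothesis lam_mu : forall i k, t + n.-1%:R <= lam i + mu k.

Local Notation good := (good kacdop).

Lemma good_A i j w : good w -> good (kA i j w).
Proof. by apply: good_op => u; rewrite kacdop_A. Qed.

Lemma good_D i j w : good w -> good (kD i j w).
Proof. by apply: good_op => u; rewrite kacdop_D. Qed.

(** Induction on [ht]. A word with a repeated letter is 0; any other is a weight vector w, and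
    [kacdop_weight] writes D w - c w, with c half the Casimir gap, through even lowering operators
    applied to even raisings of w. These raisings are combinations of words of smaller height, hence
    good, and even operators commute with D. *)
Lemma good_word0 S : S != [::] -> good (word S w0).
Proof.
have gS := good_submod kacdop.
move: {2}(ht S).+1 (ltnSn (ht S)) => h; elim: h S => // h IH S Sh S0.
have [uS|/word_dup ->] := boolP (uniq S); last exact: gS.1.
have raise (c d : 'I_(m + n)) : (c < d)%N -> p c = p d -> good (E c d (word S w0)).
  move=> cd pcd; rewrite -[E c d _]subr0.
  have -> : 0 = word S (E c d w0) by rewrite kac_raise // -wordlE linear0.
  apply: (@word_E c d good [::] S w0 pcd gS) => S1 a S2 eS ha.
  apply: IH; last by case: (S1).
  by apply: leq_trans (ht_repl S1 S2 cd pcd ha) _; rewrite -eS.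
have gap := casimir_gap t_gt0 lam_mu uS S0.
have := kacdop_weight (word_weight S); set g := _ - _ in gap *.
set low := (X in _ = _ - X) => e.
have glow : good low.
  have sum_good N (X : 'I_N -> 'I_N -> W) : (forall i j : 'I_N, (i < j)%N -> good (X i j)) ->
      good (\sum_(i < N) \sum_(j < N | (i < j)%N) X i j).
    move=> hX; apply: (submod_sum gS) => i _; apply: (submod_sum gS) => j; exact: hX.
  apply: (submodB gS).
    apply: (sum_good m (fun i j => 2 *: kA j i (kA i j (word S w0)))) => i j ij; apply: (submodZ gS).
    by apply: good_A; rewrite -(kacE_ll A D); apply: raise; rewrite ?odd_ixl.
  apply: (sum_good n (fun i j => 2 *: kD j i (kD i j (word S w0)))) => i j ij; apply: (submodZ gS).
  by apply: good_D; rewrite -(kacE_rr A D); apply: raise; rewrite ?odd_ixr ?ltn_add2l.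
pose c := complex.Re (2^-1 * g).
have gc : 0 < 2^-1 * g by rewrite mulr_gt0 ?invr_gt0 ?ltr0n.
have cE : (c%:C)%C = 2^-1 * g by rewrite /c RRe_real // gtr0_real.
apply: (@good_step _ _ _ c).
  by rewrite ltcE in gc; case/andP: gc.
have -> : kacdop (word S w0) - (c%:C)%C *: word S w0 = - (2^-1 *: low).
  have : 2^-1 *: (2 *: kacdop (word S w0)) = 2^-1 *: (g *: word S w0 - low) by rewrite e.
  rewrite !scalerA mulVf ?pnatr_eq0 // scale1r scalerBr scalerA cE => ->.
  by rewrite addrC addKr.
by apply: (submodN gS); apply: (submodZ gS).
Qed.

(** From [v0] to all of V at fixed length: a word on [E v] is [E] of the word on v minus
    combinations of words on v of the same length. *)
Lemma good_word S v : S != [::] -> good (word S (vac0 K v)).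
Proof.
have gS := good_submod kacdop.
move=> S0; move: {2}(size S) (erefl (size S)) => j; move: v S S0.
suff h : forall v S, S != [::] -> size S = j -> good (word S (vac0 K v)) by move=> v S S0; apply: h.
pose P v := forall S, S != [::] -> size S = j -> good (word S (vac0 K v)).
have hE c d v v' : p c = p d -> E c d (vac0 K v) = vac0 K v' -> (forall u, good u -> good (E c d u)) ->
    P v -> P v'.
  move=> cd e gE Pv S S0 Sj; rewrite -e -[word S _]opprK.
  apply: (submodN gS).
  have := submodB gS (@word_E c d good [::] S (vac0 K v) cd gS _) (gE _ (Pv S S0 Sj)).
  rewrite /= addrAC subrr add0r; apply => S1 a S2 eS _; apply: Pv; first by case: (S1).
  by rewrite -Sj eS !size_cat.
apply: (V_gen (P := P)).
- split=> [S S0 Sj|x u z hu hz S S0 Sj]; first by rewrite linear0 -wordlE linear0; exact: gS.1.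
  rewrite linearP -wordlE linearP !wordlE; apply: gS.2; [exact: hu|exact: hz].
- by move=> S S0 _; exact: good_word0.
- move=> a b z; apply: (hE (lshift n a) (lshift n b)); rewrite ?odd_ixl ?kacE_ll ?kacA_vac //.
  by move=> u; exact: good_A.
- move=> a b z; apply: (hE (rshift m a) (rshift m b)); rewrite ?odd_ixr ?kacE_rr ?kacD_vac //.
  by move=> u; exact: good_D.
Qed.

Definition deg (j : nat) (w : W) : Prop := forall P, submod P ->
  (forall S v, size S = j -> P (word S (vac0 K v))) -> P w.

Lemma deg_submod j : submod (deg j).
Proof.
split=> [P hP _|x u z hu hz P hP h]; first exact: hP.1.
by apply: hP.2; [exact: (hu P hP h)|exact: (hz P hP h)].
Qed.

Lemma deg_word S v : deg (size S) (word S (vac0 K v)).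
Proof. by move=> P hP h; exact: h. Qed.

Arguments deg_word : clear implicits.

Lemma deg_good j w : deg j.+1 w -> good w.
Proof. by apply; [exact: good_submod|move=> S v Sj; apply: good_word; rewrite -size_eq0 Sj]. Qed.

Lemma deg_even c d j w : p c = p d -> deg j w -> deg j (E c d w).
Proof.
move=> cd dw; apply: (dw _ (submod_pre (E c d) (deg_submod j))) => {dw w} S v <-.
rewrite -[E c d _](subrK (word S (E c d (vac0 K v)))).
apply: (submodD (deg_submod _)).
  apply: (@word_E c d _ [::] S _ cd (deg_submod _)) => S1 a S2 eS _ /=.
  have -> : size S = size (S1 ++ repl c d a :: S2) by rewrite eS !size_cat.
  exact: deg_word.
have [v' ->] : exists v', E c d (vac0 K v) = vac0 K v'; last exact: deg_word.
have [i ec|k ec] := split_ordP c; have [i' ed|k' ed] := split_ordP d; move: cd; rewrite ec ed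
  ?odd_ixl ?odd_ixr // => _.
  by exists (A i i' v); rewrite kacE_ll kacA_vac.
by exists (D k k' v); rewrite kacE_rr kacD_vac.
Qed.

Lemma deg_mcr a j w : deg j w -> deg j.+1 (mcr K a w).
Proof.
move=> dw; apply: (dw _ (submod_pre (mcr K a) (deg_submod j.+1))) => {dw} S v <-.
exact: (deg_word (a :: S) v).
Qed.

Lemma deg_X (a : J) j w : deg j.+1 w -> deg j (kX a.1 a.2 w).
Proof.
move=> dw; apply: (dw _ (submod_pre (kX a.1 a.2) (deg_submod _))) => {dw w} S; elim: S j => // b S IH j v [<-] {j}.
rewrite /= {1}(surjective_pairing b) kacX_Y -surjective_pairing.
have dS := deg_submod (size S).
apply: (submodB dS); first apply: (submodD dS).
- by apply: (submodZ dS); rewrite -(kacE_ll A D); apply: deg_even (deg_word _ _); rewrite !odd_ixl.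
- by apply: (submodZ dS); rewrite -(kacE_rr A D); apply: deg_even (deg_word _ _); rewrite !odd_ixr.
case: S IH {dS} => [_|c S IH] /=; first by rewrite kacX_vac linear0; exact: (deg_submod _).1.
by apply: deg_mcr; exact: IH.
Qed.

(** With u from [good_form], F(w, w) is the sum of the F(X_a u, X_a u), one degree lower. If it
    vanishes then D u = 0, and u = D q(D)^2 u forces u = 0. *)
Lemma deg_pos j w : deg j w -> 0 <= shap w w /\ (shap w w = 0 -> w = 0).
Proof.
elim: j w => [|j IH] w dw.
  have [v ->] : exists v, w = vac0 K v.
    apply: (dw (fun w => exists v, w = vac0 K v)); last by case=> // v _; exists v.
    split=> [|x _ _ [u ->] [z ->]]; first by exists 0; rewrite linear0.
    by exists (x *: u + z); rewrite linearP.
  rewrite shap_vac proj_vac0 hform_ge0; split=> // /eqP.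
  by rewrite hform_eq0 => /eqP ->; rewrite linear0.
have [u [q [eu [e h]]]] := good_form shap_linl shap_herm kacdop_shap (deg_good dw).
have du : deg j.+1 u.
  have dkac z : deg j.+1 z -> deg j.+1 (kacdop z).
    move=> dz; rewrite kacdopE; apply: (submod_sum (deg_submod _)) => a _.
    by apply: deg_mcr; exact: deg_X.
  rewrite eu /peval; apply: (submod_sum (deg_submod _)) => i _.
  apply: (submodZ (deg_submod _)); elim: (nat_of_ord i) => //= k; exact: dkac.
rewrite e kacdop_sq; split.
  by apply: sumr_ge0 => a _; exact: (IH _ (deg_X a du)).1.
move/eqP; rewrite psumr_eq0 => [/allP X0|a _]; last exact: (IH _ (deg_X a du)).1.
apply: h; have [q' eq'] := good_sqrt (deg_good du).
have X00 a : kX a.1 a.2 u = 0.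
  by apply: (IH _ (deg_X a du)).2; apply/eqP; apply: X0; rewrite mem_index_enum.
rewrite eq'; have c z : kacdop (peval kacdop q' z) = peval kacdop q' (kacdop z) by apply: peval_op.
rewrite !c kacdopE big1 => [|a _]; last by rewrite X00 linear0.
by rewrite -(pevallE kacdop q' 0) linear0 -pevallE linear0.
Qed.

Lemma deg_gsum w : gsum deg w.
Proof.
elim/mcar_ind: w => [|v|a w [P [f [fd ->]]]]; first exact: gsum_submod deg_submod.
  by apply: (gsum_in deg_submod (p := 0%N)); exact: (deg_word [::]).
rewrite linear_sum; apply: (submod_sum (gsum_submod deg_submod)) => j _.
by apply: (gsum_in deg_submod (p := j.+1)); exact: deg_mcr.
Qed.

Lemma deg_orth i j u w : i != j -> deg i u -> deg j w -> shap u w = 0.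
Proof.
move=> ij du; move: j w ij; apply: (du (fun u => forall j w, i != j -> deg j w -> shap u w = 0)).
  split=> [j w _ _|x y z hy hz j w ij dw]; first by rewrite /shap hform0l.
  by rewrite shap_linl (hy j) // (hz j) // mulr0 addr0.
move=> {du u} S v; elim: S i => [|a S IH] i <- j w ij dw /=.
  rewrite shap_vac.
  suff -> : proj K w = 0 by rewrite hform0r.
  apply: (dw _ (submod_ker (proj K))) => -[|b S] v' Sj /=; last by rewrite proj_mcr.
  by rewrite -Sj in ij.
rewrite shap_Y; case: j ij dw => [|j] ij dw; last by apply: (IH _ erefl j) (deg_X a dw).
have -> : kX a.1 a.2 w = 0; last by rewrite /shap linear0 hform0r.
by apply: (dw _ (submod_ker (kX a.1 a.2))) => -[] // v' _; rewrite kacX_vac.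
Qed.

Lemma shap_pos w : w != 0 -> 0 < shap w w.
Proof.
move=> w0; have [P [f [fd e]]] := deg_gsum w.
have ew : shap w w = \sum_(j < P) shap (f j) (f j).
  rewrite {1}e /shap hform_suml; apply: eq_bigr => j _; rewrite e linear_sum hform_sumr.
  rewrite (bigD1 j) //= big1 ?addr0 // => k kj.
  by apply: deg_orth (fd j) (fd k); rewrite eq_sym.
rewrite lt_def ew sumr_ge0 => [|j _]; last exact: (deg_pos (fd j)).1.
rewrite andbT; apply: contra_neq w0 => /eqP.
rewrite psumr_eq0 => [/allP h|j _]; last exact: (deg_pos (fd j)).1.
rewrite e big1 // => j _; apply: (deg_pos (fd j)).2; apply/eqP.
by apply: h; rewrite mem_index_enum.
Qed.

Hypothesis v0_neq0 : v0 != 0.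

Lemma kac_unitarizable (L : 'rV[C]_(m + n)) (c : C) :
  (forall a, L 0 a = Lam a + (-1) ^+ p a * c) ->
  exists M : supermodule R m n, is_simple_hw M L /\ unitarizable M.
Proof.
move=> hL; pose F := HForm shap_linl shap_herm shap_pos.
apply: (@superrep_unitarizable R m n W E E_rep F (gam K) w0 Lam _ _ _ _ _ _ _ _ L c hL).
- exact: shap_E.
- exact: gam_gam.
- exact: kac_parity.
- exact: shap_gam.
- by apply: contra_neq v0_neq0 => e; rewrite -(proj_vac0 K v0) e linear0.
- exact: gam_vac00.
- exact: kac_raise.
- exact: kac_diag.
Qed.

End Shapovalov.

Theorem typical_unitarizable (R : realType) (m n : nat) (V : lmodType R[i]) (B : hform V)
    (A : 'I_m -> 'I_m -> {linear V -> V}) (D : 'I_n -> 'I_n -> {linear V -> V})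
    (v0 : V) (lam : 'I_m -> R[i]) (mu : 'I_n -> R[i]) (t : R[i])
    (L : 'rV[R[i]]_(m + n)) (c : R[i]) :
  (forall i j k l v,
    A i j (A k l v) = A k l (A i j v) + (j == k)%:R *: A i l v - (l == i)%:R *: A k j v) ->
  (forall i j k l v,
    D i j (D k l v) = D k l (D i j v) + (j == k)%:R *: D i l v - (l == i)%:R *: D k j v) ->
  (forall i j k l v, A i j (D k l v) = D k l (A i j v)) ->
  (forall i j u w, B (A i j u) w = B u (A j i w)) ->
  (forall i j u w, B (D i j u) w = B u (D j i w)) ->
  (forall i j : 'I_m, (i < j)%N -> A i j v0 = 0) ->
  (forall i j : 'I_n, (i < j)%N -> D i j v0 = 0) ->
  (forall i, A i i v0 = lam i *: v0) -> (forall k, D k k v0 = mu k *: v0) ->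
  (forall P : V -> Prop, submod P -> P v0 ->
    (forall i j v, P v -> P (A i j v)) -> (forall i j v, P v -> P (D i j v)) -> forall v, P v) ->
  v0 != 0 -> 0 < t -> (forall i k, t + n.-1%:R <= lam i + mu k) ->
  (forall i, L 0 (lshift n i) = lam i + c) -> (forall k, L 0 (rshift m k) = mu k - c) ->
  exists M : supermodule R m n, is_simple_hw M L /\ unitarizable M.
Proof.
move=> AA DD AD Aa Da Ar Dr Ad Dd gen v00 t0 lm Ll Lr.
have K := car_exists B #|{: 'I_m * 'I_n}|.
have [Phi [P1 P2]] := @mcar_univ _ _ _ _ K (car_sp K) (fun a => kacX A D K a.1 a.2) (proj K)
  (fun a b u => kacX_X AA DD AD a b u).
apply: (kac_unitarizable AA DD AD Aa Da P1 P2 Ar Dr Ad Dd gen t0 lm v00 (c := c)) => a.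
have [i ->|k ->] := split_ordP a.
  by rewrite Ll weight_of_l odd_ixl mul1r.
by rewrite Lr weight_of_r odd_ixr expr1 mulN1r.
Qed.

(** * The atypical case *)

Section MpolyForm.
Variables (C : numClosedFieldType) (N : nat).
Local Notation P := {mpoly C[N]}.
Implicit Types (p q : P) (m : 'X_{1..N}).

Definition mfac m : nat := \prod_(i < N) (m i)`!.

Lemma mfac_gt0 m : (0 < mfac m)%N.
Proof. by rewrite prodn_gt0 // => i; rewrite fact_gt0. Qed.

Lemma mfacU i m : mfac (U_(i) + m) = ((m i).+1 * mfac m)%N.
Proof.
rewrite /mfac (bigD1 i) //= [X in (_ = _ * X)%N](bigD1 i) //= mnmDE mnm1E eqxx add1n factS -mulnA.
congr (_ * (_ * _))%N; apply: eq_bigr => j ji.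
by rewrite mnmDE mnm1E eq_sym (negPf ji) add0n.
Qed.

Definition msum (g : 'X_{1..N} -> C) p : C := \sum_(m <- msupp p) p@_m * g m.

Lemma msum_wide g p (s : seq 'X_{1..N}) : uniq s -> {subset msupp p <= s} ->
  msum g p = \sum_(m <- s) p@_m * g m.
Proof.
move=> us ps; rewrite (bigID (mem (msupp p))) /= [X in _ = _ + X]big1 ?addr0 => [|m]; last first.
  by rewrite -mcoeff_eq0 => /eqP ->; rewrite mul0r.
rewrite -big_filter; apply: perm_big; apply: uniq_perm; rewrite ?msupp_uniq ?filter_uniq //.
by move=> m; rewrite mem_filter /=; case: (boolP (m \in msupp p)) => // /ps ->.
Qed.

Lemma msum_linear g : linear (msum g : P -> C^o).
Proof.
move=> a p q; pose s := undup (msupp p ++ msupp q ++ msupp (a *: p + q)).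
have us : uniq s by exact: undup_uniq.
rewrite !(@msum_wide g _ s) // => [|m hm|m hm|m hm]; rewrite ?mem_undup ?mem_cat ?hm ?orbT //.
rewrite scaler_sumr -big_split; apply: eq_bigr => m _ /=.
by rewrite mcoeffD mcoeffZ mulrDl -mulrA.
Qed.

(** Monomials are orthogonal, and the factorials in their squared norms make multiplication by a
    variable adjoint to differentiation. *)
Definition mform_val p q : C := msum (fun m => (q@_m)^* * (mfac m)%:R) p.

Lemma mform_exists : {B : hform P | (forall p q, B p q = mform_val p q)
  /\ (forall i p q, B ('X_i * p) q = B p q^`M(i))}.
Proof.
have bl a u v w : mform_val (a *: u + v) w = a * mform_val u w + mform_val v w.
  exact: msum_linear.
have bh u v : mform_val u v = (mform_val v u)^*.
  pose s := undup (msupp u ++ msupp v); have us : uniq s by exact: undup_uniq.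
  rewrite /mform_val !(@msum_wide _ _ s) // => [|m hm|m hm]; rewrite ?mem_undup ?mem_cat ?hm ?orbT //.
  rewrite rmorph_sum; apply: eq_bigr => m _ /=.
  by rewrite !rmorphM /= conjCK conjC_nat; ring.
have bp u : u != 0 -> 0 < mform_val u u.
  move=> u0; rewrite /mform_val /msum.
  have pos m : m \in msupp u -> 0 < u@_m * ((u@_m)^* * (mfac m)%:R).
    rewrite mcoeff_msupp => h; rewrite mulrA -normCK mulr_gt0 ?ltr0n ?mfac_gt0 //.
    by rewrite exprn_gt0 // normr_gt0.
  case: (msupp u) pos (msupp_eq0 u) => [|m s] pos; first by rewrite eqxx (negPf u0).
  move=> _; rewrite big_cons ltr_wpDr ?pos ?mem_head // big_seq sumr_ge0 // => k ks.
  by apply/ltW/pos; rewrite inE ks orbT.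
pose B := HForm bl bh bp; exists B; split=> // i p q.
have BX m r : B 'X_[m] r = (r@_m)^* * (mfac m)%:R.
  by rewrite /= /mform_val /msum msuppX big_seq1 mcoeffX eqxx mul1r.
rewrite [p]mpolyE mulr_sumr !hform_suml; apply: eq_bigr => m _.
rewrite -scalerAr !hformZl; congr (_ * _).
rewrite -mpolyXD !BX mfacU mcoeff_deriv addmC rmorphMn /= natrM -mulr_natr; ring.
Qed.

End MpolyForm.

(** * Derivations, determinants and eigenvectors *)

Section Derivations.
Variables (A : comNzRingType) (d : {additive A -> A}).
Hypothesis dM : forall a b, d (a * b) = d a * b + a * d b.

Lemma deriv1 : d 1 = 0.
Proof.
have := dM 1 1; rewrite !mulr1 mul1r => /(congr1 (fun x => x - d 1)).
by rewrite subrr addrK.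
Qed.

Lemma deriv_prod (I : eqType) (r : seq I) (F : I -> A) : uniq r ->
  d (\prod_(i <- r) F i) = \sum_(j <- r) \prod_(i <- r) (if i == j then d (F i) else F i).
Proof.
elim: r => [_|k r IH /= /andP[kr ur]]; first by rewrite !big_nil deriv1.
rewrite !big_cons dM eqxx IH //; congr (_ + _).
  congr (_ * _); apply: eq_big_seq => i ir; case: eqP => // ik.
  by rewrite -ik ir in kr.
rewrite mulr_sumr; apply: eq_big_seq => j jr; rewrite big_cons; case: eqP => // kj.
by rewrite kj jr in kr.
Qed.

Lemma deriv_det b (M : 'M[A]_b) :
  d (\det M) = \sum_r \det (\matrix_(i, j) (if i == r then d (M i j) else M i j)).
Proof.
rewrite /determinant raddf_sum exchange_big; apply: eq_bigr => s _ /=.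
have -> : d ((-1) ^+ perm.odd_perm s * \prod_i M i (perm.fun_of_perm s i))
    = (-1) ^+ perm.odd_perm s * d (\prod_i M i (perm.fun_of_perm s i)).
  by case: (perm.odd_perm s); rewrite ?mulN1r ?mul1r ?raddfN.
rewrite deriv_prod ?index_enum_uniq // mulr_sumr; apply: eq_bigr => r _; congr (_ * _).
by apply: eq_bigr => i _; rewrite mxE.
Qed.

Definition eigd (x p : A) := d p = x * p.

Lemma eigdM x y p q : eigd x p -> eigd y q -> eigd (x + y) (p * q).
Proof. by move=> hp hq; rewrite /eigd dM hp hq; ring. Qed.

Lemma eigd1 : eigd 0 1. Proof. by rewrite /eigd deriv1 mul0r. Qed.

Lemma eigdX x p k : eigd x p -> eigd (k%:R * x) (p ^+ k).
Proof.
move=> hp; elim: k => [|k IH]; first by rewrite mul0r expr0; exact: eigd1.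
by rewrite exprS -natr1 mulrDl mul1r addrC; exact: eigdM.
Qed.

Lemma eigd_prod (I : Type) (r : seq I) (x p : I -> A) : (forall i, eigd (x i) (p i)) ->
  eigd (\sum_(i <- r) x i) (\prod_(i <- r) p i).
Proof.
move=> h; elim: r => [|i r IH]; first by rewrite !big_nil; exact: eigd1.
by rewrite !big_cons; exact: eigdM.
Qed.

End Derivations.

Lemma det_row0 (A : comNzRingType) b (M : 'M[A]_b) r : (forall j, M r j = 0) -> \det M = 0.
Proof. by move=> h; rewrite (expand_det_row M r) big1 // => j _; rewrite h mul0r. Qed.

(** * Leading minors as highest weight vectors *)

Section Minors.
Variables (C : numClosedFieldType) (n d : nat).
Local Notation N := #|{: 'I_n * 'I_d}|.
Local Notation P := {mpoly C[N]}.

Definition xvar (k : 'I_n) (s : 'I_d) : P := 'X_(enum_rank (k, s)).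
Definition xpart (k : 'I_n) (s : 'I_d) (p : P) : P := p^`M(enum_rank (k, s)).

Lemma xpart_xvar k s l t : xpart k s (xvar l t) = ((k, s) == (l, t))%:R.
Proof.
rewrite /xpart /xvar mderivX mnm1E (inj_eq enum_rank_inj) eq_sym.
case: eqP => [->|_]; last by rewrite scale0r.
by rewrite scale1r (_ : _ - _ = 0)%MM ?mpolyX0 //; apply/mnmP => i; rewrite mnmBE subnn mnm0E.
Qed.

Definition xnat (k s : nat) : P :=
  if insub k is Some k' then if insub s is Some s' then xvar k' s' else 0 else 0.

Lemma xnatE k s (kn : (k < n)%N) (sd : (s < d)%N) : xnat k s = xvar (Ordinal kn) (Ordinal sd).
Proof. by rewrite /xnat !insubT. Qed.

Lemma xnat_l (k : 'I_n) s (sd : (s < d)%N) : xnat k s = xvar k (Ordinal sd).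
Proof. by rewrite /xnat valK insubT. Qed.

(** Polarization: the action of a matrix unit of gl(n) on polynomials in an n by d matrix of
    variables. *)
Definition polar (k l : 'I_n) (p : P) : P := \sum_s xvar k s * xpart l s p.

Lemma polar_additive k l : zmod_morphism (polar k l).
Proof.
by move=> p q; rewrite /polar -sumrB; apply: eq_bigr => s _; rewrite /xpart mderivB mulrBr.
Qed.

Lemma xpart_additive k s : zmod_morphism (xpart k s).
Proof. by move=> p q; rewrite /xpart mderivB. Qed.

Definition polara k l : {additive P -> P} :=
  HB.pack (polar k l) (GRing.isZmodMorphism.Build _ _ (polar k l) (polar_additive k l)).
Definition xparta k s : {additive P -> P} :=
  HB.pack (xpart k s) (GRing.isZmodMorphism.Build _ _ (xpart k s) (xpart_additive k s)).

Lemma polarM k l p q : polara k l (p * q) = polara k l p * q + p * polara k l q.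
Proof.
rewrite /= /polar mulr_suml mulr_sumr -big_split; apply: eq_bigr => s _ /=.
by rewrite /xpart mderivM; ring.
Qed.

Lemma xpartM k s p q : xparta k s (p * q) = xparta k s p * q + p * xparta k s q.
Proof. by rewrite /= /xpart mderivM. Qed.

Lemma polar_xnat (k l : 'I_n) i j : (i < n)%N -> (j < d)%N ->
  polar k l (xnat i j) = (i == l)%:R * xnat k j.
Proof.
move=> ni jd; rewrite xnatE xnat_l /polar (bigD1 (Ordinal jd)) //= big1 ?addr0 => [|s sj].
  rewrite xpart_xvar xpair_eqE eqxx andbT -val_eqE /= eq_sym mulrC.
  by [].
by rewrite xpart_xvar xpair_eqE (negPf sj) andbF mulr0.
Qed.

Definition minor (b : nat) : P := \det (\matrix_(i < b, j < b) xnat i j).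

(** The polarization puts row k in place of row l: for k < l < b two rows coincide, for k = l < b
    nothing changes, and for [l >= b] there is no row to replace. *)
Lemma polar_minor (k l : 'I_n) b : (b <= n)%N -> (b <= d)%N -> (k <= l)%N ->
  eigd (polara k l) ((k == l) && (k < b)%N)%:R (minor b).
Proof.
move=> bn bd kl; rewrite /eigd /minor (deriv_det (polarM k l)).
have zero (r : 'I_b) : r != l :> nat -> \det (\matrix_(i, j) (if i == r then
    polara k l ((\matrix_(i, j) xnat i j) i j) else (\matrix_(i, j) xnat i j) i j)) = 0 :> P.
  move=> rl; apply: (det_row0 (r := r)) => j.
  rewrite !mxE eqxx [LHS]/= polar_xnat ?(leq_trans (ltn_ord _)) //.
  by rewrite (negPf rl) mul0r.
case: (ltnP l b) => lb; last first.
  rewrite big1 => [|r _]; last by apply: zero; have := ltn_ord r; lia.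
  case: eqVneq => [kl'|]; last by rewrite mul0r.
  by rewrite kl' ltnNge lb mul0r.
rewrite (bigD1 (Ordinal lb)) //= big1 ?addr0 => [|r rl]; last exact: zero.
case: (eqVneq k l) => [->|nkl] /=.
  rewrite lb mul1r; congr (\det _); apply/matrixP => i j; rewrite !mxE.
  case: eqP => // ->; rewrite [LHS]/= polar_xnat ?(leq_trans (ltn_ord _)) //.
  by rewrite eqxx mul1r.
have kb : (k < b)%N by apply: leq_ltn_trans lb.
rewrite mul0r; apply: (determinant_alternate (i1 := Ordinal kb) (i2 := Ordinal lb)).
  by rewrite -val_eqE /=; apply: contra nkl => /eqP/val_inj ->.
move=> j; rewrite !mxE eqxx -val_eqE /=.
have -> : (k == l :> nat) = false by apply/negP => /eqP/val_inj e; rewrite e eqxx in nkl.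
by rewrite polar_xnat ?(leq_trans (ltn_ord _)) // eqxx mul1r.
Qed.

Lemma xpart_minor (k : 'I_n) (s : 'I_d) b : (b <= n)%N -> (b <= s)%N ->
  eigd (xparta k s) 0 (minor b).
Proof.
move=> bn bs; rewrite /eigd mul0r /minor (deriv_det (xpartM k s)) big1 // => r _.
apply: (det_row0 (r := r)) => j; rewrite !mxE eqxx [LHS]/=.
have rn : (r < n)%N by apply: leq_trans bn.
have jd : (j < d)%N by have := ltn_ord j; have := ltn_ord s; lia.
rewrite xnatE xpart_xvar xpair_eqE -!val_eqE /=.
have -> : (s == j :> nat) = false by have := ltn_ord j; lia.
by rewrite andbF.
Qed.

Lemma minor_neq0 b : (b <= n)%N -> (b <= d)%N -> minor b != 0.
Proof.
move=> bn bd; pose v (a : 'I_N) : C := ((enum_val a).1 == (enum_val a).2 :> nat)%:R.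
apply/eqP => /(congr1 (meval v)); rewrite rmorph0 /minor -det_map_mx.
have -> : map_mx (meval v) (\matrix_(i < b, j < b) xnat i j) = 1%:M.
  apply/matrixP => i j; rewrite !mxE xnatE ?(leq_trans (ltn_ord _)) // => ? ?.
  by rewrite /xvar mevalXU /v enum_rankK.
by rewrite det1 => /eqP; rewrite oner_eq0.
Qed.

Variables (mu : nat -> nat) (K : nat).
Hypothesis mu_mono : forall i, (mu i.+1 <= mu i)%N.
Hypothesis mu0 : forall i, (K <= i)%N -> mu i = 0%N.
Hypotheses (Kn : (K <= n)%N) (Kd : (K <= d)%N).

(* The highest weight vector of weight mu for gl(n) in the polynomials in n x d variables. *)
Definition hwpoly : P := \prod_(b < n) minor b.+1 ^+ (mu b - mu b.+1).

Lemma hwpoly_neq0 : hwpoly != 0.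
Proof.
apply/prodf_neq0 => b _; case: (ltnP b K) => bK.
  by rewrite expf_neq0 // minor_neq0 // (leq_trans bK).
by rewrite (mu0 bK) expr0 oner_neq0.
Qed.

Lemma hwpoly_xpart (k : 'I_n) (s : 'I_d) : (K <= s)%N -> xpart k s hwpoly = 0.
Proof.
move=> Ks; rewrite -[LHS]/(xparta k s hwpoly).
have h (b : 'I_n) : eigd (xparta k s) 0 (minor b.+1 ^+ (mu b - mu b.+1)).
  case: (ltnP b K) => bK; last by rewrite (mu0 bK) expr0; exact: (eigd1 (xpartM k s)).
  rewrite -(mulr0 (mu b - mu b.+1)%:R); apply: (eigdX (xpartM k s)).
  by apply: xpart_minor; [exact: leq_trans bK Kn|exact: leq_trans bK Ks].
have := eigd_prod (xpartM k s) (index_enum 'I_n) h.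
by rewrite /eigd [X in X * _]big1 ?mul0r.
Qed.

(** The sum collects the exponents in [hwpoly] of the minors that contain row k. *)
Lemma mu_telescope (k j : nat) : (k <= j)%N ->
  (\sum_(b < j | (k < b.+1)%N) (mu b - mu b.+1) = mu k - mu j)%N.
Proof.
elim: j => [|j IH] kj; first by rewrite big_ord0; move: kj; case: k => // _; rewrite subnn.
rewrite big_mkcond big_ord_recr /= -big_mkcond /=.
case: (ltngtP k j.+1) kj => // [kj _|-> _]; last first.
  rewrite big1 ?ltnn ?subnn // => b jb; exfalso; have := ltn_ord b; lia.
rewrite IH //.
have mono a : (mu (k + a) <= mu k)%N.
  elim: a => [|a IHa]; first by rewrite addn0.
  by rewrite addnS; apply: leq_trans (mu_mono _) IHa.
have := mono (j - k)%N; have := mu_mono j; rewrite subnKC //; lia.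
Qed.

Lemma hwpoly_polar (k l : 'I_n) : (k <= l)%N ->
  polar k l hwpoly = ((k == l)%:R * (mu k)%:R) *: hwpoly.
Proof.
move=> kl; rewrite -[LHS]/(polara k l hwpoly).
have h (b : 'I_n) : eigd (polara k l)
    ((mu b - mu b.+1)%:R * ((k == l) && (k < b.+1)%N)%:R) (minor b.+1 ^+ (mu b - mu b.+1)).
  case: (ltnP b K) => bK; last by rewrite (mu0 bK) sub0n mul0r expr0; exact: (eigd1 (polarM k l)).
  apply: (eigdX (polarM k l)).
  by apply: polar_minor => //; exact: leq_trans bK Kd.
have -> := eigd_prod (polarM k l) (index_enum 'I_n) h.
rewrite -mul_mpolyC; congr (_ * _).
case: (eqVneq k l) => [_|_] /=; last first.
  by rewrite mul0r mpolyC0 big1 // => b _; rewrite mulr0.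
rewrite mul1r mpolyC_nat; under eq_bigr => b _ do rewrite mulr_natr mulrb.
rewrite -big_mkcond -natr_sum /=; congr (_%:R).
by rewrite mu_telescope ?(mu0 Kn) ?subn0 // ltnW.
Qed.

End Minors.

(** * The oscillator representation *)

Section Fock.
Variables (C : numClosedFieldType) (m n d : nat).
Local Notation P := {mpoly C[#|{: 'I_n * 'I_d}|]}.
Variable B : hform P.
Hypothesis B_var : forall i p q, B ('X_i * p) q = B p q^`M(i).
Variable K : car B #|{: 'I_m * 'I_d}|.
Local Notation W := (car_sp K).
Local Notation BW := (car_form K).
Local Notation xv := (@xvar C n d).
Local Notation xp := (@xpart C n d).

Lemma xvar_linear k s : linear (fun p : P => xv k s * p).
Proof. by move=> a u w; rewrite mulrDr scalerAr. Qed.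
Lemma xpart_linear k s : linear (xp k s).
Proof. by move=> a u w; rewrite /xpart mderivD mderivZ. Qed.

(** The first m indices carry fermions, the others bosons; the number of fermionic factors in
    [fockE a b] then has the parity of the matrix unit. *)
Definition fockCr (a : 'I_(m + n)) (s : 'I_d) : {linear W -> W} :=
  match split a with
  | inl i => @mcr C P B _ K (i, s)
  | inr k => ext K (klin (xvar_linear k s))
  end.
Definition fockAn (a : 'I_(m + n)) (s : 'I_d) : {linear W -> W} :=
  match split a with
  | inl i => @man C P B _ K (i, s)
  | inr k => ext K (klin (xpart_linear k s))
  end.

Lemma fockCr_l i s : fockCr (lshift n i) s = @mcr C P B _ K (i, s).
Proof. by rewrite /fockCr (unsplitK (inl i : 'I_m + 'I_n)). Qed.
Lemma fockCr_r k s : fockCr (rshift m k) s = ext K (klin (xvar_linear k s)).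
Proof. by rewrite /fockCr (unsplitK (inr k : 'I_m + 'I_n)). Qed.
Lemma fockAn_l i s : fockAn (lshift n i) s = @man C P B _ K (i, s).
Proof. by rewrite /fockAn (unsplitK (inl i : 'I_m + 'I_n)). Qed.
Lemma fockAn_r k s : fockAn (rshift m k) s = ext K (klin (xpart_linear k s)).
Proof. by rewrite /fockAn (unsplitK (inr k : 'I_m + 'I_n)). Qed.
Local Notation fockE_ := (fockCr_l, fockCr_r, fockAn_l, fockAn_r).

Lemma ext_comm (S T U : {linear P -> P}) (c : C) :
  (forall p, S (T p) = T (S p) + c *: U p) ->
  forall w, ext K S (ext K T w) = ext K T (ext K S w) + c *: ext K U w.
Proof.
move=> h; elim/mcar_ind => [|v|a w IH].
- split=> [|x u w hu hw]; first by rewrite !linear0 ?scaler0 addr0.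
  by rewrite !linearP hu hw; apply: (hform_inj (B := BW)) => z; rewrite !(hformDl, hformZl); ring.
- by rewrite !ext_vac0 h linearD linearZ.
- by rewrite !ext_mcr IH linearD linearZ.
Qed.

Lemma ext_id w : ext K idfun w = w.
Proof.
elim/mcar_ind: w => [|v|a w IH]; first exact: (submod_eq (ext K idfun) idfun).
  by rewrite ext_vac0.
by rewrite ext_mcr IH.
Qed.

Lemma ext_comm0 (S T : {linear P -> P}) : (forall p, S (T p) = T (S p)) ->
  forall w, ext K S (ext K T w) = ext K T (ext K S w).
Proof.
move=> h w; rewrite (ext_comm (U := idfun) (c := 0)) ?scale0r ?addr0 // => p.
by rewrite scale0r addr0 h.
Qed.

Definition fsign (a b : 'I_(m + n)) : C := (-1) ^+ (~~ odd_ix a && ~~ odd_ix b).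

Lemma fockCr_fockCr a b s t w :
  fockCr a s (fockCr b t w) = fsign a b *: fockCr b t (fockCr a s w).
Proof.
rewrite /fsign; have [i ->|k ->] := split_ordP a; have [j ->|l ->] := split_ordP b;
  rewrite !(odd_ixl, odd_ixr) !fockE_ /= ?expr1 ?expr0 ?scaleN1r ?scale1r.
- exact: mcr_mcr.
- by rewrite ext_mcr.
- by rewrite ext_mcr.
- by apply: ext_comm0 => p; rewrite !klinE mulrCA.
Qed.

Lemma xpart_xvarM k s l t p :
  xp k s (xv l t * p) = xv l t * xp k s p + ((k == l) && (s == t))%:R *: p.
Proof.
have e := xpart_xvar C k s l t; rewrite /xpart in e *; rewrite mderivM e addrC xpair_eqE.
by case: (_ && _); rewrite ?mul1r ?scale1r ?mul0r ?scale0r.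
Qed.

Lemma fockAn_fockCr a b s t w : fockAn a s (fockCr b t w)
  = ((a == b) && (s == t))%:R *: w + fsign a b *: fockCr b t (fockAn a s w).
Proof.
rewrite /fsign; have [i ->|k ->] := split_ordP a; have [j ->|l ->] := split_ordP b;
  rewrite !(odd_ixl, odd_ixr) !fockE_ ?eq_lshift ?eq_rshift ?eq_lrshift ?eq_rlshift /=
    ?expr1 ?expr0 ?scaleN1r ?scale1r ?scale0r ?add0r.
- by rewrite man_mcr xpair_eqE.
- by rewrite ext_man.
- by rewrite ext_mcr.
- rewrite (ext_comm (U := idfun) (c := ((k == l) && (s == t))%:R)) ?ext_id 1?addrC // => p.
  by rewrite !klinE xpart_xvarM.
Qed.

Lemma fock_adj a s u w : BW (fockCr a s u) w = BW u (fockAn a s w).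
Proof.
have [i ->|k ->] := split_ordP a; rewrite !fockE_; first exact: mcr_adj.
by apply: ext_adj => p q; rewrite !klinE B_var.
Qed.

Lemma fock_adj' a s u w : BW (fockAn a s u) w = BW u (fockCr a s w).
Proof. by rewrite hform_herm -fock_adj -hform_herm. Qed.

Lemma fsignC a b : fsign a b = fsign b a. Proof. by rewrite /fsign andbC. Qed.

Lemma fsign_real a b : (fsign a b)^* = fsign a b.
Proof. by rewrite /fsign; case: (_ && _); rewrite ?expr1 ?expr0 ?rmorphN rmorph1. Qed.

Lemma fockAn_fockAn a b s t w :
  fockAn a s (fockAn b t w) = fsign a b *: fockAn b t (fockAn a s w).
Proof.
apply: (hform_inj (B := BW)) => z.
by rewrite hformZl !fock_adj' fockCr_fockCr hformZr fsign_real fsignC.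
Qed.

(* Oscillator realization: m rows of fermions and n rows of bosons, each of length d. *)
Definition fockE (a b : 'I_(m + n)) : {linear W -> W} :=
  klin (linear_big (index_enum 'I_d) xpredT (fun s => fockCr a s \o fockAn b s : {linear W -> W})).

Lemma fockE_def a b w : fockE a b w = \sum_s fockCr a s (fockAn b s w).
Proof. exact: klinE. Qed.

Local Notation sg a b c := ((-1) ^+ ((odd_ix a (+) odd_ix b) && ~~ odd_ix c) : C).

Lemma fsign_fsign a b c : fsign b c * fsign a c = sg a b c.
Proof.
by rewrite /fsign; case: (odd_ix a); case: (odd_ix b); case: (odd_ix c); rewrite /= ?expr0 ?expr1; ring.
Qed.

Lemma fockE_fockCr a b c t w :
  fockE a b (fockCr c t w) = (b == c)%:R *: fockCr a t w + sg a b c *: fockCr c t (fockE a b w).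
Proof.
rewrite !fockE_def (linear_sum (fockCr c t)) scaler_sumr.
rewrite (eq_bigr (fun s => (t == s)%:R *: ((b == c)%:R *: fockCr a s w)
    + sg a b c *: fockCr c t (fockCr a s (fockAn b s w)))).
  by rewrite big_split /= sum_deltaZ.
move=> s _; rewrite fockAn_fockCr linearD !linearZ /= fockCr_fockCr !scalerA fsign_fsign.
by rewrite -natrM mulnb [s == t]eq_sym.
Qed.

Lemma fockAn_fockE a b c t w :
  fockAn c t (fockE a b w) = (c == a)%:R *: fockAn b t w + sg a b c *: fockE a b (fockAn c t w).
Proof.
rewrite !fockE_def (linear_sum (fockAn c t)) scaler_sumr.
rewrite (eq_bigr (fun s => (t == s)%:R *: ((c == a)%:R *: fockAn b s w)
    + sg a b c *: fockCr a s (fockAn b s (fockAn c t w)))).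
  by rewrite big_split /= sum_deltaZ.
move=> s _; rewrite fockAn_fockCr fockAn_fockAn linearZ /= !scalerA.
by rewrite fsignC mulrC [fsign c b]fsignC fsign_fsign -natrM mulnb andbC.
Qed.

(** [fockE a b] acts as a superderivation on creation and annihilation operators; on the bilinear
    [fockE c d] this leaves the two terms of the bracket. *)
Lemma fock_superrep : superrep fockE.
Proof.
move=> a b c d' w /=; rewrite {1}[fockE c d' w]fockE_def (linear_sum (fockE a b)).
have sg2 c' : sg a b c' * sg a b c' = 1 by rewrite -expr2 sqrr_sign.
have h s : fockE a b (fockCr c s (fockAn d' s w)) = (b == c)%:R *: fockCr a s (fockAn d' s w)
    + (sg a b c * sg a b d') *: (fockCr c s (fockAn d' s (fockE a b w))
       - (d' == a)%:R *: fockCr c s (fockAn b s w)).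
  rewrite fockE_fockCr; congr (_ + _); rewrite fockAn_fockE -!scalerA; congr (_ *: _).
  rewrite (linearD (fockCr c s)) !(linearZ_LR (fockCr c s)) /= addrAC subrr add0r scalerA sg2 scale1r.
  by [].
rewrite (eq_bigr _ (fun s _ => h s)) big_split /= -!scaler_sumr sumrB -scaler_sumr -!fockE_def.
have -> : sg a b c * sg a b d' = (-1) ^+ ((odd_ix a (+) odd_ix b) && (odd_ix c (+) odd_ix d')).
  by case: (odd_ix a); case: (odd_ix b); case: (odd_ix c); case: (odd_ix d');
    rewrite /= ?expr0 ?expr1; ring.
by rewrite scalerBr scalerA addrA addrAC addrK.
Qed.

Lemma fockE_adj a b u w : BW (fockE a b u) w = BW u (fockE b a w).
Proof.
rewrite !fockE_def hform_suml hform_sumr; apply: eq_bigr => s _.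
by rewrite fock_adj fock_adj'.
Qed.

Lemma gam_fockCr a s w : gam K (fockCr a s w) = (-1) ^+ (~~ odd_ix a) *: fockCr a s (gam K w).
Proof.
have [i ->|k ->] := split_ordP a; rewrite !fockE_ ?odd_ixl ?odd_ixr ?expr1 ?expr0.
  by rewrite gam_mcr scaleN1r.
by rewrite gam_ext scale1r.
Qed.

Lemma gam_fockAn a s w : gam K (fockAn a s w) = (-1) ^+ (~~ odd_ix a) *: fockAn a s (gam K w).
Proof.
have [i ->|k ->] := split_ordP a; rewrite !fockE_ ?odd_ixl ?odd_ixr ?expr1 ?expr0.
  by rewrite gam_man scaleN1r.
by rewrite gam_ext scale1r.
Qed.

Lemma gam_fockE a b w : gam K (fockE a b w) = (-1) ^+ (odd_ix a (+) odd_ix b) *: fockE a b (gam K w).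
Proof.
rewrite !fockE_def linear_sum scaler_sumr; apply: eq_bigr => s _.
rewrite gam_fockCr gam_fockAn linearZ /= scalerA; congr (_ *: _).
by case: (odd_ix a); case: (odd_ix b); rewrite /= ?expr0 ?expr1; ring.
Qed.

Variables (lam : 'I_m -> nat) (mu : nat -> nat) (r : nat).
Hypothesis lam_mono : forall i j : 'I_m, (i <= j)%N -> (lam j <= lam i)%N.
Hypotheses (lam_d : forall i, (lam i <= d)%N) (lam_r : forall i, (r <= lam i)%N).
Hypothesis mu_mono : forall i, (mu i.+1 <= mu i)%N.
Hypothesis mu0 : forall i, (r <= i)%N -> mu i = 0%N.
Hypotheses (rn : (r <= n)%N) (rd : (r <= d)%N).

Definition filled (a : 'I_m * 'I_d) : bool := (a.2 < lam a.1)%N.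
Definition fock_hw : W := mvac K filled (hwpoly C n d mu).

Lemma fock_hw_neq0 : fock_hw != 0.
Proof.
apply/eqP => e; have := hform_eq0 BW fock_hw; rewrite e eqxx -e /fock_hw /mvac vac_form.
by rewrite hform_eq0 (negPf (hwpoly_neq0 C n mu0 rd)).
Qed.

Lemma ext_mvac T o p : ext K T (mvac K o p) = mvac K o (T p).
Proof. exact: ext_vac. Qed.

(** Between fermions, either (j, s) is empty or (i, s) is already full, as lam decreases. From a
    boson to a fermion, columns s < r are full in row i and the polynomial does not involve columns
    s >= r: here the atypical condition enters. Between bosons it is the polarization of minors. *)
Lemma fock_raise (a b : 'I_(m + n)) : (a < b)%N -> fockE a b fock_hw = 0.
Proof.
move=> ab; rewrite fockE_def; move: ab.
have [i ->|k ->] := split_ordP a; have [j ->|l ->] := split_ordP b => /= ab.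
- rewrite big1 // => s _; rewrite !fockE_.
  case: (ltnP s (lam j)) => sj; last by rewrite mvac_man ?linear0 // /filled -leqNgt.
  have -> : mcr K (i, s) (man K (j, s) fock_hw) = - man K (j, s) (mcr K (i, s) fock_hw).
    rewrite man_mcr xpair_eqE; have -> : (j == i) = false by rewrite -val_eqE /=; lia.
    by rewrite scale0r sub0r opprK.
  by rewrite mvac_mcr ?linear0 ?oppr0 // /filled (leq_trans sj) // lam_mono // ltnW.
- rewrite big1 // => s _; rewrite !fockE_ ext_mvac klinE.
  case: (ltnP s r) => sr; first by rewrite mvac_mcr // /filled (leq_trans sr).
  by rewrite (hwpoly_xpart C mu0 rn) // !linear0.
- by have := ltn_ord j; lia.
rewrite (eq_bigr (fun s => mvac K filled (xv k s * xp l s (hwpoly C n d mu)))) => [|s _]; last first.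
  by rewrite !fockE_ !ext_mvac !klinE.
rewrite -linear_sum -/(polar k l _) (hwpoly_polar C mu_mono mu0 rn rd); last by lia.
have -> : (k == l) = false by rewrite -val_eqE /=; lia.
by rewrite mul0r scale0r linear0.
Qed.

Lemma fock_diag_l i :
  fockE (lshift n i) (lshift n i) fock_hw = (lam i)%:R *: fock_hw.
Proof.
rewrite fockE_def (eq_bigr (fun s : 'I_d => (s < lam i)%N%:R *: fock_hw)) => [|s _]; last first.
  rewrite !fockE_; case: (ltnP s (lam i)) => si.
    have := man_mcr (i, s) (i, s) fock_hw; rewrite eqxx !scale1r mvac_mcr // linear0.
    by move=> /eqP; rewrite eq_sym subr_eq0 => /eqP <-.
  by rewrite mvac_man ?linear0 ?scale0r // /filled -leqNgt.
rewrite -scaler_suml -natr_sum; congr (_%:R *: _).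
rewrite -[in RHS](card_ord (lam i)) -sum1_card (big_ord_widen d (fun=> 1%N) (lam_d i)).
by rewrite [RHS]big_mkcond; apply: eq_bigr => s _; case: ltnP.
Qed.

Lemma fock_diag_r (k : 'I_n) :
  fockE (rshift m k) (rshift m k) fock_hw = (mu k)%:R *: fock_hw.
Proof.
rewrite fockE_def.
rewrite (eq_bigr (fun s => mvac K filled (xv k s * xp k s (hwpoly C n d mu)))) => [|s _]; last first.
  by rewrite !fockE_ !ext_mvac !klinE.
by rewrite -linear_sum -/(polar k k _) (hwpoly_polar C mu_mono mu0 rn rd) // eqxx mul1r linearZ.
Qed.

End Fock.

Theorem atypical_unitarizable (R : realType) (m n : nat) (lam : 'I_m -> nat) (mu : nat -> nat)
    (r : nat) (L : 'rV[R[i]]_(m + n)) (c : R[i]) :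
  (forall i j : 'I_m, (i <= j)%N -> (lam j <= lam i)%N) -> (forall i, (r <= lam i)%N) ->
  (forall i, (mu i.+1 <= mu i)%N) -> (forall i, (r <= i)%N -> mu i = 0%N) ->
  (0 < m)%N -> (r <= n)%N ->
  (forall i, L 0 (lshift n i) = (lam i)%:R + c) ->
  (forall k : 'I_n, L 0 (rshift m k) = (mu k)%:R - c) ->
  exists M : supermodule R m n, is_simple_hw M L /\ unitarizable M.
Proof.
move=> lam_mono lam_r mu_mono mu0 m0 rn Ll Lr.
pose d := lam (Ordinal m0).
have lam_d i : (lam i <= d)%N by exact: lam_mono.
have rd : (r <= d)%N by exact: lam_r.
have [B [_ B_var]] := mform_exists R[i] #|{: 'I_n * 'I_d}|.
have K := car_exists B #|{: 'I_m * 'I_d}|.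
pose v0 := fock_hw K lam mu.
have [b gv] := gam_vac K (fun k => [exists a : 'I_m * 'I_d, (enum_rank a == k :> nat) && filled lam a]).
(* The highest weight vector may be odd for [gam]; the parity operator is multiplied by its sign to
   make it even. *)
have sl : linear (fun w => (-1) ^+ b *: gam K w) by move=> a u w; rewrite linearP scalerDr !scalerA mulrC.
pose G := klin sl.
have sb : (-1) ^+ b * (-1) ^+ b = 1 :> R[i] by rewrite -expr2 sqrr_sign.
pose Lam : 'I_(m + n) -> R[i] := weight_of (fun i => (lam i)%:R) (fun k : 'I_n => (mu k)%:R).
have hL a : L 0 a = Lam a + (-1) ^+ odd_ix a * c.
  have [i ->|k ->] := split_ordP a; rewrite /Lam ?weight_of_l ?weight_of_r ?odd_ixl ?odd_ixr.
    by rewrite Ll mul1r.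
  by rewrite Lr expr1 mulN1r.
apply: (@superrep_unitarizable R m n _ _ (fock_superrep B_var (K := K)) (car_form K) G v0 Lam _ _ _ _ _ _ _ _
  L c hL).
- exact: fockE_adj.
- by move=> u; rewrite !klinE linearZ /= scalerA sb scale1r gam_gam.
- by move=> x y u; rewrite !(klinE sl) gam_fockE (linearZ_LR (fockE K x y)) /= !scalerA mulrC.
- by move=> u w; rewrite !klinE hformZl hformZr gam_adj rmorph_sign.
- exact: fock_hw_neq0 mu0 rd.
- by rewrite klinE gv scalerA sb scale1r.
- exact: (fock_raise K lam_mono lam_r mu_mono mu0 rn rd).
- move=> a; have [i ->|k ->] := split_ordP a; rewrite /Lam ?weight_of_l ?weight_of_r.
    exact: fock_diag_l.
  exact: (fock_diag_r _ _ mu_mono mu0 rn rd).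
Qed.

(** * Sufficiency *)

Section EvenExtension.
Variables (R : realType) (m n : nat).
Local Notation C := R[i].
Local Notation mx := 'M[C]_(m + n).
Local Notation g0 := (@sl_part R m n false).
Hypothesis m_gt0 : (0 < m)%N.
Variables (V : lmodType C) (act : mx -> {linear V -> V}).
Hypothesis act_lin : action_linear g0 act.
Hypothesis act_br : forall X Y v, X \in g0 -> Y \in g0 ->
  act (sbracket false false X Y) v = act X (act Y v) - act Y (act X v).
Variables (s : C) (B : hform V).
Implicit Types (A : 'M[C]_m) (D : 'M[C]_n).

Let m_neq0 : m%:R != 0 :> C. Proof. by rewrite pnatr_eq0 -lt0n. Qed.

(* The action of sl(m|n)_0 extends to gl(m) + gl(n) by letting the central element
   diag(1,..,1|0,..,0), of supertrace m, act by the scalar s. *)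
Definition nstr A D : C := (\tr A - \tr D) / m%:R.

Definition sl_shift A D : mx := block_mx (A - (nstr A D)%:M) 0 0 D.

Lemma sl_shift_in A D : sl_shift A D \in g0.
Proof.
rewrite !inE /sl_shift block_mxKul block_mxKdr block_mxKur block_mxKdl !eqxx !andbT.
by rewrite raddfB /= mxtrace_scalar -[_ *+ m]mulr_natr /nstr divfK // subr_eq0; apply/eqP; ring.
Qed.

Lemma nstrP a A A' D D' : nstr (a *: A + A') (a *: D + D') = a * nstr A D + nstr A' D'.
Proof. by rewrite /nstr !mxtraceD !mxtraceZ; ring. Qed.

Lemma sl_shiftP a A A' D D' :
  sl_shift (a *: A + A') (a *: D + D') = a *: sl_shift A D + sl_shift A' D'.
Proof.
rewrite /sl_shift scale_block_mx add_block_mx !scaler0 !addr0 nstrP; congr (block_mx _ _ _ _).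
by apply/matrixP => i j; rewrite !mxE; case: (i == j); rewrite ?mulr1n ?mulr0n; ring.
Qed.

Lemma nstr_comm A A' D D' : nstr (A *m A' - A' *m A) (D *m D' - D' *m D) = 0.
Proof.
have h k (X Y : 'M[C]_k) : \tr (X *m Y - Y *m X) = 0.
  by rewrite linearB /= mxtrace_mulC subrr.
by rewrite /nstr !h subrr mul0r.
Qed.

Lemma sl_shift_comm A A' D D' :
  sbracket false false (sl_shift A D) (sl_shift A' D')
  = sl_shift (A *m A' - A' *m A) (D *m D' - D' *m D).
Proof.
rewrite /sbracket expr0 scale1r [RHS]/sl_shift nstr_comm /sl_shift !mulmx_block.
rewrite !mulmx0 !mul0mx !addr0 !add0r opp_block_mx add_block_mx oppr0 !addr0.
have -> : 0%:M = 0 :> 'M[C]_m by exact: raddf0.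
rewrite subr0; congr (block_mx _ _ _ _).
rewrite !mulmxBl !mulmxBr !mul_scalar_mx !mul_mx_scalar !scale_scalar_mx.
set a := nstr A D; set b := nstr A' D'.
by apply/matrixP => i j; rewrite !mxE [b * a]mulrC; ring.
Qed.

Definition ext_act A D : {linear V -> V} :=
  klin (linear_addf (linearP (act (sl_shift A D)))
    (linearP ((nstr A D * s) \*: (idfun : {linear V -> V}) : {linear V -> V}))).

Lemma ext_actE A D v : ext_act A D v = act (sl_shift A D) v + (nstr A D * s) *: v.
Proof. exact: klinE. Qed.

Lemma ext_actP a A A' D D' v :
  ext_act (a *: A + A') (a *: D + D') v = a *: ext_act A D v + ext_act A' D' v.
Proof.
rewrite !ext_actE sl_shiftP act_lin ?sl_shift_in // nstrP mulrDl scalerDl.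
by rewrite -mulrA -scalerA scalerDr addrACA.
Qed.

Lemma ext_act00 v : ext_act 0 0 v = 0.
Proof.
have := ext_actP (-1) 0 0 0 0 v; rewrite !scaler0 !addr0 scaleN1r => e.
by rewrite e addNr.
Qed.

Lemma ext_actD A A' D D' v : ext_act (A + A') (D + D') v = ext_act A D v + ext_act A' D' v.
Proof. by have := ext_actP 1 A A' D D' v; rewrite !scale1r. Qed.

Lemma ext_actZ a A D v : ext_act (a *: A) (a *: D) v = a *: ext_act A D v.
Proof. by have := ext_actP a A 0 D 0 v; rewrite !addr0 ext_act00 addr0. Qed.

Lemma ext_act_comm A A' D D' v : ext_act A D (ext_act A' D' v)
  = ext_act A' D' (ext_act A D v) + ext_act (A *m A' - A' *m A) (D *m D' - D' *m D) v.
Proof.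
have := ext_actE (A *m A' - A' *m A) (D *m D' - D' *m D) v.
rewrite nstr_comm mul0r scale0r addr0 -sl_shift_comm act_br ?sl_shift_in // => ->.
rewrite !ext_actE !(linearD (act _)) !(linearZ_LR (act _)) /=.
by apply: (hform_inj (B := B)) => z; rewrite !(hformDl, hformNl, hformZl); ring.
Qed.

Hypothesis act_adj : forall X u w, X \in g0 -> B (act X u) w = B u (act (omega_plus X) w).
Hypothesis s_real : s^* = s.

Lemma nstr_ctrmx A D : nstr (ctrmx A) (ctrmx D) = (nstr A D)^*.
Proof.
have h k (X : 'M[C]_k) : \tr (ctrmx X) = (\tr X)^*.
  by rewrite /ctrmx mxtrace_tr /mxtrace rmorph_sum; apply: eq_bigr => i _; rewrite mxE.
by rewrite /nstr !h fmorph_div rmorphB rmorph_nat.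
Qed.

Lemma omega_sl_shift A D : omega_plus (sl_shift A D) = sl_shift (ctrmx A) (ctrmx D).
Proof.
rewrite /omega_plus /sl_shift block_mxKul block_mxKdr block_mxKur block_mxKdl nstr_ctrmx.
congr (block_mx _ _ _ _); apply/matrixP => i j; rewrite !mxE ?rmorph0 //.
by rewrite rmorphB rmorphMn [j == i]eq_sym.
Qed.

Lemma ext_act_adj A D u w : B (ext_act A D u) w = B u (ext_act (ctrmx A) (ctrmx D) w).
Proof.
rewrite !ext_actE hformDl hformDr act_adj ?sl_shift_in // omega_sl_shift hformZl hformZr.
by rewrite nstr_ctrmx rmorphM /= s_real conjCK.
Qed.

Variables (L : 'rV[C]_(m + n)) (v0 : V) (c : C).
Hypothesis v0_hw : hw_vector g0 act L v0.
Hypothesis s_def : s = \sum_i L 0 (lshift n i) - m%:R * c.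

Lemma ext_act_raise A D : (forall i j : 'I_m, (j <= i)%N -> A i j = 0) ->
  (forall i j : 'I_n, (j <= i)%N -> D i j = 0) -> ext_act A D v0 = 0.
Proof.
move=> hA hD; have [_ _ up] := v0_hw.
have st0 : nstr A D = 0.
  by rewrite /nstr /mxtrace !big1 ?subrr ?mul0r // => i _; rewrite ?hA ?hD.
rewrite ext_actE st0 mul0r scale0r addr0 up ?sl_shift_in // inE.
apply/forallP => a; apply/forallP => b; apply/implyP; rewrite /sl_shift st0.
have [i ->|k ->] := split_ordP a; have [j ->|l ->] := split_ordP b => /= ba.
- by rewrite block_mxEul !mxE hA // mul0rn subr0.
- by have := ltn_ord i; lia.
- by rewrite block_mxEdl mxE.
- by rewrite block_mxEdr hD //; lia.
Qed.

(** By the choice of [s] the central element acts by the sum of the [L i - c] over i < m, so every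
    diagonal matrix acts through the tuple shifted by c. *)
Lemma ext_act_diag A D : is_diag_mx A -> is_diag_mx D -> ext_act A D v0
  = (\sum_i (L 0 (lshift n i) - c) * A i i + \sum_k (L 0 (rshift m k) + c) * D k k) *: v0.
Proof.
move=> hA hD; have [_ dg _] := v0_hw; rewrite ext_actE dg ?sl_shift_in //; last first.
  apply/is_diag_mxP => a b; rewrite /sl_shift.
  have [i ->|k ->] := split_ordP a; have [j ->|l ->] := split_ordP b => /= ba.
  - rewrite block_mxEul !mxE (is_diag_mxP hA) ?sub0r //.
    by have /negPf -> : i != j by []; rewrite mulr0n oppr0.
  - by rewrite block_mxEur mxE.
  - by rewrite block_mxEdl mxE.
  - by rewrite block_mxEdr (is_diag_mxP hD) //; move: ba; rewrite eqn_add2l.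
rewrite -scalerDl; congr (_ *: _); rewrite /weight_eval big_split_ord /=.
rewrite (eq_bigr (fun i => L 0 (lshift n i) * A i i - nstr A D * L 0 (lshift n i))); last first.
  by move=> i _; rewrite /sl_shift block_mxEul !mxE eqxx mulr1n; ring.
rewrite [X in _ + X + _](eq_bigr (fun k => L 0 (rshift m k) * D k k)); last first.
  by move=> k _; rewrite /sl_shift block_mxEdr.
rewrite sumrB -mulr_sumr s_def mulrBr.
under [in RHS]eq_bigr => i _ do rewrite mulrBl.
under [X in _ = _ + X]eq_bigr => i _ do rewrite mulrDl.
rewrite sumrB big_split /= -!mulr_sumr -/(\tr A) -/(\tr D).
have e : nstr A D * m%:R = \tr A - \tr D by rewrite /nstr divfK.
by ring: e.
Qed.

Definition evA i j := ext_act (delta_mx i j) 0.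
Definition evD k l := ext_act 0 (delta_mx k l).

Lemma ext_act_span A D v :
  ext_act A D v = \sum_i \sum_j A i j *: evA i j v + \sum_k \sum_l D k l *: evD k l v.
Proof.
have sum_l k (X : 'I_k -> 'M[C]_m) : ext_act (\sum_i X i) 0 v = \sum_i ext_act (X i) 0 v.
  elim/big_ind2: _ => [|x x' y y' <- <-|//]; first exact: ext_act00.
  by rewrite -ext_actD addr0.
have sum_r k (X : 'I_k -> 'M[C]_n) : ext_act 0 (\sum_i X i) v = \sum_i ext_act 0 (X i) v.
  elim/big_ind2: _ => [|x x' y y' <- <-|//]; first exact: ext_act00.
  by rewrite -ext_actD addr0.
rewrite -{1}[A]addr0 -{1}[D]add0r ext_actD {1}[A]matrix_sum_delta {1}[D]matrix_sum_delta.
rewrite sum_l sum_r; congr (_ + _); apply: eq_bigr => i _.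
  by rewrite sum_l; apply: eq_bigr => j _; rewrite -(ext_actZ (A i j)) scaler0.
by rewrite sum_r; apply: eq_bigr => j _; rewrite -(ext_actZ (D i j)) scaler0.
Qed.

Lemma delta_comm k (a b x y : 'I_k) :
  delta_mx a b *m delta_mx x y - delta_mx x y *m delta_mx a b
  = (b == x)%:R *: delta_mx a y - (y == a)%:R *: delta_mx x b :> 'M[C]_k.
Proof. by rewrite !mul_delta_mx_cond !scaler_nat. Qed.

Lemma evA_evA i j k l v :
  evA i j (evA k l v) = evA k l (evA i j v) + (j == k)%:R *: evA i l v - (l == i)%:R *: evA k j v.
Proof.
rewrite /evA ext_act_comm delta_comm mulmx0 subr0 -addrA; congr (_ + _).
rewrite -(ext_actZ (j == k)%:R) -scaleNr -(ext_actZ (- _)) -ext_actD !scaler0 addr0.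
by rewrite scaleNr.
Qed.

Lemma evD_evD i j k l v :
  evD i j (evD k l v) = evD k l (evD i j v) + (j == k)%:R *: evD i l v - (l == i)%:R *: evD k j v.
Proof.
rewrite /evD ext_act_comm delta_comm mulmx0 subr0 -addrA; congr (_ + _).
rewrite -(ext_actZ (j == k)%:R) -scaleNr -(ext_actZ (- _)) -ext_actD !scaler0 addr0.
by rewrite scaleNr.
Qed.

Lemma evA_evD i j k l v : evA i j (evD k l v) = evD k l (evA i j v).
Proof. by rewrite /evA /evD ext_act_comm !mulmx0 !mul0mx !subrr ext_act00 addr0. Qed.

Lemma ctrmx_delta k (a b : 'I_k) : ctrmx (delta_mx a b) = delta_mx b a :> 'M[C]_k.
Proof. by apply/matrixP => x y; rewrite !mxE rmorph_nat andbC. Qed.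

Lemma ctrmx0 k : ctrmx (0 : 'M[C]_k) = 0.
Proof. by apply/matrixP => x y; rewrite !mxE rmorph0. Qed.

Lemma evA_adj i j u w : B (evA i j u) w = B u (evA j i w).
Proof. by rewrite /evA ext_act_adj ctrmx_delta ctrmx0. Qed.

Lemma evD_adj i j u w : B (evD i j u) w = B u (evD j i w).
Proof. by rewrite /evD ext_act_adj ctrmx_delta ctrmx0. Qed.

Lemma delta_upper k (a b : 'I_k) : (a < b)%N ->
  forall i j : 'I_k, (j <= i)%N -> delta_mx a b i j = 0 :> C.
Proof.
move=> ab i j ji; rewrite mxE; case: (eqVneq i a) => //= ia; case: (eqVneq j b) => //= jb.
by rewrite ia jb in ji; lia.
Qed.

Lemma evA_raise (i j : 'I_m) : (i < j)%N -> evA i j v0 = 0.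
Proof. by move=> ij; apply: ext_act_raise => [|a b _]; [exact: delta_upper|rewrite mxE]. Qed.

Lemma evD_raise (i j : 'I_n) : (i < j)%N -> evD i j v0 = 0.
Proof. by move=> ij; apply: ext_act_raise => [a b _|]; [rewrite mxE|exact: delta_upper]. Qed.

Lemma delta_diag k (a : 'I_k) : is_diag_mx (delta_mx a a : 'M[C]_k).
Proof.
apply/is_diag_mxP => i j ij; rewrite mxE; case: (eqVneq i a) => //= ia.
by case: (eqVneq j a) => //= ja; rewrite ia ja eqxx in ij.
Qed.

Lemma sum_delta_diag k (F : 'I_k -> C) a : \sum_i F i * delta_mx a a i i = F a.
Proof.
rewrite (bigD1 a) //= big1 ?addr0 => [|i /negPf ia]; last by rewrite mxE ia mulr0.
by rewrite mxE eqxx mulr1.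
Qed.

Lemma evA_diag i : evA i i v0 = (L 0 (lshift n i) - c) *: v0.
Proof.
rewrite /evA ext_act_diag ?delta_diag ?mx0_is_diag // sum_delta_diag.
by rewrite [X in _ + X]big1 ?addr0 // => k _; rewrite mxE mulr0.
Qed.

Lemma evD_diag k : evD k k v0 = (L 0 (rshift m k) + c) *: v0.
Proof.
rewrite /evD ext_act_diag ?delta_diag ?mx0_is_diag // sum_delta_diag.
by rewrite [X in X + _]big1 ?add0r // => i _; rewrite mxE mulr0.
Qed.

Hypothesis v0_gen : forall N, subspace N -> stable g0 act N -> N v0 -> forall w, N w.

Lemma ev_gen (N : V -> Prop) : submod N -> N v0 -> (forall i j v, N v -> N (evA i j v)) ->
  (forall i j v, N v -> N (evD i j v)) -> forall v, N v.
Proof.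
move=> hN Nv hA hD; apply: v0_gen => // X v; rewrite inE /= => /andP[Xsl /andP[/eqP ur /eqP dl]] Nw.
have -> : act X v = ext_act (ulsubmx X) (drsubmx X) v.
  have st0 : nstr (ulsubmx X) (drsubmx X) = 0.
    by rewrite /nstr; move: Xsl; rewrite inE => /eqP ->; rewrite mul0r.
  rewrite ext_actE st0 mul0r scale0r addr0 /sl_shift st0.
  have -> : 0%:M = 0 :> 'M[C]_m by exact: raddf0.
  by rewrite subr0 -[in LHS](submxK X) ur dl.
rewrite ext_act_span; apply: submodD => //; do 2![apply: submod_sum => // ? _]; apply: submodZ => //;
  auto.
Qed.

End EvenExtension.

(** * Integrality of weights by sl_2-strings *)

Section Integrality.
Variables (R : realType) (N : nat) (V : lmodType R[i]) (B : hform V).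
Local Notation C := R[i].
Variables (A : 'I_N -> 'I_N -> {linear V -> V}) (v0 : V) (lam : 'I_N -> C).
Hypothesis A_A : forall i j k l v,
  A i j (A k l v) = A k l (A i j v) + (j == k)%:R *: A i l v - (l == i)%:R *: A k j v.
Hypothesis A_adj : forall i j u w, B (A i j u) w = B u (A j i w).
Hypothesis A_raise : forall i j : 'I_N, (i < j)%N -> A i j v0 = 0.
Hypothesis A_diag : forall i, A i i v0 = lam i *: v0.
Hypothesis v0_neq0 : v0 != 0.

Lemma natr_of_complex_bound (x : C) : 0 <= x -> ~ (forall k : nat, k%:R < x).
Proof.
move=> x0 h; have [r xr] : exists r : R, x = r%:C%C.
  exists (complex.Re x); apply/eqP; rewrite eq_complex /= eqxx.
  by move: x0; rewrite lecE /= => /andP[].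
have r0 : 0 <= r by move: x0; rewrite xr -(rmorph0 (real_complex R)) lecR.
have := h (Num.bound r); rewrite xr -(rmorph_nat (real_complex R)) ltcR => /lt_trans /(_ (archi_boundP r0)).
by rewrite ltxx.
Qed.

(** Each step along the string [f] multiplies the squared norm by (k + 1) (x - k). If x is not a
    natural number no [f k] vanishes, and positivity gives x > k for every k, which is
    impossible. *)
Lemma gl_integral (i j : 'I_N) : (i < j)%N -> 0 <= lam i - lam j ->
  exists k : nat, lam i - lam j = k%:R.
Proof.
move=> ij x0; set x := lam i - lam j in x0 *.
have nij : (i == j) = false by rewrite -val_eqE /= ltn_eqF.
pose f k := iter k (A j i) v0.
have fh k : A i i (f k) - A j j (f k) = (x - k%:R *+ 2) *: f k.
  elim: k => [|k IH]; first by rewrite !A_diag -scalerBl mulr0n mul0rn subr0.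
  rewrite /= A_A [A j j _]A_A nij !eqxx !scale0r !scale1r addr0 subr0.
  have e : A i i (f k) = A j j (f k) + (x - k%:R *+ 2) *: f k by rewrite -IH addrC subrK.
  rewrite -/(f k) e linearD (linearZ_LR (A j i)) /=.
  by apply: (hform_inj (B := B)) => z; rewrite !(hformDl, hformNl, hformZl) -natr1; ring.
have fe k : A i j (f k.+1) = (k.+1%:R * (x - k%:R)) *: f k.
  elim: k => [|k IH] /=.
    by rewrite A_A A_raise // linear0 !eqxx !scale1r add0r !A_diag -scalerBl mul1r mulr0n subr0.
  rewrite A_A !eqxx !scale1r -[A j i (f k)]/(f k.+1) IH -addrA fh (linearZ_LR (A j i)) /= -/(f k.+1).
  by rewrite -scalerDl; congr (_ *: _); rewrite -!natr1; ring.
apply: contrapT => nx; apply: (natr_of_complex_bound x0) => k.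
have [] : f k != 0 /\ k%:R < x.
  elim: k => [|k [fk kx]].
    split=> //; rewrite lt_neqAle x0 andbT; apply/eqP => e; apply: nx; exists 0%N.
    by rewrite e.
  have fk1 : f k.+1 != 0.
    apply/eqP => e; have := fe k; rewrite e linear0 => /esym/eqP.
    by rewrite scaler_eq0 (negPf fk) orbF mulf_eq0 pnatr_eq0 /= subr_eq0 gt_eqF.
  split=> //; have := hform_ge0 B (f k.+2).
  rewrite {1}[f k.+2]/= -/(f k.+1) A_adj fe hformZr pmulr_lge0 ?hform_pos // rmorphM rmorphB /= !conjC_nat.
  rewrite (CrealP (ger0_real x0)) pmulr_rge0 ?ltr0Sn // subr_ge0 lt_neqAle => ->.
  by rewrite andbT; apply/eqP => e; apply: nx; exists k.+1.
by [].
Qed.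

End Integrality.

Section Sufficiency.
Variables (R : realType) (m n : nat) (hm : (0 < m)%N) (hn : (0 < n)%N).
Variable L : 'rV[R[i]]_(m + n).
Local Notation Ll i := (L 0 (lshift n i)).
Local Notation Lr k := (L 0 (rshift m k)).
Local Notation im := (last_ord hm).
Local Notation kn := (last_ord hn).

Lemma last_ord_max N (hN : (0 < N)%N) (i : 'I_N) : (i <= last_ord hN)%N.
Proof. by have := ltn_ord i; rewrite /=; case: N hN i. Qed.

Lemma unitarity_sufficient : unitarity_conditions hm hn L ->
  exists M : supermodule R m n, is_simple_hw M L /\ unitarizable M.
Proof.
move=> [[V [[v0 [v0_hw v0_gen]] [f fc]]] [Ll_mono L_last Lr_mono] at_atyp at_typ].
have [B BE] := hform_of_dot f.
have act_adj X u w : X \in @sl_part R m n false -> B (em_act V X u) w = B u (em_act V (omega_plus X) w).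
  by move=> Xg; rewrite !BE fc.
have Lsum_ge0 i : 0 <= Ll i + Lr kn.
  by rewrite -[Lr kn]opprK subr_ge0; apply: le_trans L_last (Ll_mono _ _ (last_ord_max hm i)).
(* This shift makes the last mu zero and the lam nonnegative by the chain, so [s] is real. *)
pose c : R[i] := - Lr kn; pose s : R[i] := \sum_i Ll i - m%:R * c.
have sE : s = \sum_i (Ll i + Lr kn).
  by rewrite /s /c big_split /= sumr_const card_ord mulrN opprK mulr_natl.
have s_real : s^* = s by apply/CrealP/ger0_real; rewrite sE sumr_ge0.
pose A := evA (em_act V) s; pose D := evD (em_act V) s.
have v00 : v0 != 0 by case: v0_hw.
have AA := evA_evA hm (@em_linear R m n V) (@em_bracket R m n V) s B.
have DD := evD_evD hm (@em_linear R m n V) (@em_bracket R m n V) s B.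
have AD := evA_evD hm (@em_linear R m n V) (@em_bracket R m n V) s B.
have Aa := evA_adj hm act_adj s_real.
have Da := evD_adj hm act_adj s_real.
have Ar := evA_raise hm s v0_hw.
have Dr := evD_raise hm s v0_hw.
have Ad := evA_diag hm v0_hw (erefl s).
have Dd := evD_diag hm v0_hw (erefl s).
have gen := ev_gen hm (@em_linear R m n V) (s := s) v0_gen.
have w_rho k : wform (L + rho R m n) (eps R n im - del R m k) = Ll im + Lr k - k%:R by exact: wform_rho.
case: (pselect (exists k : 'I_n, wform (L + rho R m n) (eps R n im - del R m k) = 0)) => [[k wk]|typ].
  have [_] := at_atyp k wk; rewrite w_rho in wk; rewrite wform_del_del => /eqP.
  rewrite subr_eq0 => /eqP ek.
  (* After the shift lam^m equals k, because a_k = 0 and mu^k = mu^n; the other entries exceed it by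
     natural numbers. *)
  have [lam lamE] : exists lam : 'I_m -> nat, forall i, Ll i + Lr kn = (lam i)%:R.
    apply: (@fin_all_exists _ (fun=> nat) (fun i j => Ll i + Lr kn = j%:R)) => i; have lim : Ll im + Lr kn = k%:R.
      by rewrite ek; apply/eqP; rewrite -subr_eq0 wk.
    case: (ltnP i im) => [lti|]; last first.
      by move=> ii; have -> : i = im; [apply/val_inj/anti_leq; rewrite last_ord_max|exists k].
    have [|j] := gl_integral AA Aa Ar Ad v00 lti; first by rewrite opprB addrA subrK subr_ge0 Ll_mono ?last_ord_max.
    by move=> e; exists (j + k)%N; rewrite natrD -e -lim; ring.
  have [mu muE] : exists mu : 'I_n -> nat, forall l, Lr l - Lr kn = (mu l)%:R.
    apply: (@fin_all_exists _ (fun=> nat) (fun l j => Lr l - Lr kn = j%:R)) => l.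
    case: (ltnP l kn) => [ltl|]; last first.
      move=> ll; have -> : l = kn by apply/val_inj/anti_leq; rewrite last_ord_max.
      by exists 0%N; rewrite subrr.
    have [|j] := gl_integral DD Da Dr Dd v00 ltl.
      by rewrite opprD addrACA subrr addr0 subr_ge0 -lerN2 Lr_mono ?last_ord_max.
    by move=> e; exists j; rewrite -e; ring.
  pose mu' b := if insub b is Some l then mu l else 0%N.
  have mu'E (l : 'I_n) : mu' l = mu l by rewrite /mu' valK.
  have mu'0 b : (n <= b)%N -> mu' b = 0%N by move=> nb; rewrite /mu' insubF // ltnNge nb.
  apply: (@atypical_unitarizable R m n lam mu' k L c).
  - by move=> i j ij; rewrite -(ler_nat R[i]) -!lamE lerD2r Ll_mono.
  - move=> i; rewrite -(ler_nat R[i]) -lamE ek.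
    move/eqP: wk; rewrite subr_eq0 => /eqP <-; rewrite lerD2r.
    exact/Ll_mono/last_ord_max.
  - move=> b; case: (ltnP b.+1 n) => bn; last by rewrite mu'0.
    rewrite -[b.+1]/(val (Ordinal bn)) -[b]/(val (Ordinal (ltnW bn))) !mu'E.
    by rewrite -(ler_nat R[i]) -!muE lerD2r -lerN2 Lr_mono.
  - move=> b kb; case: (ltnP b n) => bn; last by rewrite mu'0.
    rewrite -[b]/(val (Ordinal bn)) mu'E; apply/eqP; rewrite -(eqr_nat R[i]) -muE subr_eq0.
    by apply/eqP/le_anti; rewrite {1}ek -lerN2 Lr_mono //= -lerN2 Lr_mono ?last_ord_max.
  - exact: hm.
  - exact/ltnW/ltn_ord.
  - by move=> i; rewrite -lamE /c; ring.
  - by move=> l; rewrite mu'E -muE /c; ring.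
(* This is a_n, which serves as the [t] of the Casimir gap. *)
have t0 : 0 < Ll im + Lr kn - kn%:R.
  by rewrite -w_rho; apply: at_typ => k e; apply: typ; exists k.
apply: (typical_unitarizable AA DD AD Aa Da Ar Dr Ad Dd gen v00 t0 _ (c := c)).
- move=> i k; rewrite -[n.-1]/(nat_of_ord kn) subrK addrACA addNr addr0.
  by rewrite lerD ?Ll_mono ?last_ord_max // -lerN2 Lr_mono ?last_ord_max.
- by move=> i; rewrite subrK.
- by move=> k; rewrite addrK.
Qed.

End Sufficiency.

Theorem theorem1 (R : realType) (m n : nat) (hm : (0 < m)%N) (hn : (0 < n)%N)
    (hmn : (2 < m + n)%N) (L : 'rV[R[i]]_(m + n)) :
  (exists M : supermodule R m n, is_simple_hw M L /\ unitarizable M)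
  <-> (unitarity_conditions hm hn L /\ condition_b hm hn L).
Proof.
split=> [[M [[_ M_hw] M_unit]]|[hL _]]; first exact: unitarizable_conditions M_hw M_unit.
exact: unitarity_sufficient hL.
Qed.
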